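(* Let $M>(2\pi)^{2/3}$ and $s>1/2$. Set $\mathcal P_N=(P_f^N)_{f\in\widetilde{\mathcal F}(M,s)}$ and $\mathcal Q_N=(Q_f^N)_{f\in\widetilde{\mathcal F}(M,s)}$. Let $(\alpha_N)_{N\geq1}$ be a sequence of positive real numbers such that $\alpha_N\to0$ and $\alpha_N^2N\to\infty$ as $N\to\infty$. Then $$\liminf_{N\to\infty}\ \mathcal D_{\mathrm{LC},\alpha_N}\bigl(\mathcal P_N\,\big\|\,\mathcal Q_N\bigr)\ \geq\ \frac12 .$$
   Context: A spectral density is a nonnegative, integrable, even function $f$ on $[-\pi,\pi]$; $\gamma_f(h)=\int_{-\pi}^{\pi}f(\lambda)e^{ih\lambda}\,d\lambda$, $h\in\mathbb Z$, and $\rho_f(h)=\gamma_f(h)/\gamma_f(0)$ when $\gamma_f(0)>0$. $\widetilde{\mathcal F}(M,s)$ is the set of spectral densities $f$ such that $f\geq 1/M$ and $\gamma_f(0)^2\big(1+\sum_{h\in\mathbb Z\setminus\{0\}}|h|^{2s}|\rho_f(h)|^2\big)\leq M$. $P_f^N$ is the law on $\mathbb R^N$ of $(X_1,\dots,X_N)$, where $(X_t)_{t\in\mathbb Z}$ is a centered real stationary Gaussian process with $\operatorname{Cov}(X_0,X_h)=\gamma_f(h)$. $Q_f^N$ is the law on $\mathbb R^N$ of a centered Gaussian vector $(Y_1,\dots,Y_N)$ with independent components $Y_j\sim\mathcal N(0,J_{j,N}(f))$, $J_{j,N}(f)=\frac{N}{2\pi}\int_{2(j-1)\pi/N}^{2j\pi/N}f(\lambda)\,d\lambda$,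 where $f$ is extended to $\mathbb R$ by $2\pi$-periodicity. $\mathcal M_\alpha$ is the class of all Markov kernels $K$ from $\mathbb R$ to an arbitrary standard Borel space such that $K(S\mid x)\le e^\alpha K(S\mid x')$ for all $x,x'\in\mathbb R$ and all measurable $S$ in the output space. $\mathcal M_\alpha^N$ is the set of tuples $K_{1:N}=(K_1,\dots,K_N)$ with each $K_i\in\mathcal M_\alpha$. For a kernel $K$ and probability measure $P$, $(K\circ P)(A)=\int K(A\mid x)\,P(dx)$; for a tuple, $K_{1:N}\circ P$ is the law determined by $(K_{1:N}\circ P)(A_1\times\cdots\times A_N)=\int\prod_{i=1}^NK_i(A_i\mid x_i)\,P(dx)$. $\|P-Q\|_{\mathrm{TV}}=\sup_A|P(A)-Q(A)|$ over measurable sets $A$. For two models $\mathcal P_N=(P_f^N)_{f\in\mathcal G}$ and $\mathcal Q_N=(Q_f^N)_{f\in\mathcal G}$ on $\mathbb R^N$ and $\alpha>0$, the LDP deficiency is $$\mathcal D_{\mathrm{LC},\alpha}(\mathcal P_N\|\mathcal Q_N)=\sup_{K_{1:N}\in\mathcal M_\alpha^N}\ \inf_{K'_{1:N}\in\mathcal M_\alpha^N,\ L'}\ \sup_{f\in\mathcal G}\left\|L'\circ K'_{1:N}\circ P_f^N-K_{1:N}\circ Q_f^N\right\|_{\mathrm{TV}},$$ where $L'$ ranges over all Markov kernels from the output space of $K'_{1:N}$ to that of $K_{1:N}$. *)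

(* Defs.v *)
(* MathComp-Analysis *)
From HB Require Import structures.
From mathcomp Require Import all_boot all_order all_algebra.
From mathcomp Require Import all_classical all_reals all_analysis.
From mathcomp Require Import measurable_realfun.

Set Implicit Arguments.
Unset Strict Implicit.
Unset Printing Implicit Defensive.

Import Order.TTheory GRing.Theory Num.Theory.
Import numFieldNormedType.Exports.

Local Open Scope classical_set_scope.
Local Open Scope ring_scope.

Section total_variation.
Context d (T : measurableType d) (R : realType).

Definition tv_dist (P Q : set T -> \bar R) : \bar R :=
  ereal_sup [set `|P A - Q A|%E | A in measurable].

End total_variation.

Section kernel_image.
Context d d' (X : measurableType d) (Y : measurableType d') (R : realType).
Variables (K : R.-pker X ~> Y) (P : probability X R).

Definition kimage (A : set Y) : \bar R := (\int[P]_x K x A)%E.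

Let kimage0 : kimage set0 = 0%E.
Proof. by rewrite /kimage integral0_eq. Qed.

Let kimage_ge0 A : (0 <= kimage A)%E.
Proof. exact: integral_ge0. Qed.

Let kimage_sigma_additive : semi_sigma_additive kimage.
Proof.
move=> U mU tU mUU; rewrite [X in _ --> X](_ : _ =
    (\int[P]_x (\sum_(n <oo) K x (U n)))%E); last first.
  apply: eq_integral => x _.
  by apply/esym/cvg_lim => //; exact/measure_semi_sigma_additive.
rewrite integral_nneseries//; last by move=> n; exact: measurable_kernel.
by apply: is_cvg_nneseries => n _ _; exact: integral_ge0.
Qed.

HB.instance Definition _ := isMeasure.Build _ _ _ kimage
  kimage0 kimage_ge0 kimage_sigma_additive.

Let kimageT : kimage setT = 1%E.
Proof.
rewrite /kimage (eq_integral (cst 1%E)); last by move=> x _; exact: prob_kernel.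
rewrite integral_cst// mul1e; exact: probability_setT.
Qed.

HB.instance Definition _ := Measure_isProbability.Build _ _ _ kimage kimageT.

End kernel_image.

Section finite_product.
Context (N : nat) (d : 'I_N -> measure_display)
  (Y : forall i, measurableType (d i)).

(* product sigma-algebra on a heterogeneous finite product *)
Definition fprodT := forall i, Y i.

Definition fprod_cylinders : set (set fprodT) :=
  [set C | exists i (B : set (Y i)),
     measurable B /\ C = [set y : fprodT | B (y i)]].

HB.instance Definition _ := Pointed.copy fprodT (forall i, Y i).

Let fprod0 : <<s fprod_cylinders >> set0.
Proof. exact: sigma_algebra0. Qed.

Let fprodC A : <<s fprod_cylinders >> A -> <<s fprod_cylinders >> (~` A).
Proof. exact: sigma_algebraC. Qed.

Let fprod_bigcup (F : (set fprodT)^nat) :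
  (forall i, <<s fprod_cylinders >> (F i)) ->
  <<s fprod_cylinders >> (\bigcup_i F i).
Proof. exact: sigma_algebra_bigcup. Qed.

HB.instance Definition _ := @isMeasurable.Build (sigma_display fprod_cylinders)
  fprodT <<s fprod_cylinders >> fprod0 fprodC fprod_bigcup.

End finite_product.
Arguments fprod_cylinders {N d} Y _.

Section finite_product_theory.
Context (N : nat) (d : 'I_N -> measure_display)
  (Y : forall i, measurableType (d i)).

Lemma measurable_fproj (i : 'I_N) : measurable_fun [set: fprodT Y] (@^~ i).
Proof.
move=> _ B mB; rewrite setTI; apply: sub_sigma_algebra.
by exists i, B.
Qed.

Lemma measurable_fun_fprodP d0 (X : measurableType d0) (g : X -> fprodT Y) :
  (forall i, measurable_fun [set: X] (fun x => g x i)) ->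
  measurable_fun [set: X] g.
Proof.
move=> mg; apply: (@measurability _ _ X (fprodT Y) _ g (fprod_cylinders Y)) => //.
by move=> _ [_ [i [B [mB ->]]] <-]; exact: mg.
Qed.

Lemma measurable_box (A : forall i, set (Y i)) :
  (forall i, measurable (A i)) ->
  measurable [set y : fprodT Y | forall i, A i (y i)].
Proof.
move=> mA; rewrite (_ : mkset _ = \bigcap_(i in [set: 'I_N]) (@^~ i) @^-1` A i).
  apply: fin_bigcap_measurable => // i _.
  by rewrite -[X in measurable X]setTI; exact: measurable_fproj.
by apply/seteqP; split => y /= h i; [move=> _; exact: h|exact: h].
Qed.

End finite_product_theory.
Arguments measurable_fproj {N d Y} i _.

Section pker_comp.
Import KCOMP_FINITE_KERNEL.
Context d1 d2 d3 (X : measurableType d1) (Y : measurableType d2)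
  (Z : measurableType d3) (R : realType).
Variables (l : R.-pker X ~> Y) (k : R.-pker (X * Y) ~> Z).

Definition pkcomp : X -> {measure set Z -> \bar R} := (l \; k)%E.

HB.instance Definition _ := Kernel.on pkcomp.

Let pkcomp_prob x : pkcomp x [set: Z] = 1%E.
Proof.
rewrite /pkcomp /= /kcomp (eq_integral (cst 1%E)); last first.
  by move=> y _; exact: prob_kernel.
by rewrite integral_cst// mul1e; exact: prob_kernel.
Qed.

HB.instance Definition _ := Kernel_isProbability.Build _ _ _ _ _
  pkcomp pkcomp_prob.

End pker_comp.

Section product_kernel.
Context (N : nat) (R : realType) (d : 'I_N -> measure_display)
  (Y : forall i, measurableType (d i))
  (K : forall i, R.-pker (measurableTypeR R) ~> Y i).
Local Notation RN := (N.-tuple (measurableTypeR R)).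

Section resample.
Variable i : 'I_N.

Definition coord_kernel (u : RN * fprodT Y) : {measure set (Y i) -> \bar R} :=
  K i (tnth u.1 i).

Let measurable_coord_kernel U : measurable U ->
  measurable_fun [set: RN * fprodT Y] (coord_kernel ^~ U).
Proof.
move=> mU; have mp : measurable_fun [set: RN * fprodT Y] (fun u => tnth u.1 i).
  exact: (measurableT_comp (measurable_tnth i) measurable_fst).
exact: (measurableT_comp (measurable_kernel (K i) U mU) mp).
Qed.

HB.instance Definition _ :=
  isKernel.Build _ _ _ _ _ coord_kernel measurable_coord_kernel.

Let coord_kernel_prob u : coord_kernel u [set: Y i] = 1%E.
Proof. exact: prob_kernel. Qed.

HB.instance Definition _ :=
  Kernel_isProbability.Build _ _ _ _ _ coord_kernel coord_kernel_prob.

Definition put_coord (v : (RN * fprodT Y) * Y i) : fprodT Y :=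
  dfwith v.1.2 i v.2.

Lemma measurable_put_coord : measurable_fun setT put_coord.
Proof.
apply: measurable_fun_fprodP => j; rewrite /put_coord.
have [ij|ij] := eqVneq i j.
  case: j / ij; rewrite (_ : (fun x => _) = snd)//.
  by apply/funext => x; rewrite dfwithin.
rewrite (_ : (fun x => _) = (fun y : fprodT Y => y j) \o snd \o fst); last first.
  by apply/funext => x; rewrite dfwithout.
exact: (measurableT_comp (measurable_fproj j)
  (measurableT_comp measurable_snd measurable_fst)).
Qed.

Definition resample : R.-pker (RN * fprodT Y) ~> fprodT Y :=
  pkcomp coord_kernel (kdirac measurable_put_coord).

End resample.

(* Product kernel: start from an arbitrary point and redraw each coordinate i
   once from K i; see fprod_kernel_box. *)
Fixpoint fprod_kernel_seq (s : seq 'I_N) : R.-pker RN ~> fprodT Y :=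
  match s with
  | [::] => kdirac (@measurable_cst _ _ RN (fprodT Y) setT (point : fprodT Y))
  | i :: s' => pkcomp (fprod_kernel_seq s') (resample i)
  end.

Definition fprod_kernel : R.-pker RN ~> fprodT Y :=
  fprod_kernel_seq (enum 'I_N).

Lemma resampleE i x y (B : set (fprodT Y)) : measurable B ->
  resample i (x, y) B = K i (tnth x i) [set z | B (dfwith y i z)].
Proof.
move=> mB; rewrite /resample /= /pkcomp /= /kcomp /=.
rewrite (_ : (fun z => _) = fun z => (\1_[set z | B (dfwith y i z)] z)%:E)//.
rewrite integral_indic//=; first by rewrite setIT.
have mf : measurable_fun setT (fun z : Y i => (dfwith y i z : fprodT Y)).
  rewrite (_ : (fun z => _) =
    @put_coord i \o pair (x, y))//.
  apply: measurableT_comp; [exact: measurable_put_coord|].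
  exact: measurable_pair1.
by rewrite -[X in measurable X]setTI; exact: mf.
Qed.

Lemma fprod_kernel_seq_box (s : seq 'I_N) x (A : forall i, set (Y i)) :
  uniq s -> (forall i, measurable (A i)) ->
  fprod_kernel_seq s x [set y : fprodT Y | forall i, i \in s -> A i (y i)] =
  (\prod_(i <- s) K i (tnth x i) (A i))%E.
Proof.
move=> + mA; have mbox (s' : seq 'I_N) :
    measurable [set y : fprodT Y | forall i, i \in s' -> A i (y i)].
  rewrite (_ : mkset _ =
    [set y : fprodT Y | forall i, (if i \in s' then A i else setT) (y i)]).
    apply: (@measurable_box _ _ Y (fun i => if i \in s' then A i else setT)).
    by move=> i; case: ifP.
  by apply/seteqP; split => y /= h i; have := h i; case: ifP => // _; exact.
elim: s => [_|i s IH /= /andP[nis us]].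
  rewrite big_nil /= /kdirac /= (_ : mkset _ = setT) ?diracT//.
  by apply/seteqP; split.
rewrite big_cons -IH// /pkcomp /= /kcomp /=.
set B := [set y : fprodT Y | forall j, j \in s -> A j (y j)].
rewrite (eq_integral (fun y => K i (tnth x i) (A i) * (\1_B y)%:E)%E).
  have mB : measurable B := mbox s.
  rewrite ge0_integralZl//=; last first.
    by apply/measurable_EFinP; exact: measurable_indic.
  by rewrite integral_indic//= setIT.
move=> y _; apply: etrans (resampleE i x y (mbox (i :: s))) _.
rewrite indicE; have [yB|yB] := boolP (y \in B).
  rewrite mule1; congr (K i _ _); apply/seteqP; split => z /=.
    by move=> /(_ i); rewrite mem_head dfwithin; exact.
  move=> Az j; rewrite inE => /predU1P[->|js]; first by rewrite dfwithin.
  rewrite dfwithout; first by move: yB; rewrite inE; exact.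
  by apply: contraNneq nis => ->.
rewrite mule0 (_ : mkset _ = set0) ?measure0//.
apply/seteqP; split => z //= h; move/negP: yB; apply; rewrite inE => j js.
have := h j; rewrite inE js orbT dfwithout; first exact.
by apply: contraNneq nis => ->.
Qed.

Lemma fprod_kernel_box x (A : forall i, set (Y i)) :
  (forall i, measurable (A i)) ->
  fprod_kernel x [set y : fprodT Y | forall i, A i (y i)] =
  (\prod_(i < N) K i (tnth x i) (A i))%E.
Proof.
move=> mA; rewrite -big_enum -fprod_kernel_seq_box ?enum_uniq//.
congr (fprod_kernel _ _); apply/seteqP; split => y /= h i //.
by apply: h; rewrite mem_enum.
Qed.

End product_kernel.

Lemma kimage_fprod_kernel_box (N : nat) (R : realType)
    (d : 'I_N -> measure_display) (Y : forall i, measurableType (d i))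
    (K : forall i, R.-pker (measurableTypeR R) ~> Y i)
    (P : probability (N.-tuple (measurableTypeR R)) R)
    (A : forall i, set (Y i)) : (forall i, measurable (A i)) ->
  kimage (fprod_kernel K) P [set y : fprodT Y | forall i, A i (y i)] =
  (\int[P]_x (\prod_(i < N) K i (tnth x i) (A i)))%E.
Proof.
by move=> mA; apply: eq_integral => x _; exact: fprod_kernel_box.
Qed.

(* Borel isomorphism with a Polish space: a complete, second countable
   pseudometric space that is Hausdorff, hence metrizable *)
Definition standard_borel (R : realType) d (Y : measurableType d) : Prop :=
  exists (T : completePseudoMetricType R) (g : Y -> T),
    [/\ hausdorff_space T, @second_countable T, bijective g &
        forall A : set T, <<s [set U : set T | open U] >> A <->
                          measurable (g @^-1` A)].

Record ldp_mechanism (R : realType) (alpha : R) := LdpMechanism {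
  mech_disp : measure_display;
  mech_out : measurableType mech_disp;
  mech_ker :> R.-pker (measurableTypeR R) ~> mech_out;
  mech_borel : standard_borel R mech_out;
  mech_ldp : forall (x x' : R) (S : set mech_out), measurable S ->
    (mech_ker x S <= (expR alpha)%:E * mech_ker x' S)%E }.

Section deficiency.
Context (R : realType) (N : nat) (alpha : R) (I : Type) (G : set I).
Local Notation RN := (N.-tuple (measurableTypeR R)).
Variables P Q : I -> probability RN R.

Definition mech_outN (K : 'I_N -> ldp_mechanism alpha) :=
  fprodT (fun i => mech_out (K i)).

Definition mech_kerN (K : 'I_N -> ldp_mechanism alpha) :
    R.-pker RN ~> mech_outN K :=
  fprod_kernel (fun i => mech_ker (K i)).

Definition ldp_deficiency : \bar R :=
  ereal_sup [set e | exists K : 'I_N -> ldp_mechanism alpha,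
    e = ereal_inf [set e' | exists (K' : 'I_N -> ldp_mechanism alpha)
                               (L : R.-pker (mech_outN K') ~> mech_outN K),
      e' = ereal_sup [set tv_dist (kimage L (kimage (mech_kerN K') (P f)))
                                  (kimage (mech_kerN K) (Q f)) | f in G]]].

End deficiency.

Section spectral.
Context (R : realType).
Local Notation mu := (@lebesgue_measure R).
Implicit Types (f : R -> R) (M s : R).

(* only the restriction of f to [-pi, pi] matters *)
Definition spectral_density f :=
  [/\ forall x, x \in `[- pi, pi] -> 0 <= f x,
      forall x, x \in `[- pi, pi] -> f (- x) = f x &
      mu.-integrable `[- pi, pi] (EFin \o f)].

(* f is even: the imaginary part of the integral of f(x) e^(ihx) vanishes *)
Definition autocov f (h : int) : R :=
  \int[mu]_(x in `[- pi, pi]) (f x * cos (h%:~R * x)).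

Definition autocorr f (h : int) : R := autocov f h / autocov f 0.

Definition sobolev_class M s : set (R -> R) :=
  [set f | [/\ spectral_density f,
    forall x, x \in `[- pi, pi] -> M^-1 <= f x &
    ((autocov f 0 ^+ 2)%:E *
       (1 + \esum_(h in [set h : int | h != 0%R])
              (`|h%:~R : R| `^ (2 * s) * `|autocorr f h| ^+ 2)%:E)
     <= M%:E)%E]].

Definition periodic_ext f (x : R) : R :=
  f (x - 2 * pi * (Num.floor ((x + pi) / (2 * pi)))%:~R).

(* the index j of 'I_N stands for j + 1 in 1..N *)
Definition local_mean (N : nat) f (j : 'I_N) : R :=
  N%:R / (2 * pi) *
  \int[mu]_(x in `[2 * j%:R * pi / N%:R, 2 * j.+1%:R * pi / N%:R])
     periodic_ext f x.

End spectral.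

Section gaussian.
Context (R : realType).

(* v is the variance; normal_prob takes the standard deviation, and
   normal_prob m 0 is not the Dirac mass at m *)
Definition gauss_law (m v : R) : set R -> \bar R :=
  fun A => if v == 0 then (\d_m A : \bar R)
           else normal_prob m (Num.sqrt v) A.

Context d (Omega : measurableType d) (Pr : probability Omega R).

Definition gaussian_process (X : int -> {RV Pr >-> (measurableTypeR R)}) :=
  forall n (t : 'I_n -> int) (a : 'I_n -> R), exists m v : R, 0 <= v /\
    forall A : set (measurableTypeR R), measurable A ->
      Pr [set w | A (\sum_i a i * X (t i) w)] = gauss_law m v A.

Definition stationary_process (X : int -> {RV Pr >-> (measurableTypeR R)}) :=
  forall n (t : 'I_n -> int) (h : int) (A : set (n.-tuple (measurableTypeR R))),
    measurable A ->
    Pr [set w | A [tuple X (t i + h) w | i < n]] =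
    Pr [set w | A [tuple X (t i) w | i < n]].

End gaussian.

Section laws.
Context (R : realType) (N : nat).
Local Notation RN := (N.-tuple (measurableTypeR R)).
Implicit Types (f : R -> R) (mu : probability RN R).

(* mu is the law of (X_1, ..., X_N), given the spectral density f of X *)
Definition time_law f mu :=
  exists d (Omega : measurableType d) (Pr : probability Omega R)
         (X : int -> {RV Pr >-> (measurableTypeR R)}),
    [/\ gaussian_process X, stationary_process X,
        forall t, ('E_Pr[X t] = 0)%E,
        forall h, covariance Pr (X 0) (X h) = (autocov f h)%:E &
        forall A : set RN, measurable A ->
          mu A = Pr [set w | A [tuple X (i.+1)%:Z w | i < N]]].

(* independent coordinates: mu is a product on measurable boxes *)
Definition freq_law f mu :=
  forall A : 'I_N -> set (measurableTypeR R), (forall j, measurable (A j)) ->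
    mu [set y | forall j, A j (tnth y j)] =
    (\prod_(j < N) gauss_law 0 (local_mean f j) (A j))%E.

End laws.

(* Main.v *)
(* Le Cam's two-point method with the spectral densities f0 = c and
   f1 = c (1 + d cos), where d^2 is of order 1 / (1 + alpha^3 N).

   In the frequency model the coordinates are independent, and f1 inflates the
   variance by a factor 1 + const d on a fixed proportion of the bins. Randomized
   response to the event x^2 > c turns this into a shift of order alpha d of that
   many independent coin tosses, which Chebyshev's inequality detects because
   N alpha^2 d^2 tends to infinity.

   In the time model f1 gives a moving average X_i = sg (u e_i + v e_(i-1)) with
   the same one-dimensional marginals as the white noise given by f0. Each new
   private output multiplies the chi-square divergence between the two output
   laws by at most 1 + O(alpha^4 d^2): the factor d^2 comes from the correlation
   of consecutive observations, the factor alpha^4 from two private views. Since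
   N alpha^4 d^2 = O(alpha), the output laws merge whatever the mechanism, and a
   postprocessing kernel does not increase total variation. Hence the error is at
   least (1 - o(1)) / 2 for one of f0, f1. *)
Require Import Defs.
From HB Require Import structures.
From mathcomp Require Import all_boot all_order all_algebra.
From mathcomp Require Import all_classical all_reals all_analysis.
From mathcomp Require Import measurable_realfun.
From mathcomp Require Import ring lra zify.

Import Order.TTheory GRing.Theory Num.Theory.
Import numFieldNormedType.Exports.

Local Open Scope classical_set_scope.
Local Open Scope ring_scope.

Set Implicit Arguments.
Unset Strict Implicit.
Unset Printing Implicit Defensive.

(** * Bounded measurable functions *)

(** The obstacle in the time model is that the output spaces are arbitrary and the outputs
    dependent. Finite labels of the coordinates determine a ring of sets that generates the product
    sigma-algebra, so a bound for finite alphabets, uniform in the labels, suffices. No joint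
    Gaussian density is used: laws are compared through cosines only, which leads to a filter that
    integrates out one noise variable at a time. The rate of the time model comes from two coupled
    quantities: the second moment C_n of the likelihood ratio of n outputs, and the second moment
    S_n when the last noise variable is revealed as well. A new output moves C_n only through the
    correlation of its input with the previous noise, which costs alpha^2 d^2 (S_n - C_n) up to a
    constant. The gap S_n - C_n measures what private outputs reveal about that noise and is itself
    O(alpha^2) C_n. A bound on C_n alone would stop at alpha^2 d^2, the very order that the
    frequency model detects. The 1 in 1 / (1 + alpha^3 N) keeps d bounded when alpha^3 N is small,
    so that f1 stays in the class. *)

Definition bounded_measurable d (T : measurableType d) (R : realType)
    (f : T -> R) : Prop :=
  measurable_fun [set: T] f /\ exists B : R, forall x, `|f x| <= B.

Section bounded_measurable_theory.
Context d (T : measurableType d) (R : realType).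
Implicit Types f g : T -> R.
Local Notation bm := (@bounded_measurable d T R).

Lemma bm_cst (c : R) : bm (fun=> c).
Proof. by split => //; exists `|c|. Qed.

Lemma bmD f g : bm f -> bm g -> bm (fun x => f x + g x).
Proof.
move=> [mf [B fB]] [mg [C gC]]; split; first exact: measurable_funD.
by exists (B + C) => x; rewrite (le_trans (ler_normD _ _))// lerD.
Qed.

Lemma bmM f g : bm f -> bm g -> bm (fun x => f x * g x).
Proof.
move=> [mf [B fB]] [mg [C gC]]; split; first exact: measurable_funM.
by exists (B * C) => x; rewrite normrM ler_pM.
Qed.

Lemma bmZ (c : R) f : bm f -> bm (fun x => c * f x).
Proof. by move=> bf; apply: bmM => //; exact: bm_cst. Qed.

Lemma bmN f : bm f -> bm (fun x => - f x).
Proof.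
move=> [mf [B fB]]; split; first exact: measurableT_comp.
by exists B => x; rewrite normrN.
Qed.

Lemma bmB f g : bm f -> bm g -> bm (fun x => f x - g x).
Proof. by move=> bf bg; apply: bmD => //; exact: bmN. Qed.

Lemma bmX f n : bm f -> bm (fun x => f x ^+ n).
Proof.
move=> bf; elim: n => [|n IH]; first exact: bm_cst.
rewrite (_ : (fun x => _) = fun x => f x * f x ^+ n); first exact: bmM.
by apply/funext => x; rewrite exprS.
Qed.

Lemma bm_sum I (s : seq I) (f : I -> T -> R) :
  (forall i, bm (f i)) -> bm (fun x => \sum_(i <- s) f i x).
Proof.
move=> bf; elim: s => [|i s IH].
  rewrite (_ : (fun x => _) = fun=> 0); first exact: bm_cst.
  by apply/funext => x; rewrite big_nil.
rewrite (_ : (fun x => _) = fun x => f i x + \sum_(j <- s) f j x).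
  exact: bmD.
by apply/funext => x; rewrite big_cons.
Qed.

Lemma bm_prod I (s : seq I) (f : I -> T -> R) :
  (forall i, bm (f i)) -> bm (fun x => \prod_(i <- s) f i x).
Proof.
move=> bf; elim: s => [|i s IH].
  rewrite (_ : (fun x => _) = fun=> 1); first exact: bm_cst.
  by apply/funext => x; rewrite big_nil.
rewrite (_ : (fun x => _) = fun x => f i x * \prod_(j <- s) f j x).
  exact: bmM.
by apply/funext => x; rewrite big_cons.
Qed.

Lemma bm_comp d' (T' : measurableType d') (h : T' -> T) f :
  measurable_fun [set: T'] h -> bm f -> bounded_measurable (fun x => f (h x)).
Proof.
move=> mh [mf [B fB]]; split; last by exists B => x.
exact: (measurableT_comp mf mh).
Qed.

Lemma bm_indic (A : set T) : measurable A -> bm \1_A.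
Proof.
move=> mA; split; first exact: measurable_indic.
by exists 1 => x; rewrite indicE; case: (x \in A); rewrite ?normr1 ?normr0.
Qed.

Variable P : probability T R.

Lemma bm_integrable f : bm f -> P.-integrable [set: T] (EFin \o f).
Proof.
move=> [mf [B fB]]; apply: measurable_bounded_integrable => //.
  by rewrite [ltLHS]probability_setT ltry.
exists B; split; first by rewrite num_real.
by move=> y By x _ /=; rewrite (le_trans (fB x))// ltW.
Qed.

Lemma bm_EFin f : bm f ->
  (\int[P]_x (f x)%:E)%E = (\int[P]_x f x)%:E.
Proof.
move=> bf; rewrite /Rintegral fineK//; apply: integrable_fin_num => //.
exact: bm_integrable.
Qed.

Lemma bm_intD f g : bm f -> bm g ->
  \int[P]_x (f x + g x) = \int[P]_x f x + \int[P]_x g x.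
Proof. by move=> bf bg; rewrite RintegralD//; exact: bm_integrable. Qed.

Lemma bm_intB f g : bm f -> bm g ->
  \int[P]_x (f x - g x) = \int[P]_x f x - \int[P]_x g x.
Proof. by move=> bf bg; rewrite RintegralB//; exact: bm_integrable. Qed.

Lemma bm_intZ c f : bm f ->
  \int[P]_x (c * f x) = c * \int[P]_x f x.
Proof. by move=> bf; rewrite RintegralZl//; exact: bm_integrable. Qed.

Lemma bm_int_cst (c : R) : \int[P]_x c = c.
Proof. by rewrite Rintegral_cst//= probability_setT/= mulr1. Qed.

Lemma bm_int_sum I (s : seq I) (f : I -> T -> R) : (forall i, bm (f i)) ->
  \int[P]_x (\sum_(i <- s) f i x) = \sum_(i <- s) \int[P]_x f i x.
Proof.
move=> bf; elim: s => [|i s IH].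
  rewrite big_nil; under eq_Rintegral do rewrite big_nil.
  exact: bm_int_cst.
rewrite big_cons -IH -bm_intD//; last exact: bm_sum.
by apply: eq_Rintegral => x _; rewrite big_cons.
Qed.

Lemma bm_int_le f g : bm f -> bm g -> (forall x, f x <= g x) ->
  \int[P]_x f x <= \int[P]_x g x.
Proof. by move=> bf bg fg; apply: le_Rintegral => //; exact: bm_integrable. Qed.

Lemma bm_int_indic (A : set T) : measurable A ->
  \int[P]_x \1_A x = fine (P A).
Proof. by move=> mA; rewrite /Rintegral integral_indic// setIT. Qed.

Lemma bm_int_norm f B : bm f -> (forall x, `|f x| <= B) ->
  `|\int[P]_x f x| <= B.
Proof.
move=> bf fB; rewrite ler_norml -{1}(bm_int_cst (- B)) -{2}(bm_int_cst B).
by rewrite !bm_int_le//; try exact: bm_cst; move=> x;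
  have := fB x; rewrite ler_norml => /andP[].
Qed.

Lemma bm_int_cvg (f_ : nat -> T -> R) (f : T -> R) B :
  (forall n, measurable_fun [set: T] (f_ n)) ->
  (forall n x, `|f_ n x| <= B) -> (forall x, f_ n x @[n --> \oo] --> f x) ->
  \int[P]_x f_ n x @[n --> \oo] --> \int[P]_x f x.
Proof.
move=> mf fB cf.
have mF : measurable_fun [set: T] f.
  by apply: (measurable_fun_cvg (h := f_)) => // x _; exact: cf.
have bF : bm f.
  split=> //; exists B => x.
  have cn : `|f_ n x| @[n --> \oo] --> `|f x| by apply: cvg_norm; exact: cf.
  rewrite -(cvg_lim _ cn)//; apply: limr_le; first by apply/cvg_ex; exists `|f x|.
  by apply: nearW => n; exact: fB.
have [|||||_ _] := @dominated_convergence _ T R P setT measurableT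
    (fun n x => (f_ n x)%:E) (EFin \o f) (fun=> B%:E).
- by move=> n; apply/measurable_EFinP.
- exact/measurable_EFinP.
- by apply/aeW => x _; apply: cvg_EFin; [exact: nearW|exact: cf].
- exact: (bm_integrable (bm_cst B)).
- by apply/aeW => x n _; rewrite lee_fin.
move=> H; apply: fine_cvg.
by rewrite /Rintegral fineK//; exact/integrable_fin_num/bm_integrable.
Qed.

End bounded_measurable_theory.

(** * Uniqueness of characteristic functions *)

Section trig_closure.
Import HBNNSimple.
Variable R : realType.
Implicit Types f g : R -> R.

(** The constructors are operations under which an equality of two integrals survives, so such an
    equality spreads from cosines by induction. The phase [p] supplies the sines. Products do not
    preserve such equalities; closure under them is derived in [trigM]. *)
Inductive trig_closure : (R -> R) -> Prop :=
| trig_cos (t p : R) : trig_closure (fun x => cos (t * x + p))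
| trig_lin (a : R) f g : trig_closure f -> trig_closure g ->
    trig_closure (fun x => a * f x + g x)
| trig_lim (f_ : nat -> R -> R) f (B : R) : (forall n, trig_closure (f_ n)) ->
    (forall n x, `|f_ n x| <= B) ->
    (forall x, f_ n x @[n --> \oo] --> f x) -> trig_closure f.

Lemma trig_ext f g : trig_closure f -> (forall x, f x = g x) -> trig_closure g.
Proof. by move=> tf fg; rewrite (_ : g = f)//; apply/funext. Qed.

Lemma trig_cst c : trig_closure (fun=> c).
Proof.
have t1 : trig_closure (fun=> 1).
  by apply: (trig_ext (trig_cos 0 0)) => x; rewrite mul0r addr0 cos0.
apply: (trig_ext (trig_lin (c - 1) t1 t1)) => x; ring.
Qed.

Lemma trigZ c f : trig_closure f -> trig_closure (fun x => c * f x).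
Proof.
by move=> tf; apply: (trig_ext (trig_lin c tf (trig_cst 0))) => x; rewrite addr0.
Qed.

Lemma trigD f g : trig_closure f -> trig_closure g ->
  trig_closure (fun x => f x + g x).
Proof. by move=> tf tg; apply: (trig_ext (trig_lin 1 tf tg)) => x; rewrite mul1r. Qed.

Lemma trigB f g : trig_closure f -> trig_closure g ->
  trig_closure (fun x => f x - g x).
Proof.
by move=> tf tg; apply: (trig_ext (trig_lin (-1) tg tf)) => x; rewrite mulN1r addrC.
Qed.

Lemma bm_cos (t p : R) :
  bounded_measurable (fun x : measurableTypeR R => cos (t * x + p)).
Proof.
split; last by exists 1 => x; exact: cos_max.
apply: continuous_measurable_fun => x.
apply: continuous_comp; last exact: continuous_cos.
apply: cvgD; last exact: cvg_cst.
by apply: cvgM; [exact: cvg_cst|exact: cvg_id].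
Qed.

Lemma trig_bm f : trig_closure f ->
  bounded_measurable (f : measurableTypeR R -> R).
Proof.
elim=> [t p|a {}f g _ bf _ bg|f_ {}f B _ bf fB cf].
- exact: bm_cos.
- by apply: bmD => //; apply: bmZ.
- split.
    by apply: (measurable_fun_cvg (h := f_)) => [n|x _]; [case: (bf n)|exact: cf].
  exists B => x; have cn : `|f_ n x| @[n --> \oo] --> `|f x|.
    by apply: cvg_norm; exact: cf.
  rewrite -(cvg_lim _ cn)//; apply: limr_le; first by apply/cvg_ex; exists `|f x|.
  by apply: nearW => n; exact: fB.
Qed.

(** Product-to-sum handles two cosines; linear combinations and bounded limits follow by induction
    on each factor in turn, using that members of the class are bounded. *)
Lemma trigM f g : trig_closure f -> trig_closure g ->
  trig_closure (fun x => f x * g x).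
Proof.
have Hcos t p h : trig_closure h -> trig_closure (fun x => cos (t * x + p) * h x).
  elim=> [u q|a {}f0 g0 _ IHf _ IHg|f_ f0 B _ IH fB cf].
  - apply: (trig_ext (trig_lin 2^-1 (trig_cos (t + u) (p + q))
      (trigZ 2^-1 (trig_cos (t - u) (p - q))))) => x.
    rewrite (_ : (t + u) * x + (p + q) = (t * x + p) + (u * x + q)); last by ring.
    rewrite (_ : (t - u) * x + (p - q) = (t * x + p) - (u * x + q)); last by ring.
    by rewrite cosD cosB; field.
  - apply: (trig_ext (trig_lin a IHf IHg)) => x; ring.
  - apply: (trig_lim (f_ := fun n x => cos (t * x + p) * f_ n x) (B := B)) => //.
      move=> n x; rewrite normrM (le_trans _ (fB n x))// ler_piMl//.
      exact: cos_max.
    by move=> x; apply: cvgM; [exact: cvg_cst|exact: cf].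
move=> + tg; elim=> [t p|a {}f f0 _ IHf _ IHg|f_ {}f B _ IH fB cf].
- exact: Hcos.
- apply: (trig_ext (trig_lin a IHf IHg)) => x; ring.
- have [_ [C gC]] := trig_bm tg.
  apply: (trig_lim (f_ := fun n x => f_ n x * g x) (B := B * C)) => //.
    by move=> n x; rewrite normrM ler_pM.
  by move=> x; apply: cvgM; [exact: cf|exact: cvg_cst].
Qed.

(* Iterating u |-> (3u - u^3)/2 drives every point of [-1, 1] to its sign. *)
Let p3 (u : R) : R := (3 * u - u ^+ 3) / 2.

Let p3_bnd (u : R) : 0 < u <= 1 -> u <= p3 u <= 1.
Proof.
move=> /andP[u0 u1]; rewrite /p3; apply/andP; split; last first.
  rewrite -subr_ge0 (_ : _ - _ = (1 - u) ^+ 2 * (2 + u) / 2); last by field.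
  have h : 0 <= 2 + u by lra.
  by rewrite !mulr_ge0 ?invr_ge0 ?subr_ge0.
rewrite -subr_ge0 (_ : _ - _ = u * (1 - u) * (1 + u) / 2); last by field.
have h : 0 <= u /\ 0 <= 1 + u by lra.
by rewrite !mulr_ge0 ?invr_ge0 ?subr_ge0//; case: h.
Qed.

Let iter_p3_bnd (u : R) n : 0 < u <= 1 -> u <= iter n p3 u <= 1.
Proof.
move=> u01; elim: n => [|n /andP[IH1 IH2]] /=; first by case/andP: u01 => _ ->; rewrite lexx.
have u0 : 0 < iter n p3 u by rewrite (lt_le_trans _ IH1)//; case/andP: u01.
have /andP[h1 h2] := p3_bnd (introT andP (conj u0 IH2)).
by rewrite h2 andbT (le_trans IH1).
Qed.

Let p3_odd (u : R) n : iter n p3 (- u) = - iter n p3 u.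
Proof. by elim: n => //= n ->; rewrite /p3; field. Qed.

Let cvg_iter_p3_pos (u : R) : 0 < u <= 1 -> iter n p3 u @[n --> \oo] --> (1:R).
Proof.
move=> u01; have [u0 u1] := andP u01.
(* At a value v the gap 1 - v shrinks by the factor 1 - v / 2 - v^2 / 2, which is at most 1 - u / 2
   because the iterates never fall below u. *)
have H n : 1 - iter n p3 u <= (1 - u / 2) ^+ n.
  elim: n => [|n IH] /=; first by rewrite expr0 gerBl ltW.
  have /andP[h1 h2] := iter_p3_bnd n u01; set v := iter n p3 u in IH h1 h2 *.
  rewrite exprS; apply: (@le_trans _ _ ((1 - u / 2) * (1 - v))).
    rewrite /p3 -subr_ge0.
    rewrite (_ : _ - _ = (1 - v) * ((v - u) + v ^+ 2) / 2); last by field.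
    by rewrite !mulr_ge0 ?invr_ge0 ?subr_ge0// addr_ge0 ?subr_ge0 ?sqr_ge0.
  by rewrite ler_wpM2l//; nra.
rewrite -[X in _ --> X]subr0 (_ : (fun n => _) = fun n => 1 - (1 - iter n p3 u)).
  apply: cvgB; first exact: cvg_cst.
  apply: (squeeze_cvgr (f := cst 0) (h := fun n => (1 - u / 2) ^+ n)).
  - apply: nearW => n; rewrite /= H andbT subr_ge0.
    by case/andP: (iter_p3_bnd n u01).
  - exact: cvg_cst.
  - by apply: cvg_expr; rewrite ger0_norm; nra.
by apply/funext => n; rewrite opprB addrC subrK.
Qed.

Let cvg_iter_p3 (u : R) : `|u| <= 1 -> iter n p3 u @[n --> \oo] --> Num.sg u.
Proof.
move=> u1; have [u0|u0|<-] := ltgtP 0 u.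
- by rewrite gtr0_sg//; apply: cvg_iter_p3_pos; rewrite u0/= -(gtr0_norm u0).
- rewrite ltr0_sg// (_ : (fun n => _) = fun n => - iter n p3 (- u)).
    by apply: cvgN; apply: cvg_iter_p3_pos; rewrite oppr_gt0 u0/= -(ltr0_norm u0).
  by apply/funext => n; rewrite p3_odd opprK.
- rewrite sgr0 (_ : (fun n => _) = fun=> 0); first exact: cvg_cst.
  apply/funext; elim => //= n ->; rewrite /p3; ring.
Qed.

Let trig_p3 f n : trig_closure f -> trig_closure (fun x => iter n p3 (f x)).
Proof.
move=> tf; elim: n => //= n IH; rewrite /p3.
have t3 := trigM IH (trigM IH IH).
apply: (trig_ext (trigB (trigZ (3 / 2) IH) (trigZ 2^-1 t3))) => x.
by field.
Qed.

Lemma trig_sg f : trig_closure f -> (forall x, `|f x| <= 1) ->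
  trig_closure (fun x => Num.sg (f x)).
Proof.
move=> tf f1; apply: (trig_lim (f_ := fun n x => iter n p3 (f x)) (B := 1)).
- by move=> n; exact: trig_p3.
- move=> n x; have [u0|u0|<-] := ltgtP 0 (f x).
  + have /iter_p3_bnd -/(_ n)/andP[h1 h2] : 0 < f x <= 1 by rewrite u0/= -(gtr0_norm u0).
    by rewrite ger0_norm// (le_trans _ h1)// ltW.
  + have /iter_p3_bnd -/(_ n)/andP[h1 h2] : 0 < - f x <= 1.
      by rewrite oppr_gt0 u0/= -(ltr0_norm u0).
    rewrite -normrN -p3_odd ger0_norm// (le_trans _ h1)// oppr_ge0 ltW//.
  + rewrite (_ : iter n p3 0 = 0) ?normr0//.
    by elim: n => //= n ->; rewrite /p3; ring.
- by move=> x; exact: cvg_iter_p3.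
Qed.

(** [trig_sg] wants an argument in [-1, 1]. The sine of (x - a) / (n + 1) is one, and it has the
    sign of x - a as soon as n + 1 exceeds |x - a|. *)
Lemma trig_sg_sub (a : R) : trig_closure (fun x => Num.sg (x - a)).
Proof.
apply: (trig_lim (f_ := fun n x => Num.sg (sin (n.+1%:R^-1 * (x - a)))) (B := 1)).
- move=> n; apply: trig_sg => [|x]; last exact: sin_max.
  apply: (trig_ext (trig_cos n.+1%:R^-1 (- (n.+1%:R^-1 * a) - pi / 2))) => x.
  by rewrite addrA cosBpihalf mulrBr.
- by move=> n x; rewrite normr_sg; case: eqP => _ //=; rewrite ler01.
- move=> x; apply: cvg_near_cst.
  near=> n; have n0 : (0 : R) < n.+1%:R^-1 by rewrite invr_gt0.
  have pos (v : R) : 0 < v -> v < n.+1%:R -> Num.sg (sin (n.+1%:R^-1 * v)) = 1.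
    move=> v0 vn; apply: gtr0_sg; apply: sin2_gt0; rewrite mulr_gt0//=.
    by rewrite mulrC ltr_pdivrMr// (lt_trans vn)// ltr_pMl// ltr1n.
  have nx : `|x - a| < n.+1%:R.
    near: n; have [m _ Hm] := near_infty_natSinv_lt (PosNum (@ltr01 R)).
    exists (Num.bound (`|x - a|)) => // k /= hk.
    rewrite (lt_le_trans (archi_boundP (normr_ge0 _)))// ler_nat.
    exact: leq_trans hk _.
  have [u0|u0|u0] := ltgtP 0 (x - a).
  + by rewrite pos// ?gtr0_sg// -(gtr0_norm u0).
  + rewrite -(opprK (x - a)) mulrN sinN sgrN pos ?oppr_gt0 -?(ltr0_norm u0)//.
    by rewrite sgrN gtr0_sg// ltr0_norm// oppr_gt0.
  + by rewrite -u0 mulr0 sin0 sgr0.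
Unshelve. all: by end_near. Qed.

(** On the generating rays the indicator is (sg^2 + sg) / 2. A countable union is a bounded limit of
    finite ones, which are built by inclusion-exclusion and hence need [trigM]. *)
Lemma trig_indic (A : set (measurableTypeR R)) : measurable A -> trig_closure \1_A.
Proof.
rewrite (RGenOInfty.measurableE R); move: A; apply: smallest_sub; last first.
  move=> _ [a ->]; have ts := trig_sg_sub a.
  apply: (trig_ext (trig_lin 2^-1 (trigM ts ts) (trigZ 2^-1 ts))) => x.
  rewrite indicE; have [xa|xa|->] := ltgtP a x.
  - rewrite mem_set; last by rewrite /= in_itv/= xa.
    by rewrite gtr0_sg ?subr_gt0//=; field.
  - rewrite memNset; last by rewrite /= in_itv/= andbT ltNge (ltW xa).
    by rewrite ltr0_sg ?subr_lt0//=; field.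
  - rewrite memNset; last by rewrite /= in_itv/= ltxx.
    rewrite subrr sgr0/=; ring.
split.
- by apply: (trig_ext (trig_cst 0)) => x; rewrite indic0.
- move=> B tB; apply: (trig_ext (trigB (trig_cst 1) tB)) => x.
  by rewrite setTD !indicE in_setC; case: (x \in B) => /=; ring.
- move=> F tF.
  pose G := fun n => \bigcup_(i in `I_n) F i.
  have tG n : trig_closure \1_(G n).
    elim: n => [|n IH].
      apply: (trig_ext (trig_cst 0)) => x.
      by rewrite /G II0 bigcup_set0 indic0.
    apply: (trig_ext (trigB (trigD IH (tF n)) (trigM IH (tF n)))) => x.
    rewrite /G IIS bigcup_setU bigcup_set1 !indicE in_setU.
    by case: (_ \in _); case: (_ \in _) => /=; ring.
  apply: (trig_lim (f_ := fun n => \1_(G n)) (B := 1)) => //.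
    by move=> n x; rewrite indicE; case: (_ \in _); rewrite ?normr0 ?normr1.
  move=> x; apply: cvg_near_cst; have [[k _ Fkx]|nF] := pselect ((\bigcup_i F i) x).
    near=> n; rewrite !indicE !mem_set//; first by exists k.
    by exists k => //=; near: n; exact: nbhs_infty_gt.
  apply: nearW => n; rewrite !indicE !memNset//.
  by move=> [k _ Fkx]; apply: nF; exists k.
Unshelve. all: by end_near. Qed.

Lemma bm_trig_closure f : bounded_measurable (f : measurableTypeR R -> R) ->
  trig_closure f.
Proof.
move=> [mf [B fB]].
have B0 : 0 <= B by rewrite (le_trans _ (fB 0)).
have mg : measurable_fun setT (fun x : measurableTypeR R => (f x + B)%:E).
  by apply/measurable_EFinP/measurable_funD.
have g0 x : (0 <= (f x + B)%:E)%E.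
  by rewrite lee_fin -lerBlDr sub0r; have := fB x; rewrite ler_norml => /andP[].
pose h := nnsfun_approx measurableT mg.
(* Monotone approximation by simple functions wants a nonnegative target; the shift by [B] provides
   it and keeps the approximants below 2 B. *)
suff : trig_closure (fun x => f x + B).
  by move=> /trigB/(_ (trig_cst B))/trig_ext; apply => x; rewrite addrK.
have ch x : h n x @[n --> \oo] --> f x + B.
  by have /fine_cvgP[_] := cvg_nnsfun_approx measurableT mg (fun x _ => g0 x) (x := x) Logic.I.
apply: (trig_lim (f_ := h) (B := B + B)) => //.
- move=> n; have [s ->] : exists s : seq R,
      (h n : R -> R) = fun x => \sum_(y <- s) y * \1_(h n @^-1` [set y]) x.
    exists (finmap.enum_fset (fset_set (range (h n)))).
    by apply/funext => x; rewrite [LHS]fimfunE fsbig_finite.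
  elim: s => [|y s IH].
    by apply: (trig_ext (trig_cst 0)) => x; rewrite big_nil.
  have ty : trig_closure \1_(h n @^-1` [set y]) by apply: trig_indic.
  by apply: (trig_ext (trig_lin y ty IH)) => x; rewrite big_cons.
- move=> n x; rewrite ger0_norm//; apply: (@le_trans _ _ (f x + B)).
    rewrite -(cvg_lim _ (ch x))//.
    apply: nondecreasing_cvgn_le; last by apply/cvg_ex; eexists; exact: ch.
    by move=> m1 m2 m12; have /lefP := nd_nnsfun_approx measurableT mg m12; exact.
  by rewrite lerD2r; have := fB x; rewrite ler_norml => /andP[].
Qed.

End trig_closure.

(* Uniqueness of characteristic functions, for the signed measures
   F1 dP1 o Y1^-1 and F2 dP2 o Y2^-1. *)
Lemma cos_int_unique (R : realType) d1 (T1 : measurableType d1)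
    (P1 : probability T1 R) d2 (T2 : measurableType d2) (P2 : probability T2 R)
    (Y1 : T1 -> measurableTypeR R) (Y2 : T2 -> measurableTypeR R)
    (F1 : T1 -> R) (F2 : T2 -> R) (f : measurableTypeR R -> R) :
  measurable_fun [set: T1] Y1 -> measurable_fun [set: T2] Y2 ->
  bounded_measurable F1 -> bounded_measurable F2 ->
  (forall t p : R, \int[P1]_x (cos (t * Y1 x + p) * F1 x) =
                   \int[P2]_x (cos (t * Y2 x + p) * F2 x)) ->
  bounded_measurable f ->
  \int[P1]_x (f (Y1 x) * F1 x) = \int[P2]_x (f (Y2 x) * F2 x).
Proof.
move=> mY1 mY2 bF1 bF2 Hcos /bm_trig_closure.
elim=> [t p|a {}f g tf IHf tg IHg|f_ {}f B tf_ IH fB cf]; first exact: Hcos.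
- have [bf bg] := (trig_bm tf, trig_bm tg).
  have E d (T : measurableType d) (P : probability T R) (Y : T -> measurableTypeR R) F :
      measurable_fun setT Y -> bounded_measurable F ->
      \int[P]_x ((a * f (Y x) + g (Y x)) * F x) =
      a * \int[P]_x (f (Y x) * F x) + \int[P]_x (g (Y x) * F x).
    move=> mY bF; rewrite -bm_intZ; last by apply: bmM => //; exact: bm_comp.
    rewrite -bm_intD; last 2 first.
    + by apply: bmZ; apply: bmM => //; exact: bm_comp.
    + by apply: bmM => //; exact: bm_comp.
    + by apply: eq_Rintegral => x _; ring.
  by rewrite !E// IHf IHg.
- have E d (T : measurableType d) (P : probability T R) (Y : T -> measurableTypeR R) F :
      measurable_fun setT Y -> bounded_measurable F ->
      \int[P]_x (f_ n (Y x) * F x) @[n --> \oo] --> \int[P]_x (f (Y x) * F x).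
    move=> mY [mF [C FC]]; apply: (bm_int_cvg (B := B * C)).
    + by move=> n; apply: measurable_funM => //; case: (bm_comp mY (trig_bm (tf_ n))).
    + by move=> n x; rewrite normrM ler_pM.
    + by move=> x; apply: cvgM; [exact: cf|exact: cvg_cst].
  rewrite -(cvg_lim _ (E _ _ _ _ _ mY1 bF1))// -(cvg_lim _ (E _ _ _ _ _ mY2 bF2))//.
  congr (lim _); rewrite (_ : (fun n => \int[P1]_x _) =
    (fun n => \int[P2]_x (f_ n (Y2 x) * F2 x)))//.
  apply/funext => n; exact: IH.
Qed.

(** * Gaussian integrals *)

Section gaussian_density.
Variable R : realType.
Local Notation mu := (@lebesgue_measure R).
Import HBNNSimple.

Section normal_prob_integral.
Variables m s : R.
Local Notation p := (normal_pdf m s).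

Let mp : measurable_fun setT (fun x : R => (p x)%:E).
Proof. by apply/measurable_EFinP; exact: measurable_normal_pdf. Qed.

Let p0 x : (0 <= (p x)%:E)%E. Proof. by rewrite lee_fin normal_pdf_ge0. Qed.

Let integral_nnsfun (f : {nnsfun (measurableTypeR R) >-> R}) :
  (\int[normal_prob m s]_x (f x)%:E = \int[mu]_x ((f x)%:E * (p x)%:E))%E.
Proof.
under [in LHS]eq_integral do rewrite fimfunE -fsumEFin//.
rewrite ge0_integral_fsum//; last 2 first.
  - by move=> r; exact/measurable_EFinP/measurableT_comp.
  - by move=> r z _; rewrite EFinM nnfun_muleindic_ge0.
under [in RHS]eq_integral.
  move=> x _; rewrite fimfunE -fsumEFin//= ge0_mule_fsuml; last first.
    by move=> r; rewrite EFinM nnfun_muleindic_ge0.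
  over.
rewrite /= ge0_integral_fsum//; last 2 first.
  - move=> r; apply: emeasurable_funM => //.
    by exact/measurable_EFinP/measurableT_comp.
  - by move=> r z _; rewrite mule_ge0// EFinM nnfun_muleindic_ge0.
apply: eq_fsbigr => r _.
rewrite (integralZl_indic _ (fun r => f @^-1` [set r]))//; last first.
  by move=> r0; rewrite preimage_nnfun0.
rewrite integral_indic// setIT.
have [r0|r0] := leP 0%R r; last first.
  rewrite preimage_nnfun0// measure0 mule0 integral0_eq// => x _.
  by rewrite indic0 mulr0 mul0e.
rewrite /normal_prob -ge0_integralZl//; last exact: measurable_funTS.
rewrite [LHS]integral_mkcond.
apply: eq_integral => x _; rewrite /patch indicE EFinM.
by case: ifPn => xr; rewrite ?mule1 ?mule0 ?mul0e.
Qed.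

Lemma ge0_integral_normal_prob (f : measurableTypeR R -> \bar R) :
  (forall x, 0 <= f x)%E -> measurable_fun setT f ->
  (\int[normal_prob m s]_x f x = \int[mu]_x (f x * (p x)%:E))%E.
Proof.
move=> f0 mf; pose f_ := nnsfun_approx measurableT mf.
transitivity (\int[normal_prob m s]_x (lim ((f_ n x)%:E @[n --> \oo])))%E.
  by apply/eq_integral => z _; apply/esym/cvg_lim => //=; exact: cvg_nnsfun_approx.
rewrite monotone_convergence//; last 3 first.
  by move=> n; exact/measurable_EFinP.
  by move=> n z _; rewrite lee_fin.
  by move=> z _ a b ab; rewrite lee_fin; exact/lefP/nd_nnsfun_approx.
under eq_fun do rewrite integral_nnsfun.
rewrite -monotone_convergence//; last 3 first.
- by move=> n; apply: emeasurable_funM => //; exact/measurable_EFinP.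
- by move=> n x _; rewrite mule_ge0// lee_fin.
- move=> x _ a b ab; rewrite lee_wpmul2r// lee_fin.
  exact/lefP/nd_nnsfun_approx.
apply: eq_integral => x _.
by apply/cvg_lim => //; apply: cvgeZr => //; exact: cvg_nnsfun_approx.
Qed.

Lemma integral_normal_prob (f : measurableTypeR R -> R) :
  measurable_fun setT f ->
  (\int[normal_prob m s]_x (f x)%:E = \int[mu]_x (f x * p x)%:E)%E.
Proof.
move=> mf; have mfE : measurable_fun setT (EFin \o f) by exact/measurable_EFinP.
rewrite integralE [RHS]integralE.
congr (_ - _)%E; rewrite ge0_integral_normal_prob//.
- apply: eq_integral => x _ /=.
  by rewrite !funeposE /= EFinM -[in RHS](mul0e (p x)%:E) -maxe_pMl.
- exact: measurable_funepos.
- apply: eq_integral => x _ /=.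
  by rewrite !funenegE /= -?EFinN -mulNr EFinM -[in RHS](mul0e (p x)%:E) -maxe_pMl.
- exact: measurable_funeneg.
Qed.

End normal_prob_integral.

End gaussian_density.

Section gaussian_density.
Variable R : realType.
Local Notation mu := (@lebesgue_measure R).

Local Notation p := (@normal_pdf R 0 1).
Local Notation gamma := (@normal_prob R 0 1).

Lemma std_normal_pdfE (x : R) : p x = normal_peak 1 * expR (- x ^+ 2 / 2).
Proof. by rewrite normal_pdfE ?oner_eq0// /normal_fun subr0 expr1n. Qed.

Let is_derive_p (x : R) : is_derive x 1 p (- x * p x).
Proof.
rewrite (_ : p = fun x => normal_peak 1 * expR (- x ^+ 2 / 2)); last first.
  by apply/funext => y; rewrite std_normal_pdfE.
have h : is_derive x (1 : R) (fun y : R => - y ^+ 2 / 2) (- x).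
  by apply: is_derive_eq; rewrite !scaler0 add0r /GRing.scale /= mulr1; field.
have e := @is_derive1_comp _ expR (fun y => - y ^+ 2 / 2) x _ _ (is_derive_expR _) h.
have g := is_deriveZ (normal_peak 1) e.
apply: (is_derive_eq g); rewrite /GRing.scale /=; ring.
Qed.

(** Since 1 + x^2 <= 4 exp (x^2 / 4), a wider Gaussian density absorbs quadratic growth. *)
Let p_bound (x : R) : (1 + x ^+ 2) * p x <=
  4 * normal_peak 1 / normal_peak (Num.sqrt 2) * normal_pdf 0 (Num.sqrt 2) x.
Proof.
have s2 : Num.sqrt 2 != 0 :> R by rewrite sqrtr_eq0 -ltNge.
rewrite std_normal_pdfE normal_pdfE//= /normal_fun subr0 sqr_sqrtr//.
rewrite [leRHS]mulrA divfK; last by rewrite gt_eqF// normal_peak_gt0.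
rewrite mulrCA -[leRHS]mulrA [leRHS]mulrCA ler_wpM2l ?normal_peak_ge0//.
rewrite (_ : - x ^+ 2 / 2 = - (x ^+ 2 / 4) + - x ^+ 2 / (2 *+ 2)); last by field.
rewrite expRD mulrA ler_wpM2r ?expR_ge0// expRN ler_pdivrMr ?expR_gt0//.
have := expR_ge1Dx (x ^+ 2 / 4); have := sqr_ge0 x; lra.
Qed.

Lemma normal_pdf_bound_integrable (f : R -> R) (C : R) : measurable_fun setT f ->
  (forall x, `|f x| <= C * (1 + x ^+ 2)) ->
  mu.-integrable setT (EFin \o (fun x => f x * p x)).
Proof.
move=> mf fC.
set K := C * (4 * normal_peak 1 / normal_peak (Num.sqrt 2)).
apply: (@le_integrable _ _ _ mu setT measurableT _ (fun x => (K * normal_pdf 0 (Num.sqrt 2) x)%:E)) => //.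
- apply/measurable_EFinP/measurable_funM => //; exact: measurable_normal_pdf.
- move=> x _ /=; rewrite lee_fin normrM [`|p x|]ger0_norm ?normal_pdf_ge0//.
  rewrite (le_trans _ (ler_norm _))// (le_trans (ler_wpM2r _ (fC x))) ?normal_pdf_ge0//.
  rewrite /K -!mulrA ler_wpM2l ?p_bound//; last by rewrite !mulrA; exact: p_bound.
  by have := le_trans (normr_ge0 _) (fC 0); rewrite expr0n addr0 mulr1.
- under eq_fun do rewrite EFinM.
  by apply: integrableZl => //; exact: integrable_normal_pdf.
Qed.

(** Stein's identity: the integrand is the derivative of h p. The fundamental theorem of calculus
    applies on [-(n + 1), n + 1], where the boundary terms are O(1 / n). *)
Lemma gaussian_ibp (h h' : R -> R) (C : R) :
  (forall x : R, is_derive x (1 : R) h (h' x)) -> continuous h' ->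
  (forall x, `|h x| <= C * (1 + `|x|)) -> (forall x, `|h' x| <= C * (1 + `|x|)) ->
  \int[mu]_x ((h' x - x * h x) * p x) = 0.
Proof.
move=> dh ch' hC h'C.
have ch : continuous h.
  by move=> x; apply/differentiable_continuous/derivable1_diffP; have [] := dh x.
have C0 : 0 <= C by have := le_trans (normr_ge0 _) (hC 0); rewrite normr0 addr0 mulr1.
pose f x := (h' x - x * h x) * p x.
have cf : continuous f.
  move=> x; apply: cvgM; last by apply: continuous_normal_pdf; rewrite oner_eq0.
  apply: cvgB; first exact: ch'.
  by apply: cvgM; [exact: cvg_id|exact: ch].
have dF (x : R) : is_derive x 1 (fun y => h y * p y) (f x).
  have e := is_deriveM (dh x) (is_derive_p x).
  apply: (is_derive_eq e); rewrite /f /GRing.scale /=; ring.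
have cF : continuous (fun y => h y * p y).
  move=> x; apply/differentiable_continuous/derivable1_diffP; have [] := dF x; by [].
have sq (x : R) : 1 + `|x| <= 2 * (1 + x ^+ 2).
  by rewrite -[x ^+ 2]ger0_norm ?sqr_ge0// normrX; have := normr_ge0 x; nra.
have if_ : mu.-integrable setT (EFin \o f).
  apply: (normal_pdf_bound_integrable (C := C * 4)).
    apply: measurable_funB; first exact: continuous_measurable_fun.
    by apply: measurable_funM => //; exact: continuous_measurable_fun.
  move=> x; rewrite (le_trans (ler_normB _ _))//.
  have h1 := h'C x; have h2 := hC x; rewrite normrM -[x ^+ 2]ger0_norm ?sqr_ge0// normrX.
  have := normr_ge0 x; have := normr_ge0 (h x); set a := `|x| in h1 h2 *.
  move=> hh a0; have : a * `|h x| <= a * (C * (1 + a)) by rewrite ler_wpM2l.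
  have : C * ((1 + a) * (1 + a)) <= C * (4 * (1 + a ^+ 2)) by rewrite ler_wpM2l//; nra.
  lra.
have I_n (n : nat) : \int[mu]_(x in `[- n.+1%:R, n.+1%:R]) f x =
    h n.+1%:R * p n.+1%:R - h (- n.+1%:R) * p (- n.+1%:R).
  rewrite /Rintegral (@continuous_FTC2 _ f (fun y => h y * p y))//.
  - by rewrite gtrN.
  - exact: continuous_subspaceT.
  - split; first by move=> x _; have [] := dF x.
    + by apply: cvg_at_right_filter; exact: cF.
    + by apply: cvg_at_left_filter; exact: cF.
  - by move=> x _; rewrite derive1E; have [_ ->] := dF x.
have lim1 : \int[mu]_(x in `[- n.+1%:R, n.+1%:R]) f x @[n --> \oo] --> \int[mu]_x f x.
  pose D (n : nat) : set R := `[- n.+1%:R, n.+1%:R]%classic.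
  have mf : measurable_fun setT f by exact: continuous_measurable_fun.
  have [|||||_ _ H] := @dominated_convergence _ _ R mu setT measurableT
    (fun n x => ((f \_ (D n)) x)%:E) (EFin \o f) (fun x => `|f x|%:E).
  - move=> n; apply/measurable_EFinP/(measurable_restrictT _ _).1.
      exact: measurable_itv.
    exact: measurable_funTS.
  - exact/measurable_EFinP.
  - apply/aeW => x _; apply: cvg_near_cst.
    near=> n; rewrite /= patchE mem_set//= /D /= in_itv/= -ler_norml.
    rewrite (le_trans (ltW (archi_boundP (normr_ge0 x))))// ler_nat.
    by near: n; exists (Num.bound `|x|) => // k /= /leq_trans; apply.
  - by have := integrable_abse if_.
  - by apply/aeW => x n _; rewrite lee_fin patchE; case: ifP; rewrite ?normr0.
  rewrite (_ : (fun n => _) = fun n => fine (\int[mu]_x ((f \_ (D n)) x)%:E)%E).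
    by apply: fine_cvg; rewrite /Rintegral fineK//; exact: integrable_fin_num.
  by apply/funext => n; rewrite Rintegral_mkcond.
have pn (x : R) n : `|x| = n.+1%:R -> `|h x * p x| <= C * normal_peak 1 * 4 * harmonic n.
  move=> xn; rewrite normrM [`|p x|]ger0_norm ?normal_pdf_ge0//.
  rewrite (le_trans (ler_wpM2r _ (hC x))) ?normal_pdf_ge0// -!mulrA ler_wpM2l//.
  rewrite std_normal_pdfE mulrCA ler_wpM2l ?normal_peak_ge0// mulNr expRN.
  rewrite ler_pdivrMr ?expR_gt0// /harmonic -[x ^+ 2]ger0_norm ?sqr_ge0// normrX xn.
  have := expR_ge1Dx (n.+1%:R ^+ 2 / 2 : R).
  have n1 : (1 : R) <= n.+1%:R by rewrite ler1n.
  set y : R := n.+1%:R in n1 *; move=> hy.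
  rewrite mulrAC ler_pdivlMr; last by rewrite (lt_le_trans _ n1).
  nra.
have lim2 : \int[mu]_(x in `[- n.+1%:R, n.+1%:R]) f x @[n --> \oo] --> (0 : R).
  have hl (c : R) : c * harmonic n @[n --> \oo] --> (0 : R).
    by rewrite -(mulr0 c); apply: cvgM; [exact: cvg_cst|exact: cvg_harmonic].
  pose K := C * normal_peak 1 * 4 + C * normal_peak 1 * 4.
  apply: (squeeze_cvgr (f := fun n => (- K) * harmonic n) (h := fun n => K * harmonic n)) => //.
  apply: nearW => n; rewrite mulNr -ler_norml I_n (le_trans (ler_normB _ _))//.
  by rewrite /K mulrDl lerD// pn// ?normrN ger0_norm.
by rewrite -(cvg_lim _ lim1)// -(cvg_lim _ lim2).
Unshelve. all: by end_near. Qed.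

End gaussian_density.

Section gaussian.
Variable R : realType.
Local Notation mu := (@lebesgue_measure R).
Local Notation p := (@normal_pdf R 0 1).
Local Notation gamma := (@normal_prob R 0 1).

Lemma Rintegral_normal_prob (m s : R) (f : measurableTypeR R -> R) :
  measurable_fun setT f ->
  \int[normal_prob m s]_x f x = \int[mu]_x (f x * normal_pdf m s x).
Proof. by move=> mf; rewrite /Rintegral integral_normal_prob. Qed.

Lemma gamma_integrable (f : measurableTypeR R -> R) C :
  measurable_fun setT f -> (forall x, `|f x| <= C * (1 + x ^+ 2)) ->
  gamma.-integrable setT (EFin \o f).
Proof.
move=> mf fC; apply/integrableP; split; first exact/measurable_EFinP.
have mn : measurable_fun setT (fun x => `|f x|) by exact: measurableT_comp.
rewrite (_ : (\int[_]_x _ = \int[gamma]_x (`|f x|)%:E)%E)//.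
rewrite integral_normal_prob//.
have /integrableP[_] := normal_pdf_bound_integrable (f := fun x => `|f x|) mn (C := C)
  (fun x => eq_ind_r (fun z => z <= _) (fC x) (normr_id _)).
apply: le_lt_trans; apply: ge0_le_integral => //.
- by move=> x _; rewrite lee_fin mulr_ge0// normal_pdf_ge0.
- by apply/measurable_EFinP/measurable_funM => //; exact: measurable_normal_pdf.
- apply: measurableT_comp => //.
  by apply/measurable_EFinP/measurable_funM => //; exact: measurable_normal_pdf.
- by move=> x _; rewrite lee_fin ler_norm.
Qed.

Lemma gamma_integrable_id : gamma.-integrable setT (EFin \o (fun x : measurableTypeR R => x)).
Proof.
apply: (gamma_integrable (C := 1)) => // x.
rewrite mul1r -[x ^+ 2]ger0_norm ?sqr_ge0// normrX; have := normr_ge0 x; nra.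
Qed.

Lemma gamma_integrable_sqr :
  gamma.-integrable setT (EFin \o (fun x : measurableTypeR R => x ^+ 2)).
Proof.
apply: (gamma_integrable (C := 1)) => [|x]; first exact: measurable_funX.
by rewrite mul1r ger0_norm ?sqr_ge0// lerDr.
Qed.

Lemma gamma_ibp (h h' : R -> R) (C : R) :
  (forall x : R, is_derive x (1 : R) h (h' x)) -> continuous h' ->
  (forall x, `|h x| <= C * (1 + `|x|)) -> (forall x, `|h' x| <= C * (1 + `|x|)) ->
  \int[gamma]_x (h' x - x * h x) = 0.
Proof.
move=> dh ch' hC h'C; rewrite Rintegral_normal_prob; last first.
  have ch : continuous h.
    by move=> x; apply/differentiable_continuous/derivable1_diffP; have [] := dh x.
  apply: measurable_funB; first exact: continuous_measurable_fun.
  by apply: measurable_funM => //; exact: continuous_measurable_fun.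
exact: gaussian_ibp dh ch' hC h'C.
Qed.

Lemma gamma_mean : \int[gamma]_x x = 0.
Proof.
have H : \int[gamma]_x (0 - x * 1) = 0.
  apply: (@gamma_ibp (fun=> 1) (fun=> 0) 1) => [x|x|x].
  - exact: cvg_cst.
  - by rewrite mul1r normr1 lerDl.
  - by rewrite mul1r normr0 addr_ge0.
apply: oppr_inj; rewrite oppr0 -[RHS]H -mulN1r -RintegralZl//; last first.
  exact: gamma_integrable_id.
by apply: eq_Rintegral => x _; ring.
Qed.

Lemma gamma_sqr : \int[gamma]_x (x ^+ 2) = 1.
Proof.
have H : \int[gamma]_x (1 - x * x) = 0.
  apply: (@gamma_ibp id (fun=> 1) 1) => [x|x|x].
  - exact: cvg_cst.
  - by rewrite mul1r lerDr.
  - by rewrite mul1r normr1 lerDl.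
move: H; under eq_Rintegral do rewrite -expr2.
rewrite RintegralB//; [|exact: bm_integrable (bm_cst _ 1)|exact: gamma_integrable_sqr].
by rewrite bm_int_cst => /eqP; rewrite subr_eq0 => /eqP.
Qed.

Lemma continuous_affine_cos (t q : R) : continuous (fun x : R => cos (t * x + q)).
Proof.
move=> x; apply: continuous_comp; last exact: continuous_cos.
apply: cvgD; last exact: cvg_cst.
by apply: cvgM; [exact: cvg_cst|exact: cvg_id].
Qed.

Let F (q t : R) := \int[gamma]_x cos (t * x + q).

(** Differentiation under the integral gives minus the mean of x sin (t x + q), and Stein's identity
    for sin (t x + q) turns it into - t F. This differential equation yields the characteristic
    function in [gamma_cos]. *)
Let F_derive (q t : R) : is_derive t (1 : R) (F q) (- t * F q t).
Proof.
pose g (t : R) (x : measurableTypeR R) : R := cos (t * x + q).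
have dg (t' x : R) : is_derive t' (1 : R) (g ^~ x) (- sin (t' * x + q) * x).
  have h : is_derive t' (1 : R) (fun u : R => u * x + q) x.
    by apply: is_derive_eq; rewrite addr0 scaler0 add0r /GRing.scale /= mulr1.
  have e := @is_derive1_comp _ cos (fun u => u * x + q) t' _ _ (is_derive_cos _) h.
  exact: e.
have tI : `]t - 1, t + 1[%classic t by rewrite /= in_itv/= gtrBl ltrDl ltr01.
have ig (x : R) : `]t - 1, t + 1[%classic x -> gamma.-integrable setT (EFin \o g x).
  by move=> _; apply: bm_integrable; exact: bm_cos.
have dd (x y : R) : `]t - 1, t + 1[%classic x -> setT y -> derivable (g ^~ y) x 1.
  by move=> _ _; have [] := dg x y.
have bd (x y : R) : `]t - 1, t + 1[%classic x -> setT y ->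
    `|partial1of2 g x y| <= `|y|.
  move=> _ _; rewrite partial1of2E; have [_ ->] := dg x y.
  by rewrite normrM normrN ler_piMl// sin_max.
have iG : gamma.-integrable setT (EFin \o (fun y : measurableTypeR R => `|y|)).
  by have := integrable_abse gamma_integrable_id.
have dF : derivable (F q) t 1.
  exact: (derivable_under_integral measurableT tI ig dd (fun y => normr_ge0 y) iG bd).
have F' : 'D_1 (F q) t = - t * F q t.
  rewrite -derive1E.
  rewrite (differentiation_under_integral measurableT tI ig dd (fun y => normr_ge0 y) iG bd).
  have H : \int[gamma]_x (t * cos (t * x + q) - x * sin (t * x + q)) = 0.
    apply: (@gamma_ibp (fun x => sin (t * x + q)) (fun x => t * cos (t * x + q)) (1 + `|t|)).
    - move=> x; have h : is_derive x (1 : R) (fun u : R => t * u + q) t.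
        by apply: is_derive_eq; rewrite addr0 /GRing.scale /= mulr1.
      have e := @is_derive1_comp _ sin (fun u => t * u + q) x _ _ (is_derive_sin _) h.
      by apply: (is_derive_eq e); rewrite mulrC.
    - by move=> x; apply: cvgM; [exact: cvg_cst|exact: continuous_affine_cos].
    - move=> x; apply: (le_trans (sin_max _)).
      by have := normr_ge0 x; have := normr_ge0 t; nra.
    - move=> x; rewrite normrM; have := cos_max (t * x + q).
      by have := normr_ge0 x; have := normr_ge0 t; have := normr_ge0 (cos (t * x + q)); nra.
  have ix : gamma.-integrable setT (EFin \o (fun x : measurableTypeR R => x * sin (t * x + q))).
    apply: (gamma_integrable (C := 1)).
      apply: measurable_funM => //; apply: continuous_measurable_fun => x.
      apply: continuous_comp; last exact: continuous_sin.
      by apply: cvgD; [apply: cvgM; [exact: cvg_cst|exact: cvg_id]|exact: cvg_cst].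
    move=> x; rewrite normrM mul1r -[x ^+ 2]ger0_norm ?sqr_ge0// normrX.
    have := sin_max (t * x + q); have := normr_ge0 x.
    have := normr_ge0 (sin (t * x + q)); nra.
  rewrite RintegralB// in H; last first.
    by apply: bm_integrable; apply: bmZ; exact: bm_cos.
  rewrite bm_intZ in H; last exact: bm_cos.
  rewrite /F mulNr; move/eqP: H; rewrite subr_eq0 => /eqP ->.
  rewrite -mulN1r -RintegralZl//.
  apply: eq_Rintegral => x _; rewrite partial1of2E; have [_ ->] := dg t x; ring.
by apply: DeriveDef.
Qed.

Lemma gamma_cos (t q : R) :
  \int[gamma]_x cos (t * x + q) = expR (- t ^+ 2 / 2) * cos q.
Proof.
have dE (u : R) : is_derive u (1 : R) (fun u => F q u * expR (u ^+ 2 / 2)) 0.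
  have h : is_derive u (1 : R) (fun y : R => y ^+ 2 / 2) u.
    by apply: is_derive_eq; rewrite !scaler0 add0r /GRing.scale /= mulr1; field.
  have e := @is_derive1_comp _ expR (fun y => y ^+ 2 / 2) u _ _ (is_derive_expR _) h.
  have m := is_deriveM (F_derive q u) e.
  by apply: (is_derive_eq m); rewrite /GRing.scale /=; ring.
have := is_derive_0_is_cst t 0 dE.
rewrite {2}/F expr0n/= mul0r expR0 mulr1.
rewrite (_ : \int[gamma]_x cos (0 * x + q) = cos q); last first.
  by under eq_Rintegral do rewrite mul0r add0r; rewrite bm_int_cst.
move=> <-; rewrite mulNr expRN mulrCA mulVf ?mulr1//.
by rewrite gt_eqF// expR_gt0.
Qed.

End gaussian.

(** Both sides are integrals over the common push-forward. Integrability is transferred along with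
    the value because the moments of the Gaussian process have to be deduced from its laws. *)
Lemma same_law_integral (R : realType) d1 (T1 : measurableType d1)
    (P1 : probability T1 R) d2 (T2 : measurableType d2) (P2 : probability T2 R)
    d (Z : measurableType d) (Y1 : T1 -> Z) (Y2 : T2 -> Z) (f : Z -> R) :
  measurable_fun setT Y1 -> measurable_fun setT Y2 ->
  (forall A, measurable A -> P1 (Y1 @^-1` A) = P2 (Y2 @^-1` A)) ->
  measurable_fun setT f ->
  P2.-integrable setT (EFin \o (f \o Y2)) ->
  P1.-integrable setT (EFin \o (f \o Y1)) /\
  \int[P1]_x f (Y1 x) = \int[P2]_x f (Y2 x).
Proof.
move=> m1 m2 law mf i2.
have mfE : measurable_fun setT (EFin \o f) by exact/measurable_EFinP.
have E (g : Z -> \bar R) :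
    (\int[pushforward P1 Y1]_y g y = \int[pushforward P2 Y2]_y g y)%E.
  by apply: eq_measure_integral => A mA _; rewrite /pushforward; exact: law.
have i1 : P1.-integrable setT (EFin \o (f \o Y1)).
  apply/integrableP; split; first exact: (measurableT_comp mfE m1).
  have mn : measurable_fun setT (fun y : Z => `|(f y)%:E|%E) by exact: measurableT_comp.
  have := @ge0_integral_pushforward _ _ _ _ _ _ m1 P1 setT _ measurableT mn (fun y _ => abse_ge0 _).
  rewrite preimage_setT /= => <-; rewrite E.
  have -> := @ge0_integral_pushforward _ _ _ _ _ _ m2 P2 setT _ measurableT mn (fun y _ => abse_ge0 _).
  by rewrite preimage_setT; have /integrableP[] := i2.
split=> //; rewrite /Rintegral; congr fine.
have := @integral_pushforward _ _ _ _ _ _ m1 P1 setT _ mfE; rewrite preimage_setT.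
move=> /(_ i1 measurableT) /= <-; rewrite E.
have := @integral_pushforward _ _ _ _ _ _ m2 P2 setT _ mfE; rewrite preimage_setT.
by move=> /(_ i2 measurableT) /= <-.
Qed.

Section gauss_law.
Variable R : realType.
Local Notation mu := (@lebesgue_measure R).
Local Notation p := (@normal_pdf R 0 1).
Local Notation gamma := (@normal_prob R 0 1).

Lemma normal_prob_cos (m s t q : R) : 0 < s ->
  \int[normal_prob m s]_x cos (t * x + q) = \int[gamma]_g cos (t * (m + s * g) + q).
Proof.
move=> s0.
have bc : bounded_measurable (fun g : measurableTypeR R => cos (t * (m + s * g) + q)).
  have := bm_cos (t * s) (t * m + q); congr bounded_measurable.
  by apply/funext => g; congr cos; ring.
(* The substitution rule is stated for nonnegative integrands; adding 1 to the cosine makes it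
   applicable. *)
suff : \int[normal_prob m s]_x (1 + cos (t * x + q)) =
       \int[gamma]_g (1 + cos (t * (m + s * g) + q)).
  rewrite bm_intD; [|exact: bm_cst|exact: bm_cos].
  rewrite bm_intD; [|exact: bm_cst|exact: bc].
  by rewrite !bm_int_cst => /addrI.
have [mc _] := bc.
rewrite !Rintegral_normal_prob; last 2 first.
- by case: (bmD (bm_cst _ 1) bc).
- by case: (bmD (bm_cst _ 1) (bm_cos t q)).
pose G (g : R) := (1 + cos (t * (m + s * g) + q)) * p g.
pose F (x : R^o) := (x - m) / s.
have F'E : F^`()%classic = cst s^-1.
  apply/funext => x; rewrite /F derive1E deriveM// deriveD// derive_cst scaler0.
  by rewrite add0r derive_id derive_cst addr0 scaler1.
rewrite /Rintegral; congr fine.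
rewrite (@increasing_ge0_integration_by_substitutionT _ F G).
- apply: eq_integral => x _; congr EFin.
  have FK : m + s * F x = x by rewrite /F; field; rewrite gt_eqF.
  rewrite F'E; change (cst s^-1 x) with s^-1.
  transitivity (G (F x) * s^-1); last by [].
  rewrite /G FK -mulrA; congr (_ * _); rewrite /F.
  rewrite normal_pdfE ?gt_eqF// std_normal_pdfE /normal_fun mulrAC; congr (_ * _).
    rewrite /normal_peak expr1n mul1r -mulrnAr sqrtrM ?sqr_ge0// sqrtr_sqr gtr0_norm//.
    by rewrite invfM mulrC.
  congr expR; field; by rewrite gt_eqF.
- move=> x y xy; rewrite /F ltr_pM2r ?ltrD2r// invr_gt0//.
- by rewrite F'E => ?; exact: cvg_cst.
- by rewrite F'E; exact: is_cvg_cst.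
- by rewrite F'E; exact: is_cvg_cst.
- by move=> x; apply: derivableM.
- apply/gt0_cvgMlNy; last exact: cvg_addrr_Ny.
  by rewrite invr_gt0.
- apply/gt0_cvgMly; last exact: cvg_addrr.
  by rewrite invr_gt0.
- move=> x; apply: cvgM; last by apply: continuous_normal_pdf; rewrite oner_eq0.
  apply: cvgD; first exact: cvg_cst.
  have := @continuous_affine_cos R (t * s) (t * m + q) x.
  rewrite (_ : (fun x => cos _) = (fun g => cos (t * (m + s * g) + q)))//.
  by apply/funext => g; congr cos; ring.
- move=> x; apply: mulr_ge0; last exact: normal_pdf_ge0.
  by rewrite -lerBlDl sub0r cos_geN1.
Qed.

Lemma measurable_affine (m s : R) :
  measurable_fun setT (fun g : measurableTypeR R => m + s * g : measurableTypeR R).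
Proof. by apply: measurable_funD => //; exact: measurable_funM. Qed.

Lemma normal_probE (m s : R) (A : set (measurableTypeR R)) : 0 < s -> measurable A ->
  normal_prob m s A = gamma ((fun g => m + s * g) @^-1` A).
Proof.
move=> s0 mA.
have := @cos_int_unique R _ _ (normal_prob m s) _ _ gamma id
  (fun g => m + s * g) (fun=> 1) (fun=> 1) \1_A (@measurable_id _ _ _)
  (measurable_affine m s) (bm_cst _ 1) (bm_cst _ 1).
move=> /(_ _ (bm_indic R mA)) H.
have {}H : \int[normal_prob m s]_x \1_A x =
    \int[gamma]_g \1_((fun g => m + s * g) @^-1` A) g.
  have {}H := H _; under eq_Rintegral do rewrite -[\1_A _]mulr1.
  under [in RHS]eq_Rintegral do rewrite -[\1__ _]mulr1; apply: H.
  move=> t q; under eq_Rintegral do rewrite mulr1.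
  under [in RHS]eq_Rintegral do rewrite mulr1.
  exact: normal_prob_cos.
have mA' : measurable ((fun g : measurableTypeR R => m + s * g : measurableTypeR R) @^-1` A).
  by rewrite -[X in measurable X]setTI; exact: measurable_affine.
rewrite (bm_int_indic _ mA) (bm_int_indic _ mA') in H.
rewrite -[LHS]fineK ?fin_num_measure// -[RHS]fineK; last exact: fin_num_measure.
by congr EFin.
Qed.

(** The image of the standard normal law under an affine map covers the Dirac mass at variance 0 and
    the nondegenerate case alike. *)
Lemma gauss_lawE (m v : R) (A : set (measurableTypeR R)) : 0 <= v -> measurable A ->
  gauss_law m v A = gamma ((fun g => m + Num.sqrt v * g) @^-1` A).
Proof.
move=> v0 mA; rewrite /gauss_law; case: eqVneq => [->|vn0]; last first.
  by rewrite normal_probE// sqrtr_gt0 lt_neqAle eq_sym vn0.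
rewrite sqrtr0 diracE; have [/set_mem mAm|mAm] := boolP (m \in A).
  rewrite (_ : _ @^-1` _ = setT) ?probability_setT//.
  by apply/seteqP; split => // g _ /=; rewrite mul0r addr0.
rewrite (_ : _ @^-1` _ = set0) ?measure0//.
apply/seteqP; split => // g /=; rewrite mul0r addr0 => Am.
by move/negP: mAm; apply; exact: mem_set.
Qed.

Section gaussian_variable.
Context d (T : measurableType d) (Pr : probability T R) (Y : T -> measurableTypeR R).
Variables (m v : R).
Hypothesis mY : measurable_fun setT Y.
Hypothesis v0 : 0 <= v.
Hypothesis lawY : forall A : set (measurableTypeR R), measurable A ->
  Pr (Y @^-1` A) = gauss_law m v A.

Let law A : measurable A -> Pr (Y @^-1` A) =
  gamma ((fun g => m + Num.sqrt v * g) @^-1` A).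
Proof. by move=> mA; rewrite lawY// gauss_lawE. Qed.

Let transfer f := same_law_integral (f := f) mY (measurable_affine m (Num.sqrt v)) law.

Let i_Zid (c : R) : gamma.-integrable setT
  (EFin \o (fun g : measurableTypeR R => c * g)).
Proof.
rewrite (_ : _ \o _ = (fun g : measurableTypeR R => c%:E * g%:E)%E)//.
by apply: integrableZl => //; exact: gamma_integrable_id.
Qed.

Let i_affine : gamma.-integrable setT
  (EFin \o (id \o (fun g : measurableTypeR R => m + Num.sqrt v * g))).
Proof.
rewrite (_ : _ \o _ = (fun g => m%:E + (Num.sqrt v)%:E * g%:E)%E); last first.
  by apply/funext => g.
apply: integrableD => //; first exact: bm_integrable (bm_cst _ m).
by apply: integrableZl => //; exact: gamma_integrable_id.
Qed.

Lemma gauss_integrable : Pr.-integrable setT (EFin \o Y).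
Proof. by have [] := transfer (f := id) (@measurable_id _ _ _) i_affine. Qed.

Lemma gauss_mean : \int[Pr]_x Y x = m.
Proof.
have [_] := transfer (f := id) (@measurable_id _ _ _) i_affine; rewrite /= => ->.
rewrite RintegralD//; last exact: bm_integrable (bm_cst _ m).
rewrite bm_int_cst RintegralZl//; last exact: gamma_integrable_id.
by rewrite gamma_mean mulr0 addr0.
Qed.

Let sqE : (fun g : measurableTypeR R => (m + Num.sqrt v * g) ^+ 2) =
  (fun g => (m ^+ 2 + (2 * m * Num.sqrt v) * g) + v * g ^+ 2).
Proof.
by apply/funext => g; rewrite -[X in X * _ ^+ 2](sqr_sqrtr v0); ring.
Qed.

Let i_lin : gamma.-integrable setT
  (EFin \o (fun g : measurableTypeR R => m ^+ 2 + (2 * m * Num.sqrt v) * g)).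
Proof.
rewrite (_ : _ \o _ = (fun g => (m ^+ 2)%:E + (2 * m * Num.sqrt v)%:E * g%:E)%E)//.
apply: integrableD => //; first exact: bm_integrable (bm_cst _ _).
by apply: integrableZl => //; exact: gamma_integrable_id.
Qed.

Let i_quad : gamma.-integrable setT (EFin \o (fun g : measurableTypeR R => v * g ^+ 2)).
Proof.
rewrite (_ : _ \o _ = (fun g : measurableTypeR R => v%:E * (g ^+ 2)%:E)%E)//.
by apply: integrableZl => //; exact: gamma_integrable_sqr.
Qed.

Let i_sq : gamma.-integrable setT
  (EFin \o ((fun x => x ^+ 2) \o (fun g : measurableTypeR R => m + Num.sqrt v * g))).
Proof.
rewrite (_ : _ \o (_ \o _) = EFin \o (fun g : measurableTypeR R => (m + Num.sqrt v * g) ^+ 2))//.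
rewrite sqE (_ : _ \o _ = (fun g : measurableTypeR R =>
    (m ^+ 2 + (2 * m * Num.sqrt v) * g)%:E + (v * g ^+ 2)%:E)%E)//.
by apply: integrableD.
Qed.

Let m_sq : measurable_fun setT (fun x : measurableTypeR R => x ^+ 2).
Proof. exact: measurable_funX. Qed.

Lemma gauss_integrable_sqr : Pr.-integrable setT (EFin \o (fun x => Y x ^+ 2)).
Proof. by have [] := transfer m_sq i_sq. Qed.

Lemma gauss_sqr : \int[Pr]_x (Y x ^+ 2) = m ^+ 2 + v.
Proof.
have [_] := transfer m_sq i_sq; rewrite /= => ->; rewrite sqE.
rewrite RintegralD// RintegralD//; last exact: bm_integrable (bm_cst _ _).
rewrite bm_int_cst !RintegralZl//; last 2 first.
- exact: gamma_integrable_sqr.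
- exact: gamma_integrable_id.
by rewrite gamma_mean gamma_sqr mulr0 addr0 mulr1.
Qed.

Lemma gauss_cos q : \int[Pr]_x cos (Y x + q) = expR (- v / 2) * cos (m + q).
Proof.
have := transfer (f := fun x => cos (x + q)) _ _.
have b1 : bounded_measurable (fun x : measurableTypeR R => cos (x + q)).
  by have := bm_cos 1 q; under eq_fun do rewrite mul1r.
case=> [||_ ->]; first by case: b1.
- exact: (bm_integrable _ (bm_comp (measurable_affine m (Num.sqrt v)) b1)).
- under eq_Rintegral do rewrite addrAC addrC.
  by rewrite gamma_cos sqr_sqrtr.
Qed.

End gaussian_variable.
End gauss_law.

Section bm_fubini.
Context d1 (T1 : measurableType d1) d2 (T2 : measurableType d2) (R : realType).
Variables (P1 : probability T1 R) (P2 : probability T2 R).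
Variable F : T1 * T2 -> R.
Hypothesis bF : bounded_measurable F.

Let iF : (P1 \x P2)%E.-integrable setT (EFin \o F).
Proof. exact: (bm_integrable (P1 \x P2)%E bF). Qed.

Lemma bm_section1 x : bounded_measurable (fun y => F (x, y)).
Proof. by apply: bm_comp bF; exact: pair1_measurable. Qed.

Lemma bm_section2 y : bounded_measurable (fun x => F (x, y)).
Proof. by apply: bm_comp bF; exact: pair2_measurable. Qed.

Let EF x : (\int[P2]_y (F (x, y))%:E)%E = (\int[P2]_y F (x, y))%:E.
Proof. by rewrite bm_EFin//; exact: bm_section1. Qed.

Let EG y : (\int[P1]_x (F (x, y))%:E)%E = (\int[P1]_x F (x, y))%:E.
Proof. by rewrite bm_EFin//; exact: bm_section2. Qed.

Lemma bm_partial1 : bounded_measurable (fun x => \int[P2]_y F (x, y)).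
Proof.
have [_ [B FB]] := bF; split.
  apply/measurable_EFinP; rewrite (_ : _ \o _ = fubini_F P2 (EFin \o F)).
    exact: measurable_fubini_F iF.
  by apply/funext => x; rewrite /fubini_F /= EF.
by exists B => x; apply: bm_int_norm => //; exact: bm_section1.
Qed.

Lemma bm_fubini1 :
  \int[(P1 \x P2)%E]_z F z = \int[P1]_x \int[P2]_y F (x, y).
Proof.
rewrite /Rintegral -(integral12_prod_meas1 iF); congr fine.
by apply: eq_integral => x _; rewrite /fubini_F /= EF.
Qed.

Lemma bm_fubini2 :
  \int[(P1 \x P2)%E]_z F z = \int[P2]_y \int[P1]_x F (x, y).
Proof.
rewrite /Rintegral -(integral21_prod_meas1 iF); congr fine.
by apply: eq_integral => x _; rewrite /fubini_G /= EG.
Qed.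

Lemma bm_fubini :
  \int[P1]_x \int[P2]_y F (x, y) = \int[P2]_y \int[P1]_x F (x, y).
Proof. by rewrite -bm_fubini1 bm_fubini2. Qed.

End bm_fubini.

(** * Moving averages of Gaussian noise *)

Section moving_average.
Variable R : realType.
Local Notation gamma := (@normal_prob R 0 1).
Variables sg cs sn : R.

(* With X_i = sg (cs G_i + sn G_(i-1)) for independent standard normal G_i,
   ma_filter f k g is the expectation of f_0(X_1) ... f_(k-1)(X_k) given G_k = g. *)
Fixpoint ma_filter (f : nat -> measurableTypeR R -> R) (k : nat) :
    measurableTypeR R -> R :=
  match k with
  | 0 => fun=> 1
  | k'.+1 => fun g' => \int[gamma]_g (f k' (sg * (cs * g' + sn * g)) * ma_filter f k' g)
  end.

Lemma measurable_ma_point :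
  measurable_fun setT (fun z : measurableTypeR R * measurableTypeR R =>
    sg * (cs * z.1 + sn * z.2) : measurableTypeR R).
Proof.
by apply: measurable_funM => //; apply: measurable_funD; apply: measurable_funM.
Qed.

Lemma bm_ma_filter_step f (V : measurableTypeR R -> R) :
  bounded_measurable f -> bounded_measurable V ->
  bounded_measurable (fun z : measurableTypeR R * measurableTypeR R =>
    f (sg * (cs * z.1 + sn * z.2)) * V z.2).
Proof.
move=> bf bV; apply: bmM; first exact: bm_comp measurable_ma_point bf.
exact: bm_comp (@measurable_snd _ _ _ _) bV.
Qed.

Variable f : nat -> measurableTypeR R -> R.
Hypothesis bf : forall i, bounded_measurable (f i).

Lemma bm_ma_filter k : bounded_measurable (ma_filter f k).
Proof.
elim: k => [|k IH] /=; first exact: bm_cst.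
exact: (bm_partial1 gamma gamma (bm_ma_filter_step (bf k) IH)).
Qed.

Variables (d : measure_display) (T : measurableType d) (P : probability T R).
Variable x : nat -> T -> measurableTypeR R.
Hypothesis mx : forall i, measurable_fun setT (x i).
(** The exponent is the variance of the sum of the t_i x_i, collected by noise variable: the oldest
    one enters with coefficient sg sn t_0, and the one first used by x_i with coefficient sg (cs t_i
    + sn t_(i+1)). *)
Hypothesis xcos : forall m (t : nat -> R) q, (forall i, (m <= i)%N -> t i = 0) ->
  \int[P]_w cos (\sum_(i < m) t i * x i w + q) =
  expR (- ((sg * sn * t 0%N) ^+ 2 +
           \sum_(i < m) (sg * (cs * t i + sn * t i.+1)) ^+ 2) / 2) * cos q.

Let bm_sumcos k m (t : nat -> R) q :
  bounded_measurable (fun w => cos (\sum_(i < m) t i * x (k + i)%N w + q)).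
Proof.
have mS : measurable_fun setT (fun w => \sum_(i < m) t i * x (k + i)%N w : measurableTypeR R).
  by apply: measurable_sum => i; apply: measurable_funM => //; exact: mx.
have b1 : bounded_measurable (fun y : measurableTypeR R => cos (y + q)).
  by have := bm_cos 1 q; under eq_fun do rewrite mul1r.
exact: bm_comp mS b1.
Qed.

Let bm_prodx k : bounded_measurable (fun w => \prod_(i < k) f i (x i w)).
Proof. by apply: bm_prod => i; apply: bm_comp. Qed.

Let cosM (a b : R) : cos a * cos b = 2^-1 * cos (a + b) + 2^-1 * cos (b - a).
Proof. by rewrite cosD cosB; field. Qed.

(** The trailing cosine of later observations is what makes the induction on k work. By uniqueness
    of characteristic functions it suffices to replace the factor [f k] by a cosine of x_k;
    product-to-sum merges that cosine with the trailing one, and the induction hypothesis applies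
    with m + 1 frequencies. On the right, the later observations meet the first k ones only through
    the last noise variable g. *)
Lemma ma_joint_cos k m (t : nat -> R) q : (forall i, (m <= i)%N -> t i = 0) ->
  \int[P]_w ((\prod_(i < k) f i (x i w)) *
             cos (\sum_(i < m) t i * x (k + i)%N w + q)) =
  expR (- (\sum_(i < m) (sg * (cs * t i + sn * t i.+1)) ^+ 2) / 2) *
  \int[gamma]_g (ma_filter f k g * cos (sg * sn * t 0%N * g + q)).
Proof.
elim: k m t q => [|k IH] m t q t0.
  under eq_Rintegral do rewrite big_ord0 mul1r.
  under [in RHS]eq_Rintegral do rewrite /= mul1r.
  rewrite gamma_cos; transitivity (\int[P]_w cos (\sum_(i < m) t i * x i w + q)); first by [].
  by rewrite xcos// mulrA -expRD; congr (expR _ * _); field.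
set beta := \sum_(i < m) _; set b := sg * sn * t 0%N.
pose V := ma_filter f k; have bV : bounded_measurable V := bm_ma_filter k.
pose F1 w := (\prod_(i < k) f i (x i w)) *
  cos (\sum_(i < m) t i * x (k.+1 + i)%N w + q).
pose F2 (z : measurableTypeR R * measurableTypeR R) :=
  expR (- beta / 2) * (V z.2 * cos (b * z.1 + q)).
have bF1 : bounded_measurable F1 by apply: bmM.
have bF2 : bounded_measurable F2.
  apply: bmZ; apply: bmM; first exact: bm_comp (@measurable_snd _ _ _ _) bV.
  exact: bm_comp (@measurable_fst _ _ _ _) (bm_cos b q).
have := cos_int_unique (P1 := P) (P2 := (gamma \x gamma)%E)
  (mx k) measurable_ma_point bF1 bF2 _ (bf k).
move=> H; transitivity (\int[P]_w (f k (x k w) * F1 w)).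
  by apply: eq_Rintegral => w _; rewrite /F1 big_ord_recr /=; ring.
rewrite {}H.
  rewrite bm_fubini1; last first.
    by apply: bmM => //; apply: bm_comp measurable_ma_point _.
  rewrite -bm_intZ; last by apply: bmM; [exact: bm_ma_filter|exact: bm_cos].
  apply: eq_Rintegral => g' _ /=.
  transitivity (\int[gamma]_g (expR (- beta / 2) * cos (b * g' + q) *
      (f k (sg * (cs * g' + sn * g)) * V g))).
    by apply: eq_Rintegral => g _; rewrite /F2 /=; ring.
  rewrite bm_intZ; last exact: (bm_section1 (bm_ma_filter_step (bf k) bV)).
  by rewrite -/V; ring.
move=> tau p.
(* Prepends the frequency [u] of x_k to those of the later observations. *)
pose t' (u : R) i := if i is i'.+1 then t i' else u.
have t'0 u i : (m.+1 <= i)%N -> t' u i = 0 by case: i => //= i; exact: t0.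
have sE u w : \sum_(i < m.+1) t' u i * x (k + i)%N w =
    u * x k w + \sum_(i < m) t i * x (k.+1 + i)%N w.
  rewrite big_ord_recl /= addn0; congr (_ + _); apply: eq_bigr => i _.
  by rewrite /bump /= add1n addSnnS.
have bE u : \sum_(i < m.+1) (sg * (cs * t' u i + sn * t' u i.+1)) ^+ 2 =
    (sg * (cs * u + sn * t 0%N)) ^+ 2 + beta.
  rewrite big_ord_recl /=; congr (_ + _); apply: eq_bigr => i _.
  rewrite /bump /= ?add1n.
pose W u q' := \int[P]_w ((\prod_(i < k) f i (x i w)) *
  cos (\sum_(i < m.+1) t' u i * x (k + i)%N w + q')).
transitivity (2^-1 * W tau (p + q) + 2^-1 * W (- tau) (q - p)).
  rewrite -!bm_intZ -?bm_intD; try by do ?[apply: bmZ|apply: bmM|exact: bm_sumcos].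
  apply: eq_Rintegral => w _; rewrite /F1 !sE mulrCA cosM.
  set S := \sum_(i < m) _.
  rewrite (_ : tau * x k w + p + (S + q) = tau * x k w + S + (p + q)); last by ring.
  rewrite (_ : S + q - (tau * x k w + p) = - tau * x k w + S + (q - p)); last by ring.
  ring.
have WE u q' : W u q' = expR (- ((sg * (cs * u + sn * t 0%N)) ^+ 2 + beta) / 2) *
    \int[gamma]_g (V g * cos (sg * sn * u * g + q')).
  by rewrite /W (IH _ _ _ (t'0 u)) -[in RHS](bE u).
rewrite !WE.
(* Here z.1 is the noise variable first used by x_k and z.2 the previous one. Integrating z.1 out
   produces the Gaussian factor left by the induction hypothesis. *)
pose G u q' (z : measurableTypeR R * measurableTypeR R) :=
  expR (- beta / 2) *
  (V z.2 * cos ((b + u * sg * cs) * z.1 + (u * sg * sn * z.2 + q'))).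
have bG u q' : bounded_measurable (G u q').
  apply: bmZ; apply: bmM; first exact: bm_comp (@measurable_snd _ _ _ _) bV.
  have b1 : bounded_measurable (fun y : measurableTypeR R => cos (y + q')).
    by have := bm_cos 1 q'; under eq_fun do rewrite mul1r.
  have mm : measurable_fun setT (fun z : measurableTypeR R * measurableTypeR R =>
      (b + u * sg * cs) * z.1 + u * sg * sn * z.2 : measurableTypeR R).
    by apply: measurable_funD; apply: measurable_funM.
  by have := bm_comp mm b1; under eq_fun do rewrite -addrA.
have E u q' : expR (- ((sg * (cs * u + sn * t 0%N)) ^+ 2 + beta) / 2) *
    \int[gamma]_g (V g * cos (sg * sn * u * g + q')) =
    \int[(gamma \x gamma)%E]_z G u q' z.
  rewrite bm_fubini2// -bm_intZ; last by apply: bmM => //; exact: bm_cos.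
  apply: eq_Rintegral => g _; rewrite /G /=.
  rewrite bm_intZ; last by apply: bmZ; exact: bm_cos.
  rewrite bm_intZ; last exact: bm_cos.
  rewrite gamma_cos.
  rewrite (_ : u * sg * sn * g + q' = sg * sn * u * g + q'); last by ring.
  rewrite (_ : - ((sg * (cs * u + sn * t 0%N)) ^+ 2 + beta) / 2 =
    - beta / 2 + - (b + u * sg * cs) ^+ 2 / 2); last by rewrite /b; field.
  by rewrite expRD; ring.
rewrite !E; symmetry.
transitivity (\int[(gamma \x gamma)%E]_z
    (2^-1 * G tau (p + q) z + 2^-1 * G (- tau) (q - p) z)).
  apply: eq_Rintegral => z _; rewrite /F2 /G mulrCA [cos _ * _]mulrCA cosM.
  set A := tau * _ + p + _; set B := b * _ + q - _.
  rewrite (_ : (b + tau * sg * cs) * _ + _ = A); last by rewrite /A; ring.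
  rewrite (_ : (b + - tau * sg * cs) * _ + _ = B); last by rewrite /B; ring.
  ring.
rewrite bm_intD; [|exact: bmZ|exact: bmZ].
by rewrite (bm_intZ _ _ (bG tau (p + q))) (bm_intZ _ _ (bG (- tau) (q - p))).
Qed.

Lemma ma_joint k :
  \int[P]_w (\prod_(i < k) f i (x i w)) = \int[gamma]_g ma_filter f k g.
Proof.
have := @ma_joint_cos k 0 (fun=> 0) 0 (fun _ _ => erefl).
rewrite big_ord0 oppr0 mul0r expR0 mul1r => H.
transitivity (\int[P]_w (\prod_(i < k) f i (x i w) *
    cos (\sum_(i < 0) 0 * x (k + i)%N w + 0))).
  by apply: eq_Rintegral => w _; rewrite big_ord0 addr0 cos0 mulr1.
rewrite H; apply: eq_Rintegral => g _.
by rewrite mulr0 mul0r addr0 cos0 mulr1.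
Qed.

End moving_average.

(** The variance of a linear combination, computed once from the tridiagonal covariance matrix c and
    once from the noise variables. The induction adds one row and one column at a time. *)
Lemma ma_quadratic_form (R : realType) (sg cs sn : R) (t : nat -> R) (c : nat -> nat -> R) m :
  cs ^+ 2 + sn ^+ 2 = 1 -> (forall i, (m <= i)%N -> t i = 0) ->
  (forall i, c i i = sg ^+ 2) -> (forall i, c i i.+1 = sg ^+ 2 * (cs * sn)) ->
  (forall i j, (i.+1 < j)%N -> c i j = 0) -> (forall i j, c i j = c j i) ->
  \sum_(i < m) \sum_(j < m) t i * t j * c i j =
  (sg * sn * t 0%N) ^+ 2 + \sum_(i < m) (sg * (cs * t i + sn * t i.+1)) ^+ 2.
Proof.
move=> cs1 t0 c0 c1 c2 cC.
pose tp n := if n is n'.+1 then t n' else 0.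
have row n : \sum_(i < n) t i * c i n = sg ^+ 2 * (cs * sn) * tp n.
  case: n => [|n]; first by rewrite big_ord0 mulr0.
  rewrite big_ord_recr /= c1 big1 ?add0r; first by rewrite mulrC.
  by move=> i _; rewrite c2 ?mulr0// ltnS.
(* The right-hand side for n variables already contains t n, through the noise variable shared with
   the next observation. The extra term on the left is that contribution, and it vanishes at n = m
   because t m = 0. *)
have H n : \sum_(i < n) \sum_(j < n) t i * t j * c i j +
    sg ^+ 2 * (sn ^+ 2 * t n ^+ 2 + 2 * (cs * sn) * (tp n * t n)) =
  (sg * sn * t 0%N) ^+ 2 + \sum_(i < n) (sg * (cs * t i + sn * t i.+1)) ^+ 2.
  elim: n => [|n IH]; first by rewrite !big_ord0 /=; ring.
  rewrite [in RHS]big_ord_recr /= addrA -IH big_ord_recr /=.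
  have -> : \sum_(i < n) \sum_(j < n.+1) t i * t j * c i j =
      \sum_(i < n) \sum_(j < n) t i * t j * c i j + t n * (sg ^+ 2 * (cs * sn) * tp n).
    rewrite -row big_distrr /= -big_split /=; apply: eq_bigr => i _.
    by rewrite big_ord_recr /=; congr (_ + _); ring.
  have -> : \sum_(j < n.+1) t n * t j * c n j =
      t n * (sg ^+ 2 * (cs * sn) * tp n) + t n ^+ 2 * sg ^+ 2.
    rewrite big_ord_recr /= c0 -expr2 -row big_distrr /=; congr (_ + _).
    by apply: eq_bigr => i _; rewrite cC mulrA.
  have -> : t n ^+ 2 * sg ^+ 2 = t n ^+ 2 * sg ^+ 2 * (cs ^+ 2 + sn ^+ 2).
    by rewrite cs1 mulr1.
  by rewrite /tp; ring.
by rewrite -H t0//; ring.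
Qed.

Lemma Rintegral_sum (R : realType) d (T : measurableType d) (P : probability T R)
    I (s : seq I) (F : I -> T -> R) :
  (forall i, P.-integrable setT (EFin \o F i)) ->
  P.-integrable setT (EFin \o (fun w => \sum_(i <- s) F i w)) /\
  \int[P]_w (\sum_(i <- s) F i w) = \sum_(i <- s) \int[P]_w F i w.
Proof.
move=> iF; elim: s => [|i s [IH1 IH2]].
  rewrite (_ : (fun w => _) = fun=> 0); last by apply/funext => w; rewrite big_nil.
  by rewrite big_nil bm_int_cst; split=> //; exact: bm_integrable (bm_cst _ 0).
rewrite (_ : (fun w => _) = fun w => F i w + \sum_(j <- s) F j w); last first.
  by apply/funext => w; rewrite big_cons.
rewrite big_cons RintegralD// IH2; split=> //.
exact: (integrableD measurableT (iF i) IH1).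
Qed.

Section gaussian_ma.
Context (R : realType) d (T : measurableType d) (Pr : probability T R).
Variable X : int -> {RV Pr >-> (measurableTypeR R)}.
Hypothesis gX : gaussian_process X.
Hypothesis sX : stationary_process X.
Hypothesis EX : forall t, ('E_Pr[X t] = 0)%E.
Variable a : int -> R.
Hypothesis cX : forall h, covariance Pr (X 0) (X h) = (a h)%:E.

Let mX t : measurable_fun setT (X t).
Proof. exact: measurable_funPT. Qed.

Let one_dim t : exists m v : R, 0 <= v /\
  forall A : set (measurableTypeR R), measurable A -> Pr (X t @^-1` A) = gauss_law m v A.
Proof.
have [m [v [v0 H]]] := gX (fun _ : 'I_1 => t) (fun=> 1).
exists m, v; split=> // A mA; rewrite -H//; congr (Pr _).
by apply/seteqP; split => w /=; rewrite big_ord1 mul1r.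
Qed.

Let iX t : Pr.-integrable setT (EFin \o X t).
Proof.
by have [m [v [v0 H]]] := one_dim t; exact: (gauss_integrable (mX t) v0 H).
Qed.

Let iX2 t : Pr.-integrable setT (EFin \o (fun w => X t w ^+ 2)).
Proof.
by have [m [v [v0 H]]] := one_dim t; exact: (gauss_integrable_sqr (mX t) v0 H).
Qed.

Let iXX s t : Pr.-integrable setT (EFin \o (fun w => X s w * X t w)).
Proof.
apply: (@le_integrable _ _ _ Pr setT measurableT _
  (fun w => (X s w ^+ 2)%:E + (X t w ^+ 2)%:E)%E).
- exact/measurable_EFinP/(measurable_funM (mX s) (mX t)).
- move=> w _ /=; rewrite lee_fin [leRHS]ger0_norm ?addr_ge0 ?sqr_ge0//.
  rewrite normrM -[X s w ^+ 2]ger0_norm ?sqr_ge0// -[X t w ^+ 2]ger0_norm ?sqr_ge0//.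
  rewrite !normrX; have := normr_ge0 (X s w); have := normr_ge0 (X t w).
  set x := `|X s w|; set y := `|X t w|; nra.
- exact: (integrableD measurableT (iX2 s) (iX2 t)).
Qed.

Let mean0 t : \int[Pr]_w X t w = 0.
Proof. by rewrite /Rintegral; have := EX t; rewrite unlock => ->. Qed.

Let cov0 h : \int[Pr]_w (X 0 w * X h w) = a h.
Proof.
have := cX h; rewrite covariance.unlock !EX /= => H.
apply: EFin_inj; rewrite -H unlock /Rintegral fineK//; last exact: (integrable_fin_num measurableT (iXX 0 h)).
apply: eq_integral => w _; transitivity (((X 0 w - 0) * (X h w - 0))%:E) => //.
by rewrite !subr0.
Qed.

(** The covariances are prescribed from time 0 only; stationarity of the pairs moves them to time
    s. *)
Let cov s (h : nat) : \int[Pr]_w (X s w * X (s + h%:Z) w) = a h.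
Proof.
pose t (i : 'I_2) : int := if i == ord0 then 0 else h%:Z.
pose Y1 w : 2.-tuple (measurableTypeR R) := [tuple X (t i + s) w | i < 2].
pose Y2 w : 2.-tuple (measurableTypeR R) := [tuple X (t i) w | i < 2].
pose f (z : 2.-tuple (measurableTypeR R)) : R := tnth z ord0 * tnth z ord_max.
have mY (u : 'I_2 -> int) :
    measurable_fun setT (fun w => [tuple X (u i) w | i < 2] : 2.-tuple (measurableTypeR R)).
  apply/measurable_fun_tnthP => i.
  rewrite (_ : _ \o _ = X (u i)); first exact: mX.
  by apply/funext => w /=; rewrite tnth_mktuple.
have [|||||_ H] := @same_law_integral R _ _ Pr _ _ Pr _ _ Y1 Y2 f.
- exact: (mY (fun i => t i + s)).
- exact: (mY t).
- by move=> A mA; exact: sX.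
- by apply: measurable_funM; exact: measurable_tnth.
- have := iXX 0 h; congr (Pr.-integrable setT _); apply/funext => w /=.
  by rewrite /f !tnth_mktuple.
rewrite -cov0.
rewrite -(_ : \int[Pr]_w f (Y1 w) = \int[Pr]_w (X s w * X (s + h%:Z) w)); last first.
  by apply: eq_Rintegral => w _; rewrite /f !tnth_mktuple /t /= add0r addrC.
rewrite H; apply: eq_Rintegral => w _; by rewrite /f !tnth_mktuple /t /=.
Qed.

Variables sg cs sn : R.
Hypothesis cs1 : cs ^+ 2 + sn ^+ 2 = 1.
Hypothesis a0 : a 0 = sg ^+ 2.
Hypothesis a1 : a 1 = sg ^+ 2 * (cs * sn).
Hypothesis a2 : forall n : nat, (1 < n)%N -> a n = 0.

(** The process is never realised as a moving average. Each linear combination is a centred Gaussian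
    whose variance is the quadratic form above, and this characteristic function is all that
    [ma_joint_cos] consumes. *)
Lemma gaussian_ma_cos m (t : nat -> R) q : (forall i, (m <= i)%N -> t i = 0) ->
  \int[Pr]_w cos (\sum_(i < m) t i * X i.+1%:Z w + q) =
  expR (- ((sg * sn * t 0%N) ^+ 2 +
           \sum_(i < m) (sg * (cs * t i + sn * t i.+1)) ^+ 2) / 2) * cos q.
Proof.
move=> t0; pose S w : measurableTypeR R := \sum_(i < m) t i * X i.+1%:Z w.
have mS : measurable_fun setT S.
  by apply: measurable_sum => i; apply: measurable_funM => //; exact: mX.
have [mu [v [v0 lawS]]] := gX (fun i : 'I_m => i.+1%:Z) t.
have iZ (k : R) F : Pr.-integrable setT (EFin \o F) ->
    Pr.-integrable setT (EFin \o (fun w => k * F w)).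
  move=> iF; rewrite (_ : _ \o _ = (fun w => k%:E * (F w)%:E)%E)//.
  exact: (integrableZl measurableT k iF).
have ES : \int[Pr]_w S w = 0.
  have [_ ->] := Rintegral_sum (index_enum 'I_m) (fun i => iZ (t i) _ (iX i.+1%:Z)).
  by apply: big1 => i _; rewrite RintegralZl// mean0 mulr0.
have ES2 : \int[Pr]_w (S w ^+ 2) =
    (sg * sn * t 0%N) ^+ 2 + \sum_(i < m) (sg * (cs * t i + sn * t i.+1)) ^+ 2.
  pose c (i j : nat) := \int[Pr]_w (X i.+1%:Z w * X j.+1%:Z w).
  have cC i j : c i j = c j i by apply: eq_Rintegral => w _; rewrite mulrC.
  have cE i h : c i (i + h)%N = a h.
    by rewrite /c -(cov i.+1%:Z h) -PoszD addSn.
  rewrite -(@ma_quadratic_form R sg cs sn t c)//.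
  - pose F (i j : 'I_m) w := t i * t j * (X i.+1%:Z w * X j.+1%:Z w).
    have iF i j : Pr.-integrable setT (EFin \o F i j) by exact: iZ _ _ (iXX _ _).
    have HF i := Rintegral_sum (index_enum 'I_m) (iF i).
    have [_ HH] := Rintegral_sum (index_enum 'I_m) (fun i => (HF i).1).
    transitivity (\int[Pr]_w \sum_i \sum_j F i j w).
      apply: eq_Rintegral => w _; rewrite /S expr2 mulr_suml; apply: eq_bigr => i _.
      by rewrite mulr_sumr; apply: eq_bigr => j _; rewrite /F; ring.
    rewrite HH; apply: eq_bigr => i _; rewrite (HF i).2; apply: eq_bigr => j _.
    by rewrite RintegralZl.
  - by move=> i; rewrite -{2}[i]addn0 cE a0.
  - by move=> i; rewrite -[i.+1]addn1 cE a1.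
  - by move=> i j ij; rewrite -(subnKC (ltnW (ltnW ij))) cE a2// ltn_subRL addn1.
have mu0 : mu = 0 by rewrite -(gauss_mean mS v0 lawS).
have vE : v = \int[Pr]_w (S w ^+ 2).
  by rewrite (gauss_sqr mS v0 lawS) mu0 expr0n add0r.
rewrite -ES2 -vE; have := gauss_cos mS v0 lawS q.
by rewrite mu0 add0r => <-.
Qed.

End gaussian_ma.

(** * Chi-square bound for private observations of a moving average *)

Section gaussian_correlation.
Variable R : realType.
Local Notation mu := (@lebesgue_measure R).
Local Notation p := (@normal_pdf R 0 1).
Local Notation gamma := (@normal_prob R 0 1).

Lemma Rintegral_affine_gamma (m s : R) (f : measurableTypeR R -> R) : 0 < s ->
  bounded_measurable f ->
  \int[gamma]_g f (m + s * g) = \int[mu]_x (f x * normal_pdf m s x).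
Proof.
move=> s0 bf; have [mf _] := bf; rewrite -(Rintegral_normal_prob m s mf); apply/esym.
have [|||||_ ->//] := @same_law_integral R _ _ (normal_prob m s) _ _ gamma _ _ id
  (fun g => m + s * g) f.
- exact: measurable_id.
- exact: measurable_affine.
- by move=> A mA; exact: (normal_probE m s0 mA).
- exact: mf.
- exact: (bm_integrable _ (bm_comp (measurable_affine m s) bf)).
Qed.

Variables c s : R.
Hypothesis c0 : 0 < c.
Hypothesis cs1 : c ^+ 2 + s ^+ 2 = 1.

Let d := Num.sqrt (1 + s ^+ 2).
Let d0 : 0 < d. Proof. by rewrite sqrtr_gt0 ltr_pwDl// sqr_ge0. Qed.
Let d2 : d ^+ 2 = 1 + s ^+ 2.
Proof. by rewrite sqr_sqrtr// addr_ge0 ?sqr_ge0. Qed.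

(** [K g] is the integral of r^2 / p, where r is the density of c h + s g given g: by [sq_ratio],
    r^2 / p is [K g] times a Gaussian density. By [K_ratio] its mean over g is 1 / c^2. *)
Let K g := (c * d)^-1 * expR (s ^+ 2 * g ^+ 2 / (1 + s ^+ 2)).

Let peakE (v : R) : 0 < v -> normal_peak v = v^-1 * normal_peak 1.
Proof.
move=> v0; rewrite /normal_peak expr1n mul1r -mulrnAr sqrtrM ?sqr_ge0//.
by rewrite sqrtr_sqr gtr0_norm// invfM.
Qed.

Let pdfE (m v x : R) : 0 < v ->
  normal_pdf m v x = v^-1 * normal_peak 1 * expR (- (x - m) ^+ 2 / (2 * v ^+ 2)).
Proof.
move=> v0; rewrite normal_pdfE ?gt_eqF// peakE//; congr (_ * expR (_ / _)).
by rewrite -mulr_natl.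
Qed.

Let pk0 : 0 < @normal_peak R 1. Proof. by rewrite normal_peak_gt0// oner_eq0. Qed.

Let p_gt0 x : 0 < p x.
Proof. by rewrite std_normal_pdfE mulr_gt0// expR_gt0. Qed.

Let sq_ratio g x : normal_pdf (s * g) c x ^+ 2 =
  K g * normal_pdf (2 * s * g / (1 + s ^+ 2)) (c / d) x * p x.
Proof.
have cd0 : 0 < c / d by rewrite divr_gt0.
rewrite (pdfE _ _ c0) (pdfE _ _ cd0) std_normal_pdfE /K exprMn -expRM_natl.
set k := normal_peak 1.
have c2 : c ^+ 2 = 1 - s ^+ 2 by rewrite -cs1; ring.
have c20 : 1 - s ^+ 2 != 0 by rewrite -c2 expf_eq0/= gt_eqF.
have s1 : 1 + s ^+ 2 != 0 by rewrite -d2 expf_eq0/= gt_eqF.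
have -> : 2 * (- (x - s * g) ^+ 2 / (2 * c ^+ 2)) = s ^+ 2 * g ^+ 2 / (1 + s ^+ 2) +
    (- (x - 2 * s * g / (1 + s ^+ 2)) ^+ 2 / (2 * (c / d) ^+ 2) + - x ^+ 2 / 2).
  rewrite expr_div_n d2 c2; field.
  by rewrite c20 s1.
rewrite !expRD.
set e1 := expR _; set e2 := expR _; set e3 := expR _.
have [cn0 dn0] : c != 0 /\ d != 0 by rewrite !gt_eqF.
field; by rewrite cn0 dn0.
Qed.

Let K_ratio g : K g * p g = c ^- 2 * normal_pdf 0 (d / c) g.
Proof.
have dc0 : 0 < d / c by rewrite divr_gt0.
rewrite (pdfE _ _ dc0) std_normal_pdfE /K; set k := normal_peak 1.
have c2 : c ^+ 2 = 1 - s ^+ 2 by rewrite -cs1; ring.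
have c20 : 1 - s ^+ 2 != 0 by rewrite -c2 expf_eq0/= gt_eqF.
have s1 : 1 + s ^+ 2 != 0 by rewrite -d2 expf_eq0/= gt_eqF.
have -> : - (g - 0) ^+ 2 / (2 * (d / c) ^+ 2) =
    s ^+ 2 * g ^+ 2 / (1 + s ^+ 2) + - g ^+ 2 / 2.
  by rewrite expr_div_n d2 c2; field; rewrite c20 s1.
rewrite expRD; set e1 := expR _; set e2 := expR _.
have [cn0 dn0] : c != 0 /\ d != 0 by rewrite !gt_eqF.
by field; rewrite cn0 dn0.
Qed.

Let int_pdf m v : \int[mu]_x normal_pdf m v x = 1.
Proof. by rewrite /Rintegral integral_normal_pdf. Qed.

Let int_pdf3 (a1 m1 v1 a2 m2 v2 a3 m3 v3 : R) :
  mu.-integrable setT (EFin \o (fun x => a1 * normal_pdf m1 v1 x +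
    a2 * normal_pdf m2 v2 x + a3 * normal_pdf m3 v3 x)) /\
  \int[mu]_x (a1 * normal_pdf m1 v1 x +
    a2 * normal_pdf m2 v2 x + a3 * normal_pdf m3 v3 x) = a1 + a2 + a3.
Proof.
have i1 (a0 m v : R) : mu.-integrable setT (EFin \o (fun x => a0 * normal_pdf m v x)).
  rewrite (_ : _ \o _ = (fun x => a0%:E * (normal_pdf m v x)%:E)%E)//.
  exact: (integrableZl measurableT a0 (integrable_normal_pdf m v)).
have i12 := integrableD measurableT (i1 a1 m1 v1) (i1 a2 m2 v2).
have iZ (a0 m v : R) : \int[mu]_x (a0 * normal_pdf m v x) = a0.
  by rewrite RintegralZl ?int_pdf ?mulr1//; exact: integrable_normal_pdf.
split; first exact: (integrableD measurableT i12 (i1 a3 m3 v3)).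
rewrite (RintegralD measurableT i12 (i1 a3 m3 v3)).
by rewrite (RintegralD measurableT (i1 a1 m1 v1) (i1 a2 m2 v2)) !iZ.
Qed.

Variables (a : measurableTypeR R -> R) (B : R).
Hypothesis ba : bounded_measurable a.
Hypothesis aB : forall x, `|a x| <= B.
Hypothesis a0 : \int[gamma]_x a x = 0.

Let eqW (x y : R) : x = y -> x <= y. Proof. by move=> ->. Qed.

(** Weighted arithmetic-geometric inequality for (u - v) / sqrt v and y sqrt v. The bound is linear
    in w, u and v, so that after substitution only Gaussian densities remain to be integrated. *)
Let amgm (l u v w y : R) : 0 < l -> 0 < v -> u ^+ 2 = w * v ->
  `|(u - v) * y| <= (l * (w - 2 * u + v) + y ^+ 2 / l * v) / 2.
Proof.
move=> l0 v0 uw.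
have E : l * (w - 2 * u + v) + y ^+ 2 / l * v =
    ((l * (u - v)) ^+ 2 + (y * v) ^+ 2) / (l * v).
  have -> : w = u ^+ 2 / v by rewrite uw mulfK// gt_eqF.
  by field; rewrite !gt_eqF.
rewrite E ler_pdivlMr// ler_pdivlMr ?mulr_gt0//.
rewrite (_ : `|_| * 2 * (l * v) = 2 * `|l * (u - v)| * `|y * v|); last first.
  by rewrite !normrM (gtr0_norm l0) (gtr0_norm v0); ring.
rewrite -(real_normK (num_real (l * (u - v)))) -(real_normK (num_real (y * v))).
have := sqr_ge0 (`|l * (u - v)| - `|y * v|); nra.
Qed.

(** As [a] has mean 0 under p, the density r may be replaced by r - p. Then [amgm] is integrated
    with u = r, v = p and w p = r^2, the integral of w - 2 r + p being [K g - 1]. *)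
Let T_bound (l y g : R) : 0 < l ->
  `|y * \int[gamma]_h a (c * h + s * g)| <= B / 2 * (l * (K g - 1) + y ^+ 2 / l).
Proof.
move=> l0; have [ma _] := ba.
have B0 : 0 <= B by rewrite (le_trans _ (aB 0)).
pose r x := normal_pdf (s * g) c x.
pose q x := normal_pdf (2 * s * g / (1 + s ^+ 2)) (c / d) x.
have Ta : \int[gamma]_h a (c * h + s * g) = \int[mu]_x (a x * r x).
  rewrite -Rintegral_affine_gamma//; apply: eq_Rintegral => h _.
  by rewrite addrC.
have a0' : \int[mu]_x (a x * p x) = 0 by rewrite -(Rintegral_normal_prob 0 1 ma).
have iap (m v : R) : mu.-integrable setT (EFin \o (fun x => a x * normal_pdf m v x)).
  apply: (@le_integrable _ _ _ mu setT measurableT _ (fun x => (B * normal_pdf m v x)%:E)).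
  - by apply/measurable_EFinP/measurable_funM => //; exact: measurable_normal_pdf.
  - move=> x _ /=; rewrite lee_fin !normrM (ger0_norm B0) ler_wpM2r//.
  - rewrite (_ : (fun x => _) = (fun x => B%:E * (normal_pdf m v x)%:E)%E)//.
    exact: (integrableZl measurableT B (integrable_normal_pdf m v)).
have E : y * \int[gamma]_h a (c * h + s * g) = \int[mu]_x (y * (a x * r x - a x * p x)).
  rewrite RintegralZl//; last exact: (integrableB measurableT (iap _ _) (iap _ _)).
  by rewrite RintegralB// ?Ta ?a0' ?subr0//; exact: iap.
have iE : mu.-integrable setT (EFin \o (fun x => y * (a x * r x - a x * p x))).
  rewrite (_ : _ \o _ = (fun x => y%:E * (a x * r x - a x * p x)%:E)%E)//.
  exact: (integrableZl measurableT y (integrableB measurableT (iap _ _) (iap _ _))).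
have [iH H] := int_pdf3 (B / 2 * l * K g) (2 * s * g / (1 + s ^+ 2)) (c / d)
  (- (B * l)) (s * g) c (B / 2 * (l + y ^+ 2 / l)) 0 1.
rewrite E (le_trans (le_normr_Rintegral measurableT iE))//.
apply: (@le_trans _ _ (\int[mu]_x (B / 2 * l * K g * q x + - (B * l) * r x +
     B / 2 * (l + y ^+ 2 / l) * p x))); last by rewrite H; apply: eqW; field; rewrite gt_eqF.
apply: le_Rintegral => //; first exact: (integrable_norm iE).
move=> x _.
rewrite (_ : y * _ = a x * ((r x - p x) * y)); last by ring.
rewrite normrM (le_trans (ler_wpM2r _ (aB x)))//.
rewrite (_ : _ + _ + _ =
  B * ((l * (K g * q x - 2 * r x + p x) + y ^+ 2 / l * p x) / 2)); last first.
  by field; rewrite gt_eqF.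
by rewrite ler_wpM2l// amgm// sq_ratio.
Qed.

Let mK : measurable_fun setT (K : measurableTypeR R -> R).
Proof.
apply: measurable_funM => //; apply: measurableT_comp => //.
by apply: measurable_funM => //; apply: measurable_funM => //; exact: measurable_funX.
Qed.

Let K_ge0 g : 0 <= K g.
Proof. by rewrite mulr_ge0 ?expR_ge0// invr_ge0 mulr_ge0// ltW. Qed.

Let intK : gamma.-integrable setT (EFin \o K) /\ \int[gamma]_g K g = c ^- 2.
Proof.
have E : (\int[gamma]_g (K g)%:E = (c ^- 2)%:E)%E.
  rewrite integral_normal_prob//; under eq_integral do rewrite K_ratio EFinM.
  by rewrite integralZl ?integral_normal_pdf ?mule1//; exact: integrable_normal_pdf.
split; last by rewrite /Rintegral E.
apply/integrableP; split; first exact/measurable_EFinP.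
by under eq_integral do rewrite /= ger0_norm//; rewrite E ltry.
Qed.

(* Cauchy-Schwarz against the Mehler kernel: the conditional density of c h + s g
   given g, relative to gamma, has second moment 1 / c^2, and 1 / c^2 - 1 = s^2 / c^2. *)
Lemma gaussian_correlation (v : measurableTypeR R -> R) : bounded_measurable v ->
  (\int[gamma]_g (v g * \int[gamma]_h a (c * h + s * g))) ^+ 2 <=
  B ^+ 2 * (s ^+ 2 / c ^+ 2) * \int[gamma]_g (v g ^+ 2).
Proof.
move=> bv.
have B0 : 0 <= B by rewrite (le_trans _ (aB 0)).
set D := \int[gamma]_g _; set V := \int[gamma]_g _.
have V0 : 0 <= V by apply: Rintegral_ge0 => x _; exact: sqr_ge0.
have bT : bounded_measurable (fun g : measurableTypeR R => \int[gamma]_h a (c * h + s * g)).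
  have mm : measurable_fun setT (fun z : measurableTypeR R * measurableTypeR R =>
      c * z.2 + s * z.1 : measurableTypeR R).
    by apply: measurable_funD; apply: measurable_funM.
  exact: (bm_partial1 gamma gamma (bm_comp mm ba)).
have bvT := bmM bv bT.
have H l : 0 < l -> `|D| <= B / 2 * (l * (s ^+ 2 / c ^+ 2) + V / l).
  move=> l0; have [iK intKE] := intK.
  rewrite (le_trans (le_normr_Rintegral measurableT (bm_integrable _ bvT)))//.
  pose W g := (B / 2 * l) * K g + (B / 2 * (- l) + B / 2 / l * v g ^+ 2).
  have i1 : gamma.-integrable setT (EFin \o (fun g => (B / 2 * l) * K g)).
    rewrite (_ : _ \o _ = (fun x => (B / 2 * l)%:E * (K x)%:E)%E)//.
    exact: (integrableZl measurableT _ iK).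
  have b2 : bounded_measurable (fun g => B / 2 * (- l) + B / 2 / l * v g ^+ 2).
    by apply: bmD; [exact: bm_cst|apply: bmZ; exact: bmX].
  apply: (@le_trans _ _ (\int[gamma]_g W g)).
    apply: le_Rintegral => //.
    - exact: (integrable_norm (bm_integrable _ bvT)).
    - exact: (integrableD measurableT i1 (bm_integrable gamma b2)).
    - move=> g _; apply: (le_trans (T_bound (v g) g l0)).
      by rewrite /W; apply: eqW; field; rewrite gt_eqF.
  rewrite /W (RintegralD measurableT i1 (bm_integrable gamma b2)).
  rewrite RintegralZl// intKE bm_intD; [|exact: bm_cst|by apply: bmZ; exact: bmX].
  rewrite bm_int_cst bm_intZ; last exact: bmX.
  have -> : s ^+ 2 = 1 - c ^+ 2 by rewrite -cs1; ring.
  by apply: eqW; rewrite /V; field; rewrite !gt_eqF.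
rewrite -(real_normK (num_real D)).
set e := s ^+ 2 / c ^+ 2 in H *.
have e0 : 0 <= e by rewrite divr_ge0 ?sqr_ge0.
have D0 := normr_ge0 D; set u := `|D| in H D0 *.
have [->|un0] := eqVneq u 0.
  by rewrite expr0n/=; apply: mulr_ge0 => //; apply: mulr_ge0 => //; exact: sqr_ge0.
have u0 : 0 < u by rewrite lt_neqAle eq_sym un0.
have {}H l : 0 < l -> 2 * u * l <= B * (l ^+ 2 * e + V).
  move=> l0; have := ler_wpM2r (ltW l0) (H l l0).
  rewrite (_ : B / 2 * _ * l = B * (l ^+ 2 * e + V) / 2); last by field; rewrite gt_eqF.
  by rewrite ler_pdivlMr//; nra.
(* The optimal l is u / (B e). If B e = 0, the value l = (B V + 1) / u would give 2 (B V + 1) <= B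
   V, a contradiction. *)
have [Be|Be] := ltP 0 (B * e).
  have /andP[Bn0 en0] : (B != 0) && (e != 0) by rewrite -negb_or -mulf_eq0 gt_eqF.
  have := H (u / (B * e)) (divr_gt0 u0 Be).
  rewrite (_ : B * (_ + _) = u ^+ 2 / (B * e) + B * V); last first.
    by field; rewrite ?Bn0 ?en0.
  rewrite (_ : 2 * u * _ = 2 * (u ^+ 2 / (B * e))); last first.
    by field; rewrite ?Bn0 ?en0.
  rewrite mulr_natl mulr2n lerD2l ler_pdivrMr// => h.
  by rewrite (le_trans h)//; apply: eqW; ring.
have {}Be : B * e = 0 by apply/eqP; rewrite eq_le Be mulr_ge0.
have := H ((B * V + 1) / u) (divr_gt0 (ltr_wpDl (mulr_ge0 B0 V0) ltr01) u0).
rewrite [leRHS]mulrDr [B * (_ * e)]mulrCA Be mulr0 add0r (_ : 2 * u * _ = 2 * (B * V + 1)); last first.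
  by field.
have := mulr_ge0 B0 V0; lra.
Qed.

End gaussian_correlation.

Lemma gamma_rotation (R : realType) (c s : R) (f : measurableTypeR R -> R) :
  c ^+ 2 + s ^+ 2 = 1 -> bounded_measurable f ->
  \int[normal_prob 0 1]_g (\int[normal_prob 0 1]_h f (c * h + s * g)) =
  \int[normal_prob 0 1]_g f g.
Proof.
move=> cs1 bf; set gamma := normal_prob 0 1.
have mm : measurable_fun setT (fun z : measurableTypeR R * measurableTypeR R =>
    c * z.2 + s * z.1 : measurableTypeR R).
  by apply: measurable_funD; apply: measurable_funM.
have H := @cos_int_unique R _ _ (gamma \x gamma)%E _ _ gamma _ id (fun=> 1) (fun=> 1) f
  mm (@measurable_id _ _ _) (bm_cst _ 1) (bm_cst _ 1) _ bf.
transitivity (\int[(gamma \x gamma)%E]_z (f (c * z.2 + s * z.1) * 1)).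
  rewrite bm_fubini1; last by apply: bmM; [exact: bm_comp mm bf|exact: bm_cst].
  by apply: eq_Rintegral => g _; apply: eq_Rintegral => h _; rewrite mulr1.
rewrite {}H; first by under eq_Rintegral do rewrite mulr1.
move=> t p; rewrite bm_fubini1; last first.
  by apply: bmM; [exact: bm_comp mm (bm_cos t p)|exact: bm_cst].
under [in RHS]eq_Rintegral do rewrite mulr1.
transitivity (\int[gamma]_g (expR (- (t * c) ^+ 2 / 2) * cos (t * s * g + p))).
  apply: eq_Rintegral => g _; rewrite -gamma_cos; apply: eq_Rintegral => h _ /=.
  by rewrite mulr1; congr cos; ring.
rewrite bm_intZ; last exact: bm_cos.
rewrite !gamma_cos mulrA -expRD; congr (expR _ * _).
have -> : - t ^+ 2 = - (t ^+ 2 * (c ^+ 2 + s ^+ 2)) by rewrite cs1 mulr1.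
by field.
Qed.

Section filter_step.
Variable R : realType.
Local Notation gamma := (@normal_prob R 0 1).
Variables (c s : R).
Hypothesis c0 : 0 < c.
Hypothesis cs1 : c ^+ 2 + s ^+ 2 = 1.
Variables (L : finType) (m : L -> R) (a : L -> measurableTypeR R -> R) (B : R).
Hypothesis m0 : forall l, 0 <= m l.
Hypothesis m1 : \sum_l m l = 1.
Hypothesis ba : forall l, bounded_measurable (a l).
Hypothesis aB : forall l x, `|a l x| <= B.
Hypothesis inta : forall l, \int[gamma]_x a l x = 0.
Hypothesis ma : forall x, \sum_l m l * a l x = 0.
Variable u : measurableTypeR R -> R.
Hypothesis bu : bounded_measurable u.

Let r l g' := \int[gamma]_g (a l (c * g' + s * g) * u g).

Let mm : measurable_fun setT (fun z : measurableTypeR R * measurableTypeR R =>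
    c * z.1 + s * z.2 : measurableTypeR R).
Proof. by apply: measurable_funD; apply: measurable_funM. Qed.

Let bau l : bounded_measurable (fun z : measurableTypeR R * measurableTypeR R =>
    a l (c * z.1 + s * z.2) * u z.2).
Proof.
apply: bmM; first exact: bm_comp mm (ba l).
exact: bm_comp (@measurable_snd _ _ _ _) bu.
Qed.

Let br l : bounded_measurable (r l : measurableTypeR R -> R).
Proof. exact: (bm_partial1 gamma gamma (bau l)). Qed.

Let bal l (g' : R) : bounded_measurable (fun g : measurableTypeR R => a l (c * g' + s * g)).
Proof. by apply: bm_comp (ba l); exact: measurable_affine. Qed.

(** Here [u] is the likelihood ratio of the past given the previous noise g, and 1 + a l is the
    likelihood of the new letter l relative to its mean m l. The result is the new likelihood ratio
    given the new noise g'. *)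
Definition filter_step l : measurableTypeR R -> R :=
  fun g' => \int[gamma]_g ((1 + a l (c * g' + s * g)) * u g).

Let ub := \int[gamma]_g u g.

Let stepE l g' : filter_step l g' = ub + r l g'.
Proof.
rewrite /filter_step /ub /r -bm_intD//; last exact: bmM (bal l g') bu.
by apply: eq_Rintegral => g _; rewrite mulrDl mul1r.
Qed.

Lemma bm_filter_step l : bounded_measurable (filter_step l).
Proof.
rewrite (_ : filter_step l = fun g' => ub + r l g'); last exact/funext/stepE.
by apply: bmD => //; exact: bm_cst.
Qed.

Let r_sum g' : \sum_l m l * r l g' = 0.
Proof.
transitivity (\int[gamma]_g \sum_l m l * (a l (c * g' + s * g) * u g)).
  rewrite bm_int_sum; last by move=> l; apply: bmZ; apply: bmM.
  by apply: eq_bigr => l _; rewrite bm_intZ//; apply: bmM.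
rewrite -[RHS](bm_int_cst gamma 0); apply: eq_Rintegral => g _.
under eq_bigr do rewrite mulrA.
by rewrite -mulr_suml ma mul0r.
Qed.

Let B0 (l : L) : 0 <= B. Proof. by rewrite (le_trans _ (aB l 0)). Qed.

Let V0 : 0 <= \int[gamma]_g (u g ^+ 2).
Proof. by apply: Rintegral_ge0 => x _; exact: sqr_ge0. Qed.

Let jensen (v : measurableTypeR R -> R) : bounded_measurable v ->
  (\int[gamma]_g v g) ^+ 2 <= \int[gamma]_g (v g ^+ 2).
Proof.
move=> bv; set e := \int[gamma]_g v g.
have : 0 <= \int[gamma]_g ((v g - e) ^+ 2).
  by apply: Rintegral_ge0 => x _; exact: sqr_ge0.
rewrite (_ : (fun g => (v g - e) ^+ 2) = fun g => v g ^+ 2 + (- (2 * e) * v g + e ^+ 2)).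
  rewrite bm_intD ?bm_intD ?bm_intZ ?bm_int_cst//; try exact: bmX; try exact: bm_cst;
    try exact: bmZ; last by apply: bmD; [exact: bmZ|exact: bm_cst].
  rewrite -/e; nra.
by apply/funext => g; ring.
Qed.

Let r_bound l g' : r l g' ^+ 2 <= B ^+ 2 * \int[gamma]_g (u g ^+ 2).
Proof.
apply: (le_trans (jensen (bmM (bal l g') bu))).
rewrite -bm_intZ; last exact: bmX.
apply: bm_int_le; [exact: bmX (bmM (bal l g') bu)|by apply: bmZ; exact: bmX|].
move=> g; rewrite exprMn ler_wpM2r ?sqr_ge0//.
rewrite -(real_normK (num_real (a _ _))) ler_sqr ?nnegrE//.
exact: B0.
Qed.

(** Expand (ub + r l)^2: the cross term vanishes because the m-average of r is 0, and |a l| <= B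
    bounds the square of r. *)
Lemma filter_step_sqr :
  \sum_l m l * \int[gamma]_g (filter_step l g ^+ 2) <=
  ub ^+ 2 + B ^+ 2 * \int[gamma]_g (u g ^+ 2).
Proof.
have E l : \int[gamma]_g (filter_step l g ^+ 2) =
    ub ^+ 2 + 2 * ub * \int[gamma]_g r l g + \int[gamma]_g (r l g ^+ 2).
  transitivity (\int[gamma]_g ((ub ^+ 2 + 2 * ub * r l g) + r l g ^+ 2)).
    by apply: eq_Rintegral => g _; rewrite stepE; ring.
  rewrite bm_intD ?bm_intD ?bm_intZ ?bm_int_cst//; try exact: bm_cst;
    try exact: bmZ; try exact: bmX.
  by apply: bmD; [exact: bm_cst|exact: bmZ].
under eq_bigr do rewrite E !mulrDr.
rewrite !big_split /= -!mulr_suml m1 mul1r.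
have -> : \sum_l m l * (2 * ub * \int[gamma]_g r l g) = 0.
  transitivity (2 * ub * \int[gamma]_g \sum_l m l * r l g).
    rewrite bm_int_sum; last by move=> l; exact: bmZ.
    rewrite mulr_sumr; apply: eq_bigr => l _; rewrite bm_intZ//; ring.
  under eq_Rintegral do rewrite r_sum.
  by rewrite bm_int_cst mulr0.
rewrite addr0 lerD2l.
apply: (@le_trans _ _ (\sum_l m l * (B ^+ 2 * \int[gamma]_g (u g ^+ 2)))).
  apply: ler_sum => l _; rewrite ler_wpM2l//.
  rewrite -[leRHS](bm_int_cst gamma); apply: bm_int_le; [exact: bmX|exact: bm_cst|].
  by move=> g; exact: r_bound.
by rewrite -mulr_suml m1 mul1r.
Qed.

Let dl l := \int[gamma]_g r l g.

(** Integrating over the new noise first leaves the past tested against the conditional mean of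
    [a l] given the old noise. That conditional mean is itself centred, so u may be replaced by u -
    ub; this puts the variance of u, and not its second moment, into the correlation inequality. *)
Let dl_bound l : dl l ^+ 2 <=
  B ^+ 2 * (s ^+ 2 / c ^+ 2) * (\int[gamma]_g (u g ^+ 2) - ub ^+ 2).
Proof.
pose v (g : measurableTypeR R) := u g - ub.
have bv : bounded_measurable v by apply: bmB => //; exact: bm_cst.
have bT : bounded_measurable (fun g : measurableTypeR R => \int[gamma]_h a l (c * h + s * g)).
  have mm' : measurable_fun setT (fun z : measurableTypeR R * measurableTypeR R =>
      c * z.2 + s * z.1 : measurableTypeR R).
    by apply: measurable_funD; apply: measurable_funM.
  exact: (bm_partial1 gamma gamma (bm_comp mm' (ba l))).
have -> : \int[gamma]_g (u g ^+ 2) - ub ^+ 2 = \int[gamma]_g (v g ^+ 2).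
  transitivity (\int[gamma]_g (u g ^+ 2 + (- (2 * ub) * u g + ub ^+ 2))); last first.
    by apply: eq_Rintegral => g _; rewrite /v; ring.
  rewrite bm_intD ?bm_intD ?bm_intZ ?bm_int_cst//; try exact: bmX; try exact: bm_cst;
    try exact: bmZ; last by apply: bmD; [exact: bmZ|exact: bm_cst].
  rewrite -/ub; ring.
have -> : dl l = \int[gamma]_g (v g * \int[gamma]_h a l (c * h + s * g)).
  transitivity (\int[gamma]_g (u g * \int[gamma]_h a l (c * h + s * g))).
    rewrite /dl /r (bm_fubini gamma gamma (bau l)).
    apply: eq_Rintegral => g _ /=; rewrite -bm_intZ.
      by apply: eq_Rintegral => h _; rewrite mulrC.
    by apply: bm_comp (ba l); have := measurable_affine (s * g) c;
      under eq_fun do rewrite addrC.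
  transitivity (\int[gamma]_g (u g * \int[gamma]_h a l (c * h + s * g) -
      ub * \int[gamma]_h a l (c * h + s * g))); last first.
    by apply: eq_Rintegral => g _; rewrite /v mulrBl.
  rewrite bm_intB; [|exact: bmM|exact: bmZ].
  by rewrite bm_intZ// (gamma_rotation cs1 (ba l)) inta mulr0 subr0.
exact: gaussian_correlation.
Qed.

(** The terms of first order in dl cancel on averaging over letters, which leaves the squares
    bounded by [dl_bound]. The lower bound makes the chi-square sequence nondecreasing. *)
Lemma filter_step_mean : ub ^+ 2 <=
  \sum_l m l * (\int[gamma]_g filter_step l g) ^+ 2 <=
  ub ^+ 2 + B ^+ 2 * (s ^+ 2 / c ^+ 2) * (\int[gamma]_g (u g ^+ 2) - ub ^+ 2).
Proof.
have E l : \int[gamma]_g filter_step l g = ub + dl l.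
  transitivity (\int[gamma]_g (ub + r l g)).
    by apply: eq_Rintegral => g _; rewrite stepE.
  by rewrite bm_intD ?bm_int_cst//; exact: bm_cst.
have sd : \sum_l m l * dl l = 0.
  transitivity (\int[gamma]_g \sum_l m l * r l g).
    rewrite bm_int_sum; last by move=> l; exact: bmZ.
    by apply: eq_bigr => l _; rewrite bm_intZ.
  by under eq_Rintegral do rewrite r_sum; rewrite bm_int_cst.
have -> : \sum_l m l * (\int[gamma]_g filter_step l g) ^+ 2 =
    ub ^+ 2 + \sum_l m l * dl l ^+ 2.
  transitivity (\sum_l (m l * ub ^+ 2 + (2 * ub * (m l * dl l) + m l * dl l ^+ 2))).
    by apply: eq_bigr => l _; rewrite E; ring.
  by rewrite !big_split /= -mulr_suml m1 mul1r -mulr_sumr sd mulr0 add0r.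
rewrite lerDl lerD2l sumr_ge0 ?andTb//; last first.
  by move=> l _; rewrite mulr_ge0// sqr_ge0.
apply: (@le_trans _ _ (\sum_l m l *
  (B ^+ 2 * (s ^+ 2 / c ^+ 2) * (\int[gamma]_g (u g ^+ 2) - ub ^+ 2)))).
  by apply: ler_sum => l _; rewrite ler_wpM2l.
by rewrite -mulr_suml m1 mul1r.
Qed.

Lemma filter_step_total : \sum_l m l * \int[gamma]_g filter_step l g = ub.
Proof.
transitivity (\int[gamma]_g \sum_l m l * filter_step l g).
  rewrite bm_int_sum; last by move=> l; apply: bmZ; exact: bm_filter_step.
  by apply: eq_bigr => l _; rewrite bm_intZ//; exact: bm_filter_step.
rewrite -[RHS](bm_int_cst gamma); apply: eq_Rintegral => g _.
under eq_bigr do rewrite stepE mulrDr.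
by rewrite big_split /= -mulr_suml m1 mul1r r_sum addr0.
Qed.

End filter_step.

Section word_sums.
Variables (R : realType) (L : finType).
Implicit Types F G : seq L -> R.

(** The head letter is summed first, so that one filter step can be estimated under the sum over the
    older letters. The passage to tuples is made once, in [word_sum_tuple]. *)
Fixpoint word_sum (n : nat) (F : seq L -> R) : R :=
  match n with
  | 0 => F [::]
  | n'.+1 => word_sum n' (fun w => \sum_l F (l :: w))
  end.

Lemma eq_word_sum n F G : (forall w, F w = G w) -> word_sum n F = word_sum n G.
Proof. by move=> FG; congr word_sum; apply/funext. Qed.

Lemma word_sumD n F G : word_sum n (fun w => F w + G w) = word_sum n F + word_sum n G.
Proof.
elim: n F G => [|n IH] F G //=; rewrite -IH; apply: eq_word_sum => w.
by rewrite big_split.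
Qed.

Lemma word_sumZ n (x : R) F : word_sum n (fun w => x * F w) = x * word_sum n F.
Proof.
elim: n F => [|n IH] F //=; rewrite -IH; apply: eq_word_sum => w.
by rewrite mulr_sumr.
Qed.

Lemma le_word_sum n F G : (forall w, F w <= G w) -> word_sum n F <= word_sum n G.
Proof.
by elim: n F G => [|n IH] F G FG //=; apply: IH => w; apply: ler_sum.
Qed.

Lemma word_sum_tuple n F : \sum_(w : n.-tuple L) F w = word_sum n F.
Proof.
elim: n F => [|n IH] F /=.
  rewrite (eq_bigr (fun=> F [::])); last by move=> w _; rewrite tuple0.
  by rewrite sumr_const card_tuple expn0.
rewrite -IH exchange_big /= pair_bigA /=.
pose h (p : L * n.-tuple L) : n.+1.-tuple L := cons_tuple p.1 p.2.
rewrite (reindex h) //=.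
exists (fun t => (thead t, behead_tuple t)) => [[l w] _|t _].
  by congr pair; rewrite /h ?theadE//; exact: val_inj.
by rewrite [RHS]tuple_eta; apply: val_inj.
Qed.

End word_sums.

(** * The chi-square recursion along words of finitely labelled outputs *)

Section private_filter.
Variable R : realType.
Local Notation gamma := (@normal_prob R 0 1).
Variables (sg c s : R).
Hypothesis c0 : 0 < c.
Hypothesis cs1 : c ^+ 2 + s ^+ 2 = 1.
Variables (L : finType) (k : nat -> L -> measurableTypeR R -> R) (alpha : R).
Hypothesis bk : forall i l, bounded_measurable (k i l).
Hypothesis k_ge0 : forall i l x, 0 <= k i l x.
Hypothesis k_sum : forall i x, \sum_l k i l x = 1.
Hypothesis k_ldp : forall i l x y, k i l x <= expR alpha * k i l y.
Hypothesis alpha0 : 0 <= alpha.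

Let kap i l (x : measurableTypeR R) := k i l (sg * x).

Let bkap i l : bounded_measurable (kap i l).
Proof. by apply: bm_comp (bk i l); exact: measurable_funM. Qed.

Definition letter_mean i l := \int[gamma]_x k i l (sg * x).
Local Notation m := letter_mean.

Let m_ge0 i l : 0 <= m i l.
Proof. by apply: Rintegral_ge0 => x _; exact: k_ge0. Qed.

Let m_sum i : \sum_l m i l = 1.
Proof.
rewrite -(bm_int_sum gamma _ (bkap i)) -[RHS](bm_int_cst gamma).
by apply: eq_Rintegral => x _; exact: k_sum.
Qed.

Let kap_le i l x : kap i l x <= expR alpha * m i l.
Proof.
rewrite -[leLHS](bm_int_cst gamma) /m -(bm_intZ gamma _ (bkap i l)).
by apply: bm_int_le; [exact: bm_cst|exact: bmZ|move=> y; exact: k_ldp].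
Qed.

Let m_le i l x : m i l <= expR alpha * kap i l x.
Proof.
rewrite -[leRHS](bm_int_cst gamma) /m.
by apply: bm_int_le; [exact: bkap|exact: bm_cst|move=> y; exact: k_ldp].
Qed.

(** If a letter has mean 0, privacy forces its likelihood to vanish everywhere, so the value 0 is
    consistent with [kapE]. *)
Let a i l x : R := if m i l == 0 then 0 else kap i l x / m i l - 1.

Let kapE i l x : kap i l x = m i l * (1 + a i l x).
Proof.
rewrite /a; case: eqVneq => [m0|m0]; last by field.
apply/eqP; rewrite m0 mul0r eq_le k_ge0 andbT.
by have := kap_le i l x; rewrite m0 mulr0.
Qed.

Let B := expR alpha - 1.

Let B_ge0 : 0 <= B. Proof. by rewrite subr_ge0 -expR0 ler_expR. Qed.

Let ba i l : bounded_measurable (a i l).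
Proof.
rewrite /a; case: eqP => _; first exact: bm_cst.
rewrite (_ : (fun x => _) = fun x => (m i l)^-1 * kap i l x - 1).
  by apply: bmB; [exact: bmZ|exact: bm_cst].
by apply/funext => x; rewrite mulrC.
Qed.

(** By privacy the ratio of likelihood to mean lies between exp (-alpha) and exp alpha, and 1 - exp
    (-alpha) <= exp alpha - 1. *)
Let aB i l x : `|a i l x| <= B.
Proof.
rewrite /a; case: eqVneq => [_|m0]; first by rewrite normr0.
have mp : 0 < m i l by rewrite lt_neqAle eq_sym m0 m_ge0.
have h1 : kap i l x / m i l <= expR alpha by rewrite ler_pdivrMr.
have h2 : 1 <= expR alpha * (kap i l x / m i l) by rewrite mulrA ler_pdivlMr// mul1r.
have e1 : 1 <= expR alpha by rewrite -expR0 ler_expR.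
by rewrite ler_norml; apply/andP; split; rewrite /B; nra.
Qed.

Let int_a i l : \int[gamma]_x a i l x = 0.
Proof.
rewrite /a; case: eqVneq => [_|m0]; first by rewrite bm_int_cst.
rewrite bm_intB; last 2 first.
- by rewrite (_ : (fun x => _) = fun x => (m i l)^-1 * kap i l x);
    [exact: bmZ|apply/funext => x; rewrite mulrC].
- exact: bm_cst.
rewrite bm_int_cst (_ : \int[gamma]_x _ = \int[gamma]_x ((m i l)^-1 * kap i l x)); last first.
  by apply: eq_Rintegral => x _; rewrite mulrC.
by rewrite bm_intZ// -/(m i l) mulVf// subrr.
Qed.

Let sum_a i x : \sum_l m i l * a i l x = 0.
Proof.
have := k_sum i (sg * x).
rewrite (eq_bigr (fun l => m i l + m i l * a i l x)); last first.
  by move=> l _; rewrite -/(kap i l x) kapE mulrDr mulr1.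
by rewrite big_split /= m_sum => /eqP; rewrite -subr_eq0 addrAC subrr add0r => /eqP.
Qed.

(* A word lists the letters observed so far, the most recent one first. *)
Fixpoint word_filter (w : seq L) : measurableTypeR R -> R :=
  match w with
  | [::] => fun=> 1
  | l :: w' => fun g' =>
      \int[gamma]_g (k (size w') l (sg * (c * g' + s * g)) * word_filter w' g)
  end.

(** The probability of the word when the observations are white noise, as [word_filter_indep]
    shows. *)
Fixpoint word_mean (w : seq L) : R :=
  match w with
  | [::] => 1
  | l :: w' => m (size w') l * word_mean w'
  end.

(** The likelihood ratio [word_filter] / [word_mean], defined by recursion so that it makes sense
    for words of probability 0. *)
Let U := fix U (w : seq L) : measurableTypeR R -> R :=
  match w with
  | [::] => fun=> 1
  | l :: w' => filter_step c s (a (size w')) (U w') l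
  end.

Let bU w : bounded_measurable (U w).
Proof.
by elim: w => [|l w IH] /=; [exact: bm_cst|exact: bm_filter_step].
Qed.

Let word_filterE w g : word_filter w g = word_mean w * U w g.
Proof.
elim: w g => [|l w IH] g /=; first by rewrite mulr1.
rewrite /filter_step -bm_intZ; last first.
  apply: bmM => //; apply: bmD; first exact: bm_cst.
  by apply: bm_comp (ba _ _); exact: measurable_affine.
apply: eq_Rintegral => h _; rewrite IH -/(kap (size w) l (c * g + s * h)) kapE; ring.
Qed.

Let word_mean_ge0 w : 0 <= word_mean w.
Proof. by elim: w => //= l w IH; rewrite mulr_ge0. Qed.

Lemma word_sum_mean n : word_sum n word_mean = 1.
Proof.
elim: n => //= n <-; apply: eq_word_sum => w.
by rewrite -mulr_suml m_sum mul1r.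
Qed.

Let mU w := \int[gamma]_g U w g.
Let sU w := \int[gamma]_g (U w g ^+ 2).

(** [Cn] is 1 plus the chi-square divergence between the two laws of the first n letters; [Sn] is
    the same quantity when the last noise variable is observed too. *)
Let Cn n := word_sum n (fun w => word_mean w * mU w ^+ 2).
Let Sn n := word_sum n (fun w => word_mean w * sU w).

Let sum_mU n : word_sum n (fun w => word_mean w * mU w) = 1.
Proof.
elim: n => [|n IH]; first by rewrite /= /mU /= bm_int_cst mulr1.
rewrite /= -[RHS]IH; apply: eq_word_sum => w.
rewrite (eq_bigr (fun l => word_mean w * (m (size w) l * mU (l :: w)))); last first.
  by move=> l _; ring.
rewrite -mulr_sumr; congr (_ * _).
exact: (filter_step_total c s (m_sum (size w)) (ba _) (sum_a (size w)) (bU w)).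
Qed.

Let q := B ^+ 2 * (s ^+ 2 / c ^+ 2).

Let q_ge0 : 0 <= q.
Proof. by rewrite /q mulr_ge0 ?divr_ge0// sqr_ge0. Qed.

Let C_step n : Cn n <= Cn n.+1 <= Cn n + q * (Sn n - Cn n).
Proof.
have H w := filter_step_mean c0 cs1 (m_ge0 (size w)) (m_sum (size w)) (ba _) (aB _) (int_a _)
  (sum_a (size w)) (bU w).
rewrite -[Cn n.+1]/(word_sum n (fun w => \sum_l m (size w) l * word_mean w * mU (l :: w) ^+ 2)).
have E w : \sum_l m (size w) l * word_mean w * mU (l :: w) ^+ 2 =
    word_mean w * \sum_l m (size w) l * mU (l :: w) ^+ 2.
  by rewrite mulr_sumr; apply: eq_bigr => l _; ring.
apply/andP; split.
  apply: le_word_sum => w; rewrite E ler_wpM2l//.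
  by have /andP[] := H w.
apply: (@le_trans _ _ (word_sum n (fun w => word_mean w * mU w ^+ 2 +
    q * (word_mean w * sU w + (- 1) * (word_mean w * mU w ^+ 2))))); last first.
  by rewrite !(word_sumD, word_sumZ) mulN1r.
apply: le_word_sum => w; rewrite E.
rewrite (_ : _ + _ = word_mean w * (mU w ^+ 2 + q * (sU w - mU w ^+ 2))); last by ring.
by rewrite ler_wpM2l//; have /andP[] := H w.
Qed.

Let S_step n : Sn n.+1 <= Cn n + B ^+ 2 * Sn n.
Proof.
rewrite -[Sn n.+1]/(word_sum n (fun w => \sum_l word_mean (l :: w) * sU (l :: w))).
rewrite /Cn /Sn -word_sumZ -word_sumD; apply: le_word_sum => w.
have -> : \sum_l word_mean (l :: w) * sU (l :: w) =
    word_mean w * \sum_l m (size w) l * sU (l :: w).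
  by rewrite mulr_sumr; apply: eq_bigr => l _ /=; ring.
rewrite (_ : _ + _ = word_mean w * (mU w ^+ 2 + B ^+ 2 * sU w)); last by ring.
rewrite ler_wpM2l//.
exact: (filter_step_sqr c s (m_ge0 (size w)) (m_sum (size w)) (ba _) (aB _) (sum_a (size w)) (bU w)).
Qed.

(** With this constant the bound S <= 2 C reproduces itself: S_(n+1) <= C_n + (1 / 2) (2 C_n) <= 2
    C_(n+1). *)
Hypothesis B2 : B ^+ 2 <= 2^-1.

Let y := 2 * q * B ^+ 2.

(** The second factor B^2 appears here: as C is nondecreasing, S_(n+1) - C_(n+1) <= B^2 S_n <= 2 B^2
    C_n, hence C_(n+2) <= C_(n+1) + y C_n. The recursion has order two, so the induction carries the
    bounds for n and n + 1 together. *)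
Let C_bound n : 1 <= Cn n /\ Sn n <= 2 * Cn n /\ Cn n.+1 <= (1 + y) ^+ n.+1 /\
  Cn n <= (1 + y) ^+ n.
Proof.
have C0 : Cn 0 = 1 by rewrite /Cn /= /mU /= bm_int_cst expr1n mulr1.
have S0 : Sn 0 = 1.
  rewrite /Sn /= /sU /= mul1r; under eq_Rintegral do rewrite expr1n.
  by rewrite bm_int_cst.
have y0 : 0 <= y by rewrite /y; apply: mulr_ge0; [apply: mulr_ge0|exact: sqr_ge0].
elim: n => [|n [IH1 [IH2 [IH3 IH4]]]].
  have /andP[_] := C_step 0; rewrite C0 S0 subrr mulr0 addr0 => h.
  rewrite expr0 expr1 lexx mulr1; split=> //; split; first by lra.
  by split=> //; lra.
have /andP[h1 _] := C_step n; have /andP[_ h2] := C_step n.+1.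
have h3 := S_step n.
have B2_ge0 : 0 <= B ^+ 2 by exact: sqr_ge0.
split; first exact: le_trans h1.
have h4 : B ^+ 2 * Sn n <= B ^+ 2 * (2 * Cn n) by rewrite ler_wpM2l.
have h5 : B ^+ 2 * (2 * Cn n) <= 2^-1 * (2 * Cn n) by rewrite ler_wpM2r//; lra.
split; first by lra.
split=> //.
have h6 : q * (Sn n.+1 - Cn n.+1) <= q * (B ^+ 2 * (2 * Cn n)).
  by rewrite ler_wpM2l//; lra.
rewrite exprSr mulrDr mulr1.
have h7 : Cn n * y <= (1 + y) ^+ n.+1 * y.
  by rewrite ler_wpM2r//; apply: le_trans IH3.
have h8 : q * (B ^+ 2 * (2 * Cn n)) = Cn n * y by rewrite /y; ring.
lra.
Qed.

(* The weighted sum of p1(w)^2 / p0(w), minus one, is a chi-square divergence. *)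
Lemma word_filter_tv n (t : R) (b : seq L -> bool) : 0 < t ->
  (1 + 2 * (B ^+ 2 * (s ^+ 2 / c ^+ 2)) * B ^+ 2) ^+ n - 1 <= t ^+ 2 ->
  `|word_sum n (fun w => (b w)%:R * (\int[gamma]_g word_filter w g - word_mean w))| <= t.
Proof.
move=> t0 ht; have [_ [_ [_ hC]]] := C_bound n.
have wE w : \int[gamma]_g word_filter w g - word_mean w = word_mean w * (mU w - 1).
  rewrite mulrBr mulr1 -bm_intZ//; congr (_ - _).
  by apply: eq_Rintegral => g _; rewrite word_filterE.
have {}ht : Cn n - 1 <= t ^+ 2 by apply: le_trans ht; rewrite lerD2r.
have norm_le (F : seq L -> R) : `|word_sum n F| <= word_sum n (fun w => `|F w|).
  rewrite ler_norml -[X in - X <= _]mul1r -mulNr -word_sumZ.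
  by apply/andP; split; apply: le_word_sum => w; rewrite ?mulN1r ?ler_norm// lerNl -normrN ler_norm.
apply: (le_trans (norm_le _)).
(* Uses |x| <= (t^2 + x^2) / (2 t) in place of Cauchy-Schwarz. The square is expanded because each
   piece has a known sum, the total of the squares being Cn - 1 <= t^2. *)
apply: (@le_trans _ _ (word_sum n (fun w => (2 * t)^-1 * (t ^+ 2 * word_mean w +
    (word_mean w * mU w ^+ 2 + (- 2) * (word_mean w * mU w) + word_mean w))))).
  apply: le_word_sum => w; rewrite wE.
  rewrite [leRHS](_ : _ = word_mean w * ((2 * t)^-1 * (t ^+ 2 + (mU w - 1) ^+ 2))); last by ring.
  apply: (@le_trans _ _ (word_mean w * `|mU w - 1|)).
    rewrite !normrM (ger0_norm (word_mean_ge0 w)).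
    rewrite -[leRHS]mul1r ler_wpM2r ?mulr_ge0//.
    by case: (b w); rewrite ?normr1 ?normr0.
  rewrite ler_wpM2l// mulrC ler_pdivlMr ?mulr_gt0//.
  rewrite -(real_normK (num_real (mU w - 1))).
  have := sqr_ge0 (`|mU w - 1| - t); nra.
rewrite word_sumZ !(word_sumD, word_sumZ) word_sum_mean sum_mU -/(Cn n).
by rewrite mulrC ler_pdivrMr ?mulr_gt0//; nra.
Qed.

End private_filter.

Lemma eq_ma_filter (R : realType) (sg c s : R) (f f' : nat -> measurableTypeR R -> R) n g :
  (forall i, (i < n)%N -> f i = f' i) -> ma_filter sg c s f n g = ma_filter sg c s f' n g.
Proof.
elim: n g => // n IH g ff' /=; apply: eq_Rintegral => h _.
by rewrite ff'// IH// => i lin; apply: ff'; rewrite ltnS ltnW.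
Qed.

(** Words list the newest letter first while [ma_filter] numbers factors from the oldest, so the
    letter of observation i stands at position size w - i.+1. *)
Lemma word_filter_ma (R : realType) (sg c s : R) (L : finType)
    (k : nat -> L -> measurableTypeR R -> R) (l0 : L) w g :
  word_filter sg c s k w g =
  ma_filter sg c s (fun i => k i (nth l0 w (size w - i.+1))) (size w) g.
Proof.
elim: w g => //= l w IH g; apply: eq_Rintegral => h _.
rewrite subnn /= IH; congr (_ * _); apply: eq_ma_filter => i iw.
by rewrite subSS -(subnSK iw).
Qed.

(** White noise is the moving average with coefficients 1 and 0. One filter therefore describes both
    hypotheses, and here it factorises. *)
Lemma word_filter_indep (R : realType) (sg : R) (L : finType)
    (k : nat -> L -> measurableTypeR R -> R) w :
  (forall i l, bounded_measurable (k i l)) ->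
  \int[normal_prob 0 1]_g word_filter sg 1 0 k w g = word_mean sg k w.
Proof.
move=> bk; have bV w' : bounded_measurable (word_filter sg 1 0 k w').
  case: w' => [|l w']; first exact: bm_cst.
  rewrite (_ : word_filter _ _ _ _ _ =
      ma_filter sg 1 0 (fun i => k i (nth l (l :: w') (size (l :: w') - i.+1))) (size (l :: w'))).
    exact: bm_ma_filter.
  by apply/funext => g; rewrite (word_filter_ma _ _ _ _ l).
elim: w => [|l w IH] /=; first by rewrite bm_int_cst.
have bkk : bounded_measurable (fun x : measurableTypeR R => k (size w) l (sg * x)).
  by apply: bm_comp (bk _ _); exact: measurable_funM.
rewrite -IH mulrC -(bm_intZ (normal_prob 0 1) _ bkk).
apply: eq_Rintegral => g _; rewrite [RHS]mulrC -(bm_intZ (normal_prob 0 1) _ (bV w)).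
by apply: eq_Rintegral => h _; rewrite mul1r mul0r addr0.
Qed.

Lemma time_law_ma (R : realType) (N : nat) (f : R -> R)
    (P : probability (N.-tuple (measurableTypeR R)) R) (sg c s : R)
    (F : nat -> measurableTypeR R -> R) :
  time_law f P -> c ^+ 2 + s ^+ 2 = 1 -> autocov f 0 = sg ^+ 2 ->
  autocov f 1 = sg ^+ 2 * (c * s) -> (forall n : nat, (1 < n)%N -> autocov f n = 0) ->
  (forall i, bounded_measurable (F i)) ->
  \int[P]_y \prod_(i < N) F i (tnth y i) = \int[normal_prob 0 1]_g ma_filter sg c s F N g.
Proof.
move=> [disp [Om [Pr [X [gX sX EX cX law]]]]] cs1 a0 a1 a2 bF.
have mX (i : nat) : measurable_fun setT (X i.+1%:Z) by exact: measurable_funPT.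
pose Y w : N.-tuple (measurableTypeR R) := [tuple X (i.+1)%:Z w | i < N].
have mY : measurable_fun setT Y.
  apply/measurable_fun_tnthP => i.
  rewrite (_ : _ \o _ = X i.+1%:Z); first exact: mX.
  by apply/funext => w /=; rewrite tnth_mktuple.
have bf : bounded_measurable (fun y : N.-tuple (measurableTypeR R) => \prod_(i < N) F i (tnth y i)).
  by apply: bm_prod => i; apply: bm_comp (bF i); exact: measurable_tnth.
have [mf _] := bf.
have [|||||_ ->] := @same_law_integral R _ _ P _ _ Pr _ _ id Y
  (fun y => \prod_(i < N) F i (tnth y i)).
- exact: measurable_id.
- exact: mY.
- by move=> A mA; exact: law.
- exact: mf.
- exact: (bm_integrable Pr (bm_comp mY bf)).
rewrite -(ma_joint bF mX (fun m t q t0 => gaussian_ma_cos gX sX EX cX cs1 a0 a1 a2 q t0)).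
by apply: eq_Rintegral => w _; apply: eq_bigr => i _; rewrite tnth_mktuple.
Qed.

(** * Reduction to finitely many output labels *)

Section grid_sets.
Variables (N : nat) (d : 'I_N -> measure_display) (Y : forall i, measurableType (d i)).

(** One alphabet [L] serves all coordinates, so that a labelled output is a word over a single
    finite type. The predicate [b] is arbitrary, which makes the class a ring: two labellings are
    combined by pairing. *)
Definition grid_set (A : set (fprodT Y)) : Prop :=
  exists (L : finType) (lab : forall i, Y i -> L) (b : ('I_N -> L) -> bool),
    (forall i l, measurable (lab i @^-1` [set l])) /\
    A = [set y : fprodT Y | b (fun i => lab i (y i))].

Lemma grid_setring : setring grid_set.
Proof.
have H (A1 A2 : set (fprodT Y)) (op : bool -> bool -> bool) : grid_set A1 -> grid_set A2 ->
    grid_set [set y | op (`[< A1 y >]) (`[< A2 y >])].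
  move=> [L1 [lab1 [b1 [m1 ->]]]] [L2 [lab2 [b2 [m2 ->]]]].
  exists (L1 * L2)%type, (fun i y => (lab1 i y, lab2 i y)),
    (fun w => op (b1 (fun i => (w i).1)) (b2 (fun i => (w i).2))); split.
    move=> i [l1 l2]; rewrite (_ : _ @^-1` _ = lab1 i @^-1` [set l1] `&` lab2 i @^-1` [set l2]).
      exact: measurableI.
    by apply/seteqP; split => y /= [-> ->].
  by apply/seteqP; split => y /=; rewrite !asboolb.
split.
- exists unit, (fun _ _ => tt), (fun=> false); split; last by apply/seteqP; split.
  move=> i l; rewrite (_ : _ @^-1` _ = setT) //.
  by apply/seteqP; split => // y _ /=; case: l.
- move=> A1 A2 g1 g2; rewrite (_ : A1 `|` A2 = [set y | `[< A1 y >] || `[< A2 y >] ]).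
    exact: H.
  apply/seteqP; split => y /=.
    by case=> h; apply/orP; [left|right]; apply/asboolP.
  by case/orP => /asboolP; [left|right].
- move=> A1 A2 g1 g2; rewrite (_ : A1 `\` A2 = [set y | `[< A1 y >] && ~~ `[< A2 y >] ]).
    exact: (H _ _ (fun a b => a && ~~ b)).
  apply/seteqP; split => y /=.
    by case=> h1 h2; apply/andP; split; [exact/asboolP|exact/asboolPn].
  by case/andP => /asboolP h1 /asboolPn h2.
Qed.

Lemma grid_cylinder i (C : set (Y i)) : measurable C ->
  grid_set [set y : fprodT Y | C (y i)].
Proof.
move=> mC; pose B := dfwith (fun j => [set: Y j]) i C.
have mB j : measurable (B j).
  have [ij|ij] := eqVneq i j; first by case: j / ij; rewrite /B dfwithin.
  by rewrite /B dfwithout.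
exists bool, (fun j y => `[< B j y >]), (fun w => w i); split.
  move=> j [].
    rewrite (_ : _ @^-1` _ = B j); first exact: mB.
    by apply/seteqP; split => y /= /asboolP.
  rewrite (_ : _ @^-1` _ = ~` B j); first exact: measurableC.
  apply/seteqP; split => y /= => [/negbT/asboolPn//|nB].
  by apply/negbTE/asboolPn.
by rewrite /B dfwithin; apply/seteqP; split => y /= /asboolP.
Qed.

Lemma measurable_grid_ring (A : set (fprodT Y)) : measurable A -> <<sr grid_set>> A.
Proof.
have [g0 gU gD] := grid_setring.
have [s0 sD sU] := smallest_sigma_ring grid_set.
have gT : grid_set setT.
  exists unit, (fun _ _ => tt), (fun=> true); split; last by apply/seteqP; split.
  move=> i l; rewrite (_ : _ @^-1` _ = setT) //.
  by apply/seteqP; split => // y _ /=; case: l.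
have sT : <<sr grid_set>> setT by apply: sub_g_sigma_ring.
suff : <<s fprod_cylinders Y>> `<=` <<sr grid_set>> by apply.
apply: smallest_sub; first by split=> // B sB; apply: sD.
by move=> _ [i [C [mC ->]]]; apply: sub_g_sigma_ring; exact: grid_cylinder.
Qed.

(** Probabilities are continuous along monotone sequences, so the sets satisfying the bound form a
    monotone class, which contains the sigma-ring generated by the grid sets. *)
Lemma grid_diff_le (R : realType) (mu0 mu1 : probability (fprodT Y) R) (t : R) :
  (forall A, grid_set A -> measurable A) ->
  (forall A, grid_set A -> `|fine (mu1 A) - fine (mu0 A)| <= t) ->
  forall A, measurable A -> `|fine (mu1 A) - fine (mu0 A)| <= t.
Proof.
move=> gm gt A mA.
pose G := [set A : set (fprodT Y) | measurable A /\ `|fine (mu1 A) - fine (mu0 A)| <= t].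
suff : <<sr grid_set>> `<=` G by move=> /(_ _ (measurable_grid_ring mA))[].
have lim (F : (set (fprodT Y))^nat) B : (forall i, G (F i)) -> measurable B ->
    (forall mu : probability (fprodT Y) R, mu (F n) @[n --> \oo] --> mu B) -> G B.
  move=> GF mB cF; split=> //.
  have fc (mu : probability (fprodT Y) R) : fine (mu (F n)) @[n --> \oo] --> fine (mu B).
    by apply: fine_cvg; rewrite fineK ?fin_num_measure//; exact: cF.
  have cn : `|fine (mu1 (F n)) - fine (mu0 (F n))| @[n --> \oo] -->
      `|fine (mu1 B) - fine (mu0 B)|.
    by apply: cvg_norm; apply: cvgB; exact: fc.
  rewrite -(cvg_lim _ cn)//; apply: limr_le; first by apply/cvg_ex; eexists; exact: cn.
  by apply: nearW => n; have [] := GF n.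
apply: monotone_setring_sub_g_sigma_ring.
- split=> F mF GF.
  + apply: (lim F) => //; first by apply: bigcup_measurable => n _; have [] := GF n.
    move=> mu; apply: nondecreasing_cvg_mu => //; first by move=> n; have [] := GF n.
    by apply: bigcup_measurable => n _; have [] := GF n.
  + apply: (lim F) => //; first by apply: bigcapT_measurable => n; have [] := GF n.
    move=> mu; apply: nonincreasing_cvg_mu => //.
    * by rewrite (le_lt_trans (probability_le1 _ _)) ?ltry//; have [] := GF 0%N.
    * by move=> n; have [] := GF n.
    * by apply: bigcapT_measurable => n; have [] := GF n.
- exact: grid_setring.
- by move=> B gB; split; [exact: gm|exact: gt].
Qed.

End grid_sets.

Section labels.
Context (R : realType) d (T : measurableType d) (mu : probability T R) (L : finType).

Lemma sum_label_measure (lab : T -> L) :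
  (forall l, measurable (lab @^-1` [set l])) ->
  \sum_l fine (mu (lab @^-1` [set l])) = 1.
Proof.
move=> mlab.
rewrite -[RHS](bm_int_cst mu).
transitivity (\int[mu]_y \sum_l \1_(lab @^-1` [set l]) y).
  rewrite bm_int_sum; last by move=> l; exact: bm_indic.
  by apply: eq_bigr => l _; rewrite bm_int_indic.
apply: eq_Rintegral => y _; rewrite (bigD1 (lab y)) //= indicE mem_set// big1 ?addr0// => l ll.
by rewrite indicE memNset//= => ly; rewrite ly eqxx in ll.
Qed.

Lemma label_measure (lab : T -> L) (b : pred L) :
  (forall l, measurable (lab @^-1` [set l])) ->
  measurable [set y | b (lab y)] /\
  fine (mu [set y | b (lab y)]) = \sum_l (b l)%:R * fine (mu (lab @^-1` [set l])).
Proof.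
move=> mlab.
have E : \1_[set y | b (lab y)] = fun y => \sum_l (b l)%:R * \1_(lab @^-1` [set l]) y :> R.
  apply/funext => y; rewrite (bigD1 (lab y)) //= [X in _ = _ * X + _]indicE mem_set// mulr1.
  rewrite big1 ?addr0; last first.
    by move=> l ll; rewrite indicE memNset ?mulr0//= => ly; rewrite ly eqxx in ll.
  rewrite indicE; congr (_%:R); case: (boolP (b (lab y))) => by_; first by rewrite mem_set.
  by rewrite memNset//=; exact/negP.
have bE : bounded_measurable (\1_[set y | b (lab y)] : T -> R).
  by rewrite E; apply: bm_sum => l; apply: bmZ; exact: bm_indic.
have mA : measurable [set y | b (lab y)].
  have [mf _] := bE; have := mf measurableT [set 1] (measurable_set1 1).
  rewrite setTI (_ : _ @^-1` _ = [set y | b (lab y)])//.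
  apply/seteqP; split => y /=; rewrite indicE.
    by case: (boolP (y \in _)) => [/set_mem//|_ /eqP]; rewrite eq_sym oner_eq0.
  by move=> h; rewrite mem_set.
split=> //; rewrite -bm_int_indic// E bm_int_sum; last by move=> l; apply: bmZ; exact: bm_indic.
by apply: eq_bigr => l _; rewrite bm_intZ ?bm_int_indic//; exact: bm_indic.
Qed.

End labels.

Lemma pker_sum_label (R : realType) d d' (X : measurableType d) (Y : measurableType d')
    (K : R.-pker X ~> Y) (L : finType) (lab : Y -> L) (x : X) :
  (forall l, measurable (lab @^-1` [set l])) ->
  \sum_l fine (K x (lab @^-1` [set l])) = 1.
Proof.
(* A kernel at a point is the image of a Dirac mass, hence a probability to which the previous
   section applies. *)
move=> mlab; rewrite -(sum_label_measure (kimage K (\d_x)) mlab).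
apply: eq_bigr => l _; congr fine; rewrite /= /kimage integral_dirac//.
  by rewrite diracT mul1e.
exact: measurable_kernel.
Qed.

Lemma pker_le1 (R : realType) d d' (X : measurableType d) (Y : measurableType d')
    (K : R.-pker X ~> Y) (x : X) (A : set Y) : measurable A -> (K x A <= 1)%E.
Proof.
move=> mA; have <- : K x setT = 1%E by exact: prob_kernel.
by apply: le_measure; rewrite ?inE.
Qed.

Section time_side.
Context (R : realType) (N : nat) (alpha : R) (K : 'I_N.+1 -> ldp_mechanism alpha).
Variables (f0 f1 : R -> R) (P0 P1 : probability (N.+1.-tuple (measurableTypeR R)) R).
Variables (sg c s : R).
Hypothesis c0 : 0 < c.
Hypothesis cs1 : c ^+ 2 + s ^+ 2 = 1.
Hypothesis law0 : time_law f0 P0.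
Hypothesis law1 : time_law f1 P1.
Hypothesis f00 : autocov f0 0 = sg ^+ 2.
Hypothesis f0n : forall n : nat, (0 < n)%N -> autocov f0 n = 0.
Hypothesis f10 : autocov f1 0 = sg ^+ 2.
Hypothesis f11 : autocov f1 1 = sg ^+ 2 * (c * s).
Hypothesis f1n : forall n : nat, (1 < n)%N -> autocov f1 n = 0.
Hypothesis alpha0 : 0 <= alpha.
Local Notation B := (expR alpha - 1).
Hypothesis B2 : B ^+ 2 <= 2^-1.
Variable t : R.
Hypothesis t0 : 0 < t.
Hypothesis tN : (1 + 2 * (B ^+ 2 * (s ^+ 2 / c ^+ 2)) * B ^+ 2) ^+ N.+1 - 1 <= t ^+ 2.
Local Notation gamma := (@normal_prob R 0 1).
Local Notation Y := (fun i => mech_out (K i)).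

(** The labelled outputs form a random word. Its law is given by the word filter with coefficients
    (c, s) under f1 and (1, 0) under f0, and the chi-square bound is uniform in the labelling and in
    [b]. *)
Lemma time_grid_bound (A : set (mech_outN K)) : grid_set A -> measurable A /\
  `|fine (kimage (mech_kerN K) P1 A) - fine (kimage (mech_kerN K) P0 A)| <= t.
Proof.
move=> [L [lab [b [mlab ->]]]].
pose l0 : L := lab ord0 point.
(* The reversal matches the newest-first order of words. *)
pose box (w : N.+1.-tuple L) : set (mech_outN K) :=
  [set y | forall i, (lab i @^-1` [set tnth w (rev_ord i)]) (y i)].
pose lw (y : mech_outN K) : N.+1.-tuple L :=
  [tuple lab (rev_ord i) (y (rev_ord i)) | i < N.+1].
pose bw (w : seq L) := b (fun i : 'I_N.+1 => nth l0 w (N.+1 - i.+1)).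
have lwE w : lw @^-1` [set w] = box w.
  apply/seteqP; split => y /=.
    by move=> <- i; rewrite /= tnth_mktuple rev_ordK.
  move=> h; apply: eq_from_tnth => i; rewrite tnth_mktuple.
  by have := h (rev_ord i); rewrite /= rev_ordK.
have mlw w : measurable (lw @^-1` [set w]).
  by rewrite lwE; apply: (measurable_box (A := fun i => lab i @^-1` [set tnth w (rev_ord i)])).
have AE : [set y : mech_outN K | b (fun i => lab i (y i))] = [set y | bw (lw y)].
  have E y : (fun i : 'I_N.+1 => nth l0 (lw y) (N.+1 - i.+1)) = fun i => lab i (y i).
    by apply/funext => i; rewrite -(tnth_nth l0 (lw y) (rev_ord i)) tnth_mktuple rev_ordK.
  by apply/seteqP; split => y /=; rewrite /bw E.
rewrite AE.
have H (mu : probability (mech_outN K) R) :=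
  label_measure mu (fun w : N.+1.-tuple L => bw w) mlw.
split; first by have [] := H (kimage (mech_kerN K) P1).
rewrite (H (kimage (mech_kerN K) P1)).2 (H (kimage (mech_kerN K) P0)).2.
(* The filter is indexed by natural numbers; [inord] is exact for the indices below N.+1 that a word
   of this length uses. *)
pose k (i : nat) (l : L) (x : measurableTypeR R) : R :=
  fine (K (inord i) x (lab (inord i) @^-1` [set l])).
have kfin i l x : K i x (lab i @^-1` [set l]) \is a fin_num.
  rewrite ge0_fin_numE// (@le_lt_trans _ _ 1%E) ?ltry//.
  exact: pker_le1.
have bk i l : bounded_measurable (k i l).
  split.
    apply/measurable_EFinP; rewrite (_ : _ \o _ =
        fun x => K (inord i) x (lab (inord i) @^-1` [set l])).
      exact: (measurable_kernel (mech_ker _)).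
    by apply/funext => x /=; rewrite fineK.
  exists 1 => x; rewrite ger0_norm ?fine_ge0// -lee_fin fineK//.
  exact: pker_le1.
have k_ge0 i l x : 0 <= k i l x by rewrite fine_ge0.
have k_sum i x : \sum_l k i l x = 1 by exact: pker_sum_label.
have k_ldp i l x y : k i l x <= expR alpha * k i l y.
  rewrite /k -lee_fin EFinM !fineK//.
  exact: mech_ldp.
have boxE (f : R -> R) (P : probability (N.+1.-tuple (measurableTypeR R)) R) c' s' (w : N.+1.-tuple L) :
    time_law f P -> c' ^+ 2 + s' ^+ 2 = 1 -> autocov f 0 = sg ^+ 2 ->
    autocov f 1 = sg ^+ 2 * (c' * s') -> (forall n : nat, (1 < n)%N -> autocov f n = 0) ->
    fine (kimage (mech_kerN K) P (lw @^-1` [set w])) =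
    \int[gamma]_g word_filter sg c' s' k w g.
  move=> lf cs' a0 a1 a2.
  rewrite lwE /box /mech_kerN.
  rewrite (kimage_fprod_kernel_box (fun i => mech_ker (K i)) P
    (A := fun i => lab i @^-1` [set tnth w (rev_ord i)])); last by [].
  transitivity (\int[P]_x \prod_(i < N.+1) k i (nth l0 w (N.+1 - i.+1)) (tnth x i)).
    rewrite /Rintegral; congr fine; apply: eq_integral => x _.
    rewrite -prodEFin; apply: eq_bigr => i _.
    rewrite /k inord_val fineK//; congr (_ _ _).
    by rewrite -(tnth_nth l0 w (rev_ord i)).
  rewrite (time_law_ma (F := fun i => k i (nth l0 w (N.+1 - i.+1))) lf cs' a0 a1 a2)//.
  by apply: eq_Rintegral => g _; rewrite (word_filter_ma _ _ _ _ l0) size_tuple.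
have E1 w : fine (kimage (mech_kerN K) P1 (lw @^-1` [set w])) =
    \int[gamma]_g word_filter sg c s k w g by exact: boxE law1 cs1 f10 f11 f1n.
have E0 w : fine (kimage (mech_kerN K) P0 (lw @^-1` [set w])) = word_mean sg k w.
  rewrite -word_filter_indep//; apply: boxE law0 _ f00 _ _.
  - by rewrite expr1n expr0n addr0.
  - by rewrite mulr0 mulr0 f0n.
  - by move=> n n1; rewrite f0n// ltnW.
rewrite -sumrB (eq_bigr (fun w : N.+1.-tuple L =>
  (bw w)%:R * (\int[gamma]_g word_filter sg c s k w g - word_mean sg k w))); last first.
  by move=> w _; rewrite E1 E0 mulrBr.
rewrite (word_sum_tuple (N.+1) (fun w => (bw w)%:R *
  (\int[gamma]_g word_filter sg c s k w g - word_mean sg k w))).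
exact: (word_filter_tv sg c0 cs1 bk k_ge0 k_sum k_ldp alpha0 B2 bw t0 tN).
Qed.

Lemma time_bound (A : set (mech_outN K)) : measurable A ->
  `|fine (kimage (mech_kerN K) P1 A) - fine (kimage (mech_kerN K) P0 A)| <= t.
Proof.
by apply: grid_diff_le => C /time_grid_bound[].
Qed.

End time_side.

(** * Randomized response in the frequency model *)

(** The output space of a mechanism must be standard Borel, so the two-point space is made a
    complete uniform space; compactness gives this. *)
Lemma bool_complete (F : set_system bool) : ProperFilter F -> cauchy F -> cvg F.
Proof.
move=> PF cF; apply: (compact_cauchy_cvg (U := [set: bool])) => //.
  exact: filterT.
exact: bool_compact.
Qed.

HB.instance Definition _ := Uniform_isComplete.Build bool bool_complete.

Section randomized_response.
Variables (R : realType) (alpha : R).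
Hypothesis alpha0 : 0 < alpha.
Variable S : set (measurableTypeR R).
Hypothesis mS : measurable S.

(** The answer true has probability 1 / 2 off S and 1 - exp (-alpha) / 2 on S. The answer false then
    has probabilities 1 / 2 and exp (-alpha) / 2, whose ratio exhausts the privacy budget. *)
Definition response_prob (x : measurableTypeR R) : R :=
  (1 + (1 - expR (- alpha)) * \1_S x) / 2.

Lemma bm_response_prob : bounded_measurable response_prob.
Proof.
rewrite (_ : response_prob = fun x => 2^-1 * (1 + (1 - expR (- alpha)) * \1_S x)).
  by apply: bmZ; apply: bmD; [exact: bm_cst|apply: bmZ; exact: bm_indic].
by apply/funext => x; rewrite mulrC.
Qed.

Let e := expR (- alpha).

Let e01 : 0 < e < 1.
Proof. by rewrite expR_gt0 -expR0 ltr_expR oppr_lt0. Qed.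

Lemma response_prob_bounds x : 1 / 2 <= response_prob x <= (2 - e) / 2.
Proof.
have /andP[e0 e1] := e01; rewrite /response_prob -/e indicE.
by case: (x \in S) => /=; rewrite ?mulr1 ?mulr0; apply/andP; split; lra.
Qed.

Lemma response_prob01 x : 0 <= response_prob x <= 1.
Proof.
have /andP[e0 e1] := e01; have /andP[] := response_prob_bounds x => h1 h2.
by apply/andP; split; lra.
Qed.

Definition response_kernel : R.-pker (measurableTypeR R) ~> bool :=
  kprobability (measurableT_comp measurable_bernoulli_prob bm_response_prob.1).

Lemma response_kernelE x A : response_kernel x A =
  ((response_prob x)%:E * \d_true A + (1 - response_prob x)%:E * \d_false A)%E.
Proof. by rewrite /response_kernel /= bernoulli_probE ?response_prob01. Qed.

Lemma response_ldp (x x' : R) (A : set bool) : measurable A ->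
  (response_kernel x A <= (expR alpha)%:E * response_kernel x' A)%E.
Proof.
move=> _; rewrite !response_kernelE !diracE.
have ep : expR alpha * e = 1 by rewrite /e -expRD subrr expR0.
have /andP[e0 e1] := e01; have E0 := expR_gt0 alpha.
have /andP[h1 h2] := response_prob_bounds x; have /andP[h3 h4] := response_prob_bounds x'.
set r := response_prob x in h1 h2 *; set r' := response_prob x' in h3 h4 *.
set E := expR alpha in ep E0 *.
have E1 : 1 <= E by nra.
have hT : r <= E * r' by nra.
have hF : 1 - r <= E * (1 - r') by nra.
case: (true \in A); case: (false \in A);
  rewrite /= ?mule1 ?mule0 ?adde0 ?add0e -?EFinD -?EFinM lee_fin; lra.
Qed.

Lemma bool_standard_borel : standard_borel R bool.
Proof.
exists bool, id; split.
- exact: discrete_hausdorff.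
- by apply: (@compact_second_countable R bool); exact: bool_compact.
- by exists id.
- move=> A; split=> // _; apply: sub_sigma_algebra => /=.
  exact: discrete_open.
Qed.

Definition response_mechanism : ldp_mechanism alpha :=
  LdpMechanism bool_standard_borel response_ldp.

End randomized_response.

Section count_chebyshev.
Context (R : realType) d (T : measurableType d) (mu : probability T R) (I : finType).
Variables (J : {set I}) (xi : I -> T -> R) (pi_ : I -> R).
Hypothesis bxi : forall j, bounded_measurable (xi j).
Hypothesis xi2 : forall j y, xi j y ^+ 2 = xi j y.
Hypothesis xi_mean : forall j, j \in J -> \int[mu]_y xi j y = pi_ j.
Hypothesis xi_cov : forall i j, i \in J -> j \in J -> i != j ->
  \int[mu]_y (xi i y * xi j y) = pi_ i * pi_ j.

Let Z y := \sum_(j in J) (xi j y - pi_ j).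

Lemma bm_count_dev : bounded_measurable Z.
Proof.
rewrite /Z; under eq_fun do rewrite -big_enum /=.
by apply: bm_sum => j; apply: bmB => //; exact: bm_cst.
Qed.

Lemma count_variance : \int[mu]_y (Z y ^+ 2) <= #|J|%:R / 4.
Proof.
pose G i j y := (xi i y - pi_ i) * (xi j y - pi_ j).
have bG i j : bounded_measurable (G i j).
  by apply: bmM; apply: bmB => //; exact: bm_cst.
have EG i j : i \in J -> j \in J -> \int[mu]_y G i j y = if i == j then pi_ i * (1 - pi_ i) else 0.
  move=> iJ jJ.
  transitivity (\int[mu]_y (xi i y * xi j y + (- pi_ j * xi i y + (- pi_ i * xi j y + pi_ i * pi_ j)))).
    by apply: eq_Rintegral => y _; rewrite /G; ring.
  have b3 : bounded_measurable (fun y => - pi_ i * xi j y + pi_ i * pi_ j).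
    by apply: bmD; [exact: bmZ|exact: bm_cst].
  have b2 : bounded_measurable (fun y => - pi_ j * xi i y + (- pi_ i * xi j y + pi_ i * pi_ j)).
    by apply: bmD => //; exact: bmZ.
  rewrite bm_intD//; last exact: bmM.
  rewrite bm_intD//; last exact: bmZ.
  rewrite bm_intD; [|exact: bmZ|exact: bm_cst].
  rewrite (bm_intZ _ _ (bxi i)) (bm_intZ _ _ (bxi j)) bm_int_cst !xi_mean//.
  case: eqVneq => [ij|ij]; last by rewrite xi_cov//; ring.
  subst j; rewrite (_ : (fun y => xi i y * xi i y) = xi i) ?xi_mean//; first by ring.
  by apply/funext => y; rewrite -expr2 xi2.
have -> : \int[mu]_y (Z y ^+ 2) = \sum_(j in J) pi_ j * (1 - pi_ j).
  transitivity (\int[mu]_y \sum_(i <- enum J) \sum_(j <- enum J) G i j y).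
    apply: eq_Rintegral => y _; rewrite /Z expr2 mulr_suml big_enum /=.
    apply: eq_bigr => i _; rewrite mulr_sumr big_enum /=.
    by apply: eq_bigr => j _.
  rewrite bm_int_sum; last by move=> i; exact: bm_sum.
  rewrite big_enum /=; apply: eq_bigr => i iJ.
  rewrite bm_int_sum// big_enum /= (bigD1 i)//= EG// eqxx big1 ?addr0// => j /andP[jJ ji].
  by rewrite EG// eq_sym (negbTE ji).
apply: (@le_trans _ _ (\sum_(j in J) 4^-1)).
  by apply: ler_sum => j _; have := sqr_ge0 (pi_ j - 2^-1); nra.
by rewrite sumr_const -[leLHS]mulr_natl.
Qed.

Lemma count_chebyshev (h : R) : 0 < h ->
  measurable [set y | h <= `|Z y|] /\
  fine (mu [set y | h <= `|Z y|]) <= #|J|%:R / (4 * h ^+ 2).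
Proof.
move=> h0; have bZ := bm_count_dev; have [mZ _] := bZ.
have mA : measurable [set y | h <= `|Z y|].
  rewrite -[X in measurable X]setTI.
  have mn : measurable_fun setT (fun y => `|Z y|) by exact: measurableT_comp.
  by have := mn measurableT _ (measurable_itv `[h, +oo[%R); congr measurable;
    apply/seteqP; split => y /=; rewrite in_itv/= andbT.
split=> //; rewrite -(bm_int_indic mu mA).
apply: (@le_trans _ _ (\int[mu]_y ((h ^+ 2)^-1 * Z y ^+ 2))).
  apply: bm_int_le; [exact: bm_indic|by apply: bmZ; exact: bmX|].
  move=> y; rewrite indicE; have [/set_mem/= hy|_] := boolP (y \in _); last first.
    by rewrite mulr_ge0 ?invr_ge0 ?sqr_ge0.
  rewrite mulrC ler_pdivlMr ?exprn_gt0// mul1r -(real_normK (num_real (Z y))).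
  by rewrite ler_sqr ?nnegrE// ltW.
rewrite bm_intZ; last exact: bmX.
have h2 : 0 < h ^+ 2 by rewrite exprn_gt0.
rewrite [leLHS]mulrC ler_pdivrMr//; apply: (le_trans count_variance).
by rewrite le_eqVlt; apply/orP; left; apply/eqP; field; rewrite gt_eqF.
Qed.

End count_chebyshev.

Lemma count_test (R : realType) d (T : measurableType d) (mu0 mu1 : probability T R)
    (I : finType) (J : {set I}) (xi : I -> T -> R) (p0 p1 : I -> R) (e : R) :
  (forall j, bounded_measurable (xi j)) -> (forall j y, xi j y ^+ 2 = xi j y) ->
  (forall j, j \in J -> \int[mu0]_y xi j y = p0 j) ->
  (forall i j, i \in J -> j \in J -> i != j -> \int[mu0]_y (xi i y * xi j y) = p0 i * p0 j) ->
  (forall j, j \in J -> \int[mu1]_y xi j y = p1 j) ->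
  (forall i j, i \in J -> j \in J -> i != j -> \int[mu1]_y (xi i y * xi j y) = p1 i * p1 j) ->
  0 < e -> (0 < #|J|)%N -> (forall j, j \in J -> p0 j + e <= p1 j) ->
  exists A, measurable A /\ 1 - 2 / (#|J|%:R * e ^+ 2) <= fine (mu1 A) - fine (mu0 A).
Proof.
move=> bxi xi2 m0 c0 m1 c1 e0 J0 pe.
pose n : R := #|J|%:R; have n0 : 0 < n by rewrite ltr0n.
(* Half the guaranteed gap between the two expected counts. The variances are at most n / 4, so
   Chebyshev bounds either error by (n / 4) / h^2 = 1 / (n e^2). *)
pose h := n * e / 2; have h0 : 0 < h by rewrite divr_gt0 ?mulr_gt0.
pose A := [set y | h <= \sum_(j in J) (xi j y - p0 j)].
have [mB0 B0] := count_chebyshev bxi xi2 m0 c0 h0.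
have [mB1 B1] := count_chebyshev bxi xi2 m1 c1 h0.
have [mZ _] := bm_count_dev J p0 bxi.
have mA : measurable A.
  rewrite -[X in measurable X]setTI.
  by have := mZ measurableT _ (measurable_itv `[h, +oo[%R); congr measurable;
    apply/seteqP; split => y /=; rewrite in_itv/= andbT.
exists A; split=> //.
have hE : #|J|%:R / (4 * h ^+ 2) = (n * e ^+ 2)^-1.
  by rewrite /h -/n; field; rewrite !gt_eqF.
rewrite hE in B0 B1.
have l0 : fine (mu0 A) <= (n * e ^+ 2)^-1.
  apply: le_trans B0; apply: fine_le; rewrite ?fin_num_measure//.
  by apply: le_measure; rewrite ?inE// => y /= /le_trans; apply; exact: ler_norm.
have l1 : fine (mu1 (~` A)) <= (n * e ^+ 2)^-1.
  have mAc := measurableC mA.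
  apply: le_trans B1; apply: fine_le; rewrite ?fin_num_measure//.
  apply: le_measure; rewrite ?inE// => y /= /negP; rewrite -ltNge => hy.
  rewrite -normrN; apply: le_trans (ler_norm _); rewrite -sumrN.
  have : \sum_(j in J) (- (xi j y - p1 j) + (xi j y - p0 j)) >= n * e.
    apply: (@le_trans _ _ (\sum_(j in J) e)); first by rewrite sumr_const -mulr_natl.
    by apply: ler_sum => j /pe; lra.
  by rewrite big_split /=; move: hy; rewrite /h; lra.
have E : fine (mu1 A) = 1 - fine (mu1 (~` A)).
  have := probability_setC mu1 mA.
  by move=> ->; rewrite fineB ?fin_num_measure//= subKr.
rewrite E (_ : 2 / _ = (n * e ^+ 2)^-1 + (n * e ^+ 2)^-1); first by lra.
by rewrite -/n; field; rewrite !gt_eqF.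
Qed.

Section gauss_tail.
Variable R : realType.
Local Notation gamma := (@normal_prob R 0 1).
Local Notation p := (@normal_pdf R 0 1).

Lemma gauss_law_setT (m v : R) : gauss_law m v setT = 1%E.
Proof.
rewrite /gauss_law; case: eqP => _; first by rewrite diracT.
exact: probability_setT.
Qed.

Lemma measurable_sqr_gt (c0 : R) :
  measurable ([set x : measurableTypeR R | c0 < x ^+ 2] : set (measurableTypeR R)).
Proof.
rewrite -[X in measurable X]setTI.
have mf : measurable_fun setT (fun x : measurableTypeR R => x ^+ 2) by exact: measurable_funX.
by have := mf measurableT _ (measurable_itv `]c0, +oo[%R); congr measurable;
  apply/seteqP; split => y /=; rewrite in_itv/= andbT.
Qed.

Lemma gamma_itv (a : R) : 0 <= a <= 1 -> ((p 1 * (1 - a))%:E <= gamma `]a, 1%R])%E.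
Proof.
move=> /andP[a0 a1].
have -> : ((p 1 * (1 - a))%:E = \int[lebesgue_measure]_(x in `]a, 1%R]) (p 1)%:E)%E.
  rewrite integral_cst// EFinM; congr (_ * _)%E.
  rewrite (_ : _ `]a, 1]%classic = lebesgue_measure (`]a, 1%R] : set R))//.
  rewrite lebesgue_measure_itv /= lte_fin; case: ltP => h; first by rewrite EFinB.
  have -> : a = 1 by apply/eqP; rewrite eq_le a1 h.
  by rewrite subrr.
apply: ge0_le_integral => //.
- by move=> x _; rewrite lee_fin normal_pdf_ge0.
- by apply/measurable_EFinP/measurable_funTS; exact: measurable_normal_pdf.
- move=> x /=; rewrite in_itv/= => /andP[ax x1]; rewrite lee_fin !std_normal_pdfE.
  by rewrite ler_wpM2l ?normal_peak_ge0// ler_expR; nra.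
Qed.

(** In terms of a standard normal g the event is g^2 > 1 at variance c0. At variance v it also
    contains the interval from 1 - eta / 4 to 1, because (1 + eta) (1 - eta / 4)^2 >= 1 for 0 < eta
    <= 1; there the density is at least p 1. *)
Lemma gauss_tail (c0 v eta : R) : 0 < c0 -> 0 < eta <= 1 -> c0 * (1 + eta) <= v ->
  fine (gauss_law 0 c0 [set x | c0 < x ^+ 2]) + p 1 * (eta / 4) <=
  fine (gauss_law 0 v [set x | c0 < x ^+ 2]).
Proof.
move=> c00 /andP[e0 e1] cv; have mS := measurable_sqr_gt c0.
have v0 : 0 <= v by rewrite (le_trans _ cv)// mulr_ge0 ?ltW// ltr_wpDr// ltW.
rewrite !gauss_lawE//; last exact: ltW.
set S1 := _ @^-1` _; set S2 := _ @^-1` _.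
have mS1 : measurable S1 by rewrite -[X in measurable X]setTI; exact: measurable_affine.
have mS2 : measurable S2 by rewrite -[X in measurable X]setTI; exact: measurable_affine.
set I := `]1 - eta / 4, 1]%classic.
have mI : measurable (I : set (measurableTypeR R)) by exact: measurable_itv.
have dis : [disjoint S1 & I].
  apply/disj_setPS => x []; rewrite /S1 /I /=; rewrite add0r exprMn sqr_sqrtr ?ltW// in_itv/= => h /andP[h1 h2].
  have : x ^+ 2 <= 1 by nra.
  by rewrite leNgt -(ltr_pM2l c00) mulr1 h.
have sub : S1 `|` I `<=` S2.
  move=> x []; rewrite /S1 /S2 /I /= ?add0r ?exprMn ?sqr_sqrtr// ?ltW//.
    by move=> h; rewrite (lt_le_trans h)// ler_wpM2r ?sqr_ge0//; nra.
  rewrite in_itv/= => /andP[h1 h2].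
  have hx : (1 - eta / 4) ^+ 2 < x ^+ 2 by nra.
  have he : 1 <= (1 + eta) * (1 - eta / 4) ^+ 2 by nra.
  have x2 : 0 < x ^+ 2 by apply: le_lt_trans hx; exact: sqr_ge0.
  apply: (@lt_le_trans _ _ (c0 * (1 + eta) * x ^+ 2)); last by rewrite ler_wpM2r// ltW.
  rewrite -mulrA -[ltLHS]mulr1 ltr_pM2l//.
  by apply: (le_lt_trans he); rewrite ltr_pM2l//; lra.
have e4 : 0 <= 1 - eta / 4 <= 1 by apply/andP; split; lra.
have := gamma_itv e4; rewrite opprB addrC subrK => hI.
rewrite -lee_fin EFinD !fineK ?fin_num_measure//.
apply: (@le_trans _ _ (gamma S1 + gamma I)%E); first by rewrite leeD2l.
rewrite -measureU//; last by apply/disj_set2P.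
by apply: le_measure; rewrite ?inE//; exact: measurableU.
Qed.

End gauss_tail.

Section freq_side.
Context (R : realType) (N : nat) (alpha : R).
Hypothesis alpha0 : 0 < alpha.
Variables (c0 : R).
Local Notation p := (@normal_pdf R 0 1).
Local Notation S := [set x : measurableTypeR R | c0 < x ^+ 2].
Local Notation RN := (N.-tuple (measurableTypeR R)).

Definition response (_ : 'I_N) : ldp_mechanism alpha :=
  response_mechanism alpha0 (measurable_sqr_gt c0).

Let prob := response_prob alpha S.
Let xi (j : 'I_N) (y : mech_outN response) : R := (y j : bool)%:R.
Let beta := 1 - expR (- alpha).

Let bxi j : bounded_measurable (xi j).
Proof.
split; last by exists 1 => y; rewrite /xi; case: (y j); rewrite ?normr1 ?normr0.
have mb : measurable_fun setT (fun b : bool => (b%:R : R)) by [].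
exact: (measurableT_comp mb (measurable_fproj j)).
Qed.

Let xi2 j y : xi j y ^+ 2 = xi j y.
Proof. by rewrite /xi; case: (y j); rewrite ?expr1n ?expr0n. Qed.

(** A product over a set of bins is the indicator of a box that leaves the other coordinates free.
    Singletons and pairs give the means and covariances that Chebyshev's inequality uses. *)
Let xi_prod (Q : probability RN R) (D : {set 'I_N}) :
  \int[kimage (mech_kerN response) Q]_y (\prod_(j in D) xi j y) =
  \int[Q]_x (\prod_(j in D) prob (tnth x j)).
Proof.
pose A (j : 'I_N) : set (mech_out (response j)) := if j \in D then [set true] else setT.
have mA j : measurable (A j) by [].
have mB := measurable_box (Y := fun i => mech_out (response i)) mA.
transitivity (fine (kimage (mech_kerN response) Q
    [set y : mech_outN response | forall i, A i (y i)])).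
  rewrite -bm_int_indic//; apply: eq_Rintegral => y _; rewrite indicE.
  have [/set_mem/= h|h] := boolP (y \in _).
    by apply: big1 => j jD; have := h j; rewrite /A jD /xi /= => ->.
  have [j [jD yj]] : exists j, j \in D /\ (y j : bool) = false.
    apply: contrapT => hh; move/negP: h; apply; apply/mem_set => j /=.
    rewrite /A; case: ifPn => // jD; case E : (y j : bool) => //=.
    by exfalso; apply: hh; exists j.
  by rewrite (bigD1 j)//= /xi yj mul0r.
rewrite (kimage_fprod_kernel_box (fun i => mech_ker (response i)) Q mA).
rewrite /Rintegral; congr fine; apply: eq_integral => x _.
rewrite -prodEFin [RHS]big_mkcond /=; apply: eq_bigr => j _.
rewrite (response_kernelE alpha0 (measurable_sqr_gt c0)) /A; case: (j \in D).
  by rewrite !diracE mem_set// memNset//= mule1 mule0 adde0.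
by rewrite !diracT !mule1 -EFinD addrC subrK.
Qed.

Variables (f : R -> R) (Q : probability RN R).
Hypothesis lawQ : freq_law f Q.
Let psi (j : 'I_N) := fine (gauss_law 0 (local_mean f j) S).
Let pi_ (j : 'I_N) := (1 + beta * psi j) / 2.

Let ind (j : 'I_N) (x : RN) : R := \1_S (tnth x j).

Let bind j : bounded_measurable (ind j).
Proof.
apply: bm_comp (bm_indic R (measurable_sqr_gt c0)); exact: measurable_tnth.
Qed.

Let ind_prod (D : {set 'I_N}) :
  (forall j, j \in D -> gauss_law 0 (local_mean f j) S \is a fin_num) ->
  \int[Q]_x (\prod_(j in D) ind j x) = \prod_(j in D) psi j.
Proof.
move=> finD.
pose A (j : 'I_N) : set (measurableTypeR R) := if j \in D then S else setT.
have mA j : measurable (A j) by rewrite /A; case: ifP => // _; exact: measurable_sqr_gt.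
have mB : measurable [set x : RN | forall j, A j (tnth x j)].
  rewrite (_ : mkset _ = \bigcap_(j in [set: 'I_N]) (fun x : RN => tnth x j) @^-1` A j).
    apply: fin_bigcap_measurable => // j _.
    by rewrite -[X in measurable X]setTI; exact: measurable_tnth.
  by apply/seteqP; split => x /= h j; [move=> _; exact: h|exact: h].
transitivity (fine (Q [set x : RN | forall j, A j (tnth x j)])).
  rewrite -bm_int_indic//; apply: eq_Rintegral => x _; rewrite indicE.
  have [/set_mem/= h|h] := boolP (x \in _).
    by apply: big1 => j jD; have := h j; rewrite /A jD /ind indicE => hj; rewrite mem_set.
  have [j [jD xj]] : exists j, j \in D /\ ~ S (tnth x j).
    apply: contrapT => hh; move/negP: h; apply; apply/mem_set => j /=.
    rewrite /A; case: ifPn => // jD; apply: contrapT => hS.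
    by apply: hh; exists j.
  by rewrite (bigD1 j)//= /ind indicE memNset// mul0r.
rewrite lawQ// (eq_bigr (fun j => (if j \in D then psi j else 1)%:E)); last first.
  move=> j _; rewrite /A; case: ifPn => jD; last exact: gauss_law_setT.
  by rewrite fineK// finD.
by rewrite prodEFin /= -big_mkcond.
Qed.

Variable J : {set 'I_N}.
(** [psi] is read off with [fine]. Finiteness is asked on J only, where the means imposed in
    [freq_bound] are positive and the Gaussian law is a genuine measure. *)
Hypothesis finJ : forall j, j \in J -> gauss_law 0 (local_mean f j) S \is a fin_num.

Let probE j x : prob (tnth x j) = (1 + beta * ind j x) / 2.
Proof. by []. Qed.

Let ind1 j : j \in J -> \int[Q]_x ind j x = psi j.
Proof.
move=> jJ; have := @ind_prod [set j].
rewrite big_set1; under eq_Rintegral do rewrite big_set1.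
by apply => i; rewrite inE => /eqP ->; exact: finJ.
Qed.

Let ind2 i j : i \in J -> j \in J -> i != j ->
  \int[Q]_x (ind i x * ind j x) = psi i * psi j.
Proof.
move=> iJ jJ ij; have := @ind_prod [set i; j].
have jni : i \notin [set j]%SET by rewrite inE.
rewrite big_setU1//= big_set1; under eq_Rintegral do rewrite big_setU1//= big_set1.
by apply => k; rewrite !inE => /orP[]/eqP ->; exact: finJ.
Qed.

Lemma response_mean j : j \in J ->
  \int[kimage (mech_kerN response) Q]_y xi j y = pi_ j.
Proof.
move=> jJ; have := @xi_prod Q [set j].
rewrite (_ : (fun y => \prod_(j0 in [set j]%SET) xi j0 y) = xi j); last first.
  by apply/funext => y; rewrite big_set1.
move=> ->; transitivity (\int[Q]_x (2^-1 + beta / 2 * ind j x)).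
  by apply: eq_Rintegral => x _; rewrite big_set1 probE; field.
rewrite bm_intD; [|exact: bm_cst|exact: bmZ].
by rewrite bm_int_cst bm_intZ// ind1// /pi_; field.
Qed.

Lemma response_cov i j : i \in J -> j \in J -> i != j ->
  \int[kimage (mech_kerN response) Q]_y (xi i y * xi j y) = pi_ i * pi_ j.
Proof.
move=> iJ jJ ij; have := @xi_prod Q [set i; j].
have jni : i \notin [set j]%SET by rewrite inE.
rewrite (_ : (fun y => \prod_(j0 in [set i; j]%SET) xi j0 y) = fun y => xi i y * xi j y); last first.
  by apply/funext => y; rewrite big_setU1//= big_set1.
move=> ->; transitivity (\int[Q]_x (4^-1 + (beta / 4 * ind i x + (beta / 4 * ind j x +
    beta ^+ 2 / 4 * (ind i x * ind j x))))).
  by apply: eq_Rintegral => x _; rewrite big_setU1//= big_set1 !probE; field.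
have b1 : bounded_measurable (fun x => beta ^+ 2 / 4 * (ind i x * ind j x)).
  by apply: bmZ; exact: bmM.
have b2 : bounded_measurable (fun x => beta / 4 * ind j x +
    beta ^+ 2 / 4 * (ind i x * ind j x)) by apply: bmD => //; exact: bmZ.
rewrite bm_intD; [|exact: bm_cst|by apply: bmD => //; exact: bmZ].
rewrite bm_intD//; last exact: bmZ.
rewrite bm_intD//; last exact: bmZ.
have e0 : \int[Q]_x (4^-1 : R) = 4^-1 by exact: bm_int_cst.
have e1 := bm_intZ Q (beta / 4) (bind i).
have e2 := bm_intZ Q (beta / 4) (bind j).
have e3 := bm_intZ Q (beta ^+ 2 / 4) (bmM (bind i) (bind j)).
rewrite (ind1 iJ) in e1; rewrite (ind1 jJ) in e2; rewrite (ind2 iJ jJ ij) in e3.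
rewrite e0 e1 e2 e3 /pi_.
move: (psi i) (psi j) beta => a b c; by field.
Qed.

End freq_side.

Section freq_side_test.
Context (R : realType) (N : nat) (alpha : R).
Hypothesis alpha0 : 0 < alpha.
Variables (c0 eta : R) (f0 f1 : R -> R).
Variables (Q0 Q1 : probability (N.-tuple (measurableTypeR R)) R).
Hypothesis law0 : freq_law f0 Q0.
Hypothesis law1 : freq_law f1 Q1.
Hypothesis c00 : 0 < c0.
Hypothesis eta01 : 0 < eta <= 1.
Variable J : {set 'I_N}.
Hypothesis J0 : (0 < #|J|)%N.
Hypothesis J_mean0 : forall j, j \in J -> local_mean f0 j = c0.
Hypothesis J_mean1 : forall j, j \in J -> c0 * (1 + eta) <= local_mean f1 j.
Local Notation p := (@normal_pdf R 0 1).
Local Notation S := [set x : measurableTypeR R | c0 < x ^+ 2].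

Lemma freq_bound : exists A : set (mech_outN (@response R N alpha alpha0 c0)), measurable A /\
  1 - 2 / (#|J|%:R * ((1 - expR (- alpha)) * (p 1 * (eta / 8))) ^+ 2) <=
  fine (kimage (mech_kerN (@response R N alpha alpha0 c0)) Q1 A) -
  fine (kimage (mech_kerN (@response R N alpha alpha0 c0)) Q0 A).
Proof.
have /andP[e0 e1] := eta01.
have fin v : 0 <= v -> gauss_law 0 v S \is a fin_num.
  move=> v0; rewrite gauss_lawE//; last exact: measurable_sqr_gt.
  apply: fin_num_measure; rewrite -[X in measurable X]setTI.
  exact: (measurable_affine 0 (Num.sqrt v) measurableT (measurable_sqr_gt c0)).
have fin0 j : j \in J -> gauss_law 0 (local_mean f0 j) S \is a fin_num.
  by move=> jJ; apply: fin; rewrite J_mean0// ltW.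
have fin1 j : j \in J -> gauss_law 0 (local_mean f1 j) S \is a fin_num.
  move=> jJ; apply: fin; apply: le_trans (J_mean1 jJ).
  by rewrite mulr_ge0 ?ltW// ltr_wpDr// ltW.
have b0 : 0 < 1 - expR (- alpha) by rewrite subr_gt0 -expR0 ltr_expR oppr_lt0.
apply: (count_test (xi := fun j (y : mech_outN (@response R N alpha alpha0 c0)) => (y j : bool)%:R : R)
  (p0 := fun j => (1 + (1 - expR (- alpha)) * fine (gauss_law 0 (local_mean f0 j) S)) / 2)
  (p1 := fun j => (1 + (1 - expR (- alpha)) * fine (gauss_law 0 (local_mean f1 j) S)) / 2)) => //.
- move=> j; split; last by exists 1 => y; case: (y j : bool); rewrite ?normr1 ?normr0.
  have mb : measurable_fun setT (fun b : bool => (b%:R : R)) by [].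
  exact: (measurableT_comp mb (measurable_fproj j)).
- by move=> j y; case: (y j : bool); rewrite ?expr1n ?expr0n.
- by move=> j jJ; exact: (response_mean alpha0 law0 fin0).
- by move=> i j iJ jJ ij; exact: (response_cov alpha0 law0 fin0).
- by move=> j jJ; exact: (response_mean alpha0 law1 fin1).
- by move=> i j iJ jJ ij; exact: (response_cov alpha0 law1 fin1).
- by rewrite mulr_gt0// mulr_gt0 ?divr_gt0// std_normal_pdfE mulr_gt0 ?normal_peak_gt0 ?expR_gt0.
(* The tail gap p 1 (eta / 4) is damped by the slope (1 - exp (-alpha)) / 2 of the randomized
   response, whence eta / 8. *)
- move=> j jJ; have := gauss_tail c00 eta01 (J_mean1 jJ).
  have H (u v q b : R) : 0 < b -> u + q * (eta / 4) <= v ->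
    (1 + b * u) / 2 + b * (q * (eta / 8)) <= (1 + b * v) / 2 by move=> ? ?; nra.
  by rewrite (J_mean0 jJ); exact: H b0.
Qed.

End freq_side_test.

(** * Cosine spectral densities *)

Section cosine_density.
Context (R : realType).
Local Notation mu := (@lebesgue_measure R).
Local Notation I0 := (`[- pi, pi]%classic : set R).

Lemma sin_int_pi (k : int) : sin (k%:~R * pi) = 0 :> R.
Proof.
have H (n : nat) : sin (n%:R * pi) = 0 :> R.
  elim: n => [|n IH]; first by rewrite mul0r sin0.
  by rewrite -addn1 natrD mulrDl mul1r sinD IH sinpi mul0r mulr0 addr0.
by case: k => n; rewrite ?NegzE ?mulrNz ?mulNr ?sinN ?H ?oppr0.
Qed.

Lemma continuous_cosZ (k : R) : continuous (fun x : R => cos (k * x)).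
Proof.
move=> x; apply: continuous_comp; last exact: continuous_cos.
by apply: cvgM => //; exact: cvg_cst.
Qed.

Lemma compact_itv_integrable (f : R -> R) (a b : R) :
  continuous f -> mu.-integrable `[a, b] (EFin \o f).
Proof.
move=> cf; apply: continuous_compact_integrable; first exact: segment_compact.
exact: continuous_subspaceT.
Qed.

Lemma Rintegral_itv_cst (a b r : R) : a <= b -> \int[mu]_(x in `[a, b]) r = r * (b - a).
Proof.
move=> ab; rewrite Rintegral_cst//=.
rewrite lebesgue_measure_itv /= lte_fin; case: ltP => h //=.
by have -> : a = b; [apply/eqP; rewrite eq_le ab h|rewrite subrr].
Qed.

Lemma Rintegral_cos (k : int) :
  \int[mu]_(x in `[- pi, pi]) cos (k%:~R * x) = if k == 0 then 2 * pi else 0 :> R.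
Proof.
have pi0 := pi_gt0 R.
have [->|k0] := eqVneq k 0.
  under eq_Rintegral do rewrite mul0r cos0.
  by rewrite Rintegral_itv_cst ?mul1r; lra.
have k0' : k%:~R != 0 :> R by rewrite intr_eq0.
pose F (x : R) := sin (k%:~R * x) / k%:~R.
have dF (x : R) : is_derive x 1 F (cos (k%:~R * x)).
  have h : is_derive x 1 (fun x : R => k%:~R * x) k%:~R.
    by apply: is_derive_eq; rewrite scaler1.
  have g := is_derive1_comp (is_derive_sin (k%:~R * x)) h.
  have g' := is_deriveM g (is_derive_cst (k%:~R^-1 : R) x 1).
  apply: is_derive_eq g' _; rewrite /= scaler0 add0r /GRing.scale /=; by field.
have cF : continuous F.
  move=> x; have [d _] := dF x.
  apply: differentiable_continuous; exact/derivable1_diffP.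
have ab : - pi < pi :> R by lra.
rewrite /Rintegral (@continuous_FTC2 _ (fun x => cos (k%:~R * x)) F)//.
- by rewrite /F mulrN sinN sin_int_pi mul0r oppr0 mul0r -EFinB subrr.
- by apply: continuous_subspaceT; exact: continuous_cosZ.
- split; first by move=> x _; have [] := dF x.
  + by apply: cvg_at_right_filter; exact: cF.
  + by apply: cvg_at_left_filter; exact: cF.
- by move=> x _; rewrite derive1E; have [_ ->] := dF x.
Qed.

Variables (c d : R).
Definition cosine_density (x : R) := c * (1 + d * cos x).

Lemma continuous_cosine_density : continuous cosine_density.
Proof.
move=> x; apply: cvgM; first exact: cvg_cst.
apply: cvgD; first exact: cvg_cst.
by apply: cvgM; [exact: cvg_cst|exact: continuous_cos].
Qed.

Lemma autocov_cosine_density (h : int) :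
  autocov cosine_density h =
  c * (if h == 0 then 2 * pi else 0) + c * d / 2 *
  ((if h + 1 == 0 then 2 * pi else 0) + (if h - 1 == 0 then 2 * pi else 0)).
Proof.
have i k : mu.-integrable I0 (EFin \o (fun x : R => cos (k * x))).
  by apply: compact_itv_integrable; exact: continuous_cosZ.
have cc k : continuous (fun x : R => cos (k * x)) by exact: continuous_cosZ.
rewrite /autocov -!Rintegral_cos.
transitivity (\int[mu]_(x in I0) (c * cos (h%:~R * x) + c * d / 2 *
    (cos ((h + 1)%:~R * x) + cos ((h - 1)%:~R * x)))).
  apply: eq_Rintegral => x _; rewrite /cosine_density.
  rewrite !rmorphD/= rmorphN/= !mulrDl mulN1r mul1r cosB cosD; by field.
have cD : continuous (fun x : R => cos ((h + 1)%:~R * x) + cos ((h - 1)%:~R * x)).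
  by move=> x; apply: cvgD; exact: cc.
rewrite RintegralD//; last 2 first.
- apply: compact_itv_integrable => x; apply: cvgM; [exact: cvg_cst|exact: cc].
- apply: compact_itv_integrable => x; apply: cvgM; [exact: cvg_cst|exact: cD].
by rewrite !RintegralZl// ?RintegralD//; exact: compact_itv_integrable.
Qed.

Lemma autocov_cosine_density0 : autocov cosine_density 0 = 2 * pi * c.
Proof. rewrite autocov_cosine_density /=; by field. Qed.

Lemma autocov_cosine_density1 : autocov cosine_density 1 = pi * c * d.
Proof. rewrite autocov_cosine_density /=; by field. Qed.

Lemma autocov_cosine_density_ge2 (n : nat) : (1 < n)%N -> autocov cosine_density n = 0.
Proof.
move=> n1; rewrite autocov_cosine_density.
have -> : (n%:Z == 0) = false by apply/negbTE; lia.
have -> : (n%:Z + 1 == 0) = false by apply/negbTE; lia.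
have -> : (n%:Z - 1 == 0) = false by apply/negbTE; lia.
by rewrite addr0 !mulr0 addr0.
Qed.

Lemma autocov_cosine_densityN1 : autocov cosine_density (-1) = pi * c * d.
Proof. rewrite autocov_cosine_density /=; by field. Qed.

Lemma autocov_cosine_density_eq0 (h : int) : h != 0 -> h != 1 -> h != -1 ->
  autocov cosine_density h = 0.
Proof.
move=> h0 h1 hN1; rewrite autocov_cosine_density.
by rewrite (negbTE h0) subr_eq0 (negbTE h1) addr_eq0 (negbTE hN1) addr0 !mulr0 addr0.
Qed.

(** Only lags 1 and -1 carry correlation, namely d / 2, and their Sobolev weight is 1, so the sum
    over lags is d^2 / 2. The density is smallest where the cosine is -1, which gives c (1 - d). *)
Lemma cosine_density_class (M s : R) : 0 < c -> 0 <= d <= 1 -> 0 < M -> M^-1 <= c * (1 - d) ->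
  (2 * pi * c) ^+ 2 * (1 + d ^+ 2 / 2) <= M -> sobolev_class M s cosine_density.
Proof.
move=> c0 /andP[d0 d1] M0 Mc cM; have pi0 := pi_gt0 R.
have lb x : M^-1 <= cosine_density x.
  by apply: (le_trans Mc); rewrite /cosine_density ler_wpM2l ?(ltW c0)// lerD2l -mulrN1 ler_wpM2l ?cos_geN1.
split; first split.
- by move=> x _; apply: le_trans (lb x); rewrite invr_ge0 ltW.
- by move=> x _; rewrite /cosine_density cosN.
- by apply: compact_itv_integrable; exact: continuous_cosine_density.
- by move=> x _; exact: lb.
set F : int -> \bar R := fun h => _.
have F0 h : (0 <= F h)%E by rewrite lee_fin mulr_ge0 ?powR_ge0 ?exprn_ge0.
have ratio (p : R) : 0 < p -> p * c * d / (2 * p * c) = d / 2.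
  by move=> p0; field; rewrite !gt_eqF.
have ac1 : autocorr cosine_density 1 = d / 2.
  by rewrite /autocorr autocov_cosine_density1 autocov_cosine_density0 ratio.
have acN1 : autocorr cosine_density (-1) = d / 2.
  by rewrite /autocorr autocov_cosine_densityN1 autocov_cosine_density0 ratio.
have FE h : h = 1 \/ h = -1 -> F h = (d ^+ 2 / 4)%:E.
  have d2 : 0 <= d / 2 by rewrite divr_ge0.
  case=> ->; rewrite /F ?ac1 ?acN1 ?rmorphN /= ?normrN normr1 powR1 mul1r (ger0_norm d2);
    congr EFin; by field.
have -> : \esum_(h in [set h : int | h != 0]) F h = (d ^+ 2 / 2)%:E.
  rewrite (esumID [set 1])// (_ : _ `&` _ = [set 1]); last first.
    by apply/seteqP; split=> h /=; [case|move=> ->].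
  rewrite esum_set1// (esumID [set -1])// (_ : _ `&` [set -1] = [set -1]); last first.
    by apply/seteqP; split=> h /=; [case|move=> ->; split].
  rewrite esum_set1// esum1 ?adde0.
    by rewrite !FE; [rewrite -EFinD; congr EFin; field|right|left].
  move=> h [[/= h0 /eqP h1] /eqP hN1].
  by rewrite /F /autocorr autocov_cosine_density_eq0// mul0r normr0 expr0n/= mulr0.
by rewrite -EFinD -EFinM lee_fin autocov_cosine_density0.
Qed.

End cosine_density.

Section local_mean_cosine.
Context (R : realType) (N : nat) (c d : R).
Local Notation mu := (@lebesgue_measure R).

Lemma periodic_ext_id (f : R -> R) x : - pi <= x < pi -> periodic_ext f x = f x.
Proof.
move=> /andP[x1 x2]; have pi0 := pi_gt0 R; have p2 : 0 < 2 * pi :> R by lra.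
rewrite /periodic_ext (_ : Num.floor _ = 0) ?mulr0 ?subr0//.
apply: floor_def; rewrite add0r mulr0z mulr1z divr_ge0 ?ltr_pdivrMr//=; lra.
Qed.

Let mean_cst (n p k : R) : 0 < n -> 0 < p -> n / (2 * p) * (k * (2 * p / n)) = k.
Proof. by move=> n0 p0; field; rewrite !gt_eqF. Qed.

Let bin_width (n x p : R) : 2 * (x + 1) * p / n - 2 * x * p / n = 2 * p / n.
Proof. ring. Qed.

Lemma local_mean_cosine0 (j : 'I_N) : local_mean (cosine_density c 0) j = c.
Proof.
have pi0 := pi_gt0 R; have N0 : 0 < N%:R :> R by rewrite ltr0n (leq_ltn_trans _ (ltn_ord j)).
rewrite /local_mean (_ : periodic_ext _ = fun=> c); last first.
  by apply/funext => x; rewrite /periodic_ext /cosine_density mul0r addr0 mulr1.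
rewrite Rintegral_itv_cst.
  by rewrite -(natr1 j) bin_width mean_cst.
by rewrite ler_wpM2r ?invr_ge0 ?(ltW N0)// ler_wpM2r ?(ltW pi0)// ler_wpM2l// ler_nat.
Qed.

(** The condition on j places the right end of the bin, 2 (j + 1) pi / N, at or below pi / 4, and
    the cosine decreases on the bin. *)
Lemma local_mean_cosine_ge (j : 'I_N) : 0 < c -> 0 <= d -> (8 * j.+1 <= N)%N ->
  c * (1 + d * cos (pi / 4)) <= local_mean (cosine_density c d) j.
Proof.
move=> c0 d0 jN.
have pi0 := pi_gt0 R; have N0 : 0 < N%:R :> R by rewrite ltr0n (leq_ltn_trans _ (ltn_ord j)).
pose a : R := 2 * j%:R * pi / N%:R; pose b : R := 2 * j.+1%:R * pi / N%:R.
have a0 : 0 <= a by rewrite /a divr_ge0 ?(ltW N0)// mulr_ge0 ?(ltW pi0)// mulr_ge0.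
have ab : a <= b.
  by rewrite ler_wpM2r ?invr_ge0 ?(ltW N0)// ler_wpM2r ?(ltW pi0)// ler_wpM2l// ler_nat.
have b4 : b <= pi / 4.
  rewrite /b ler_pdivrMr//.
  have : (8 * j.+1)%:R <= N%:R :> R by rewrite ler_nat.
  by rewrite natrM; nra.
have ba : b - a = 2 * pi / N%:R by rewrite /a /b -(natr1 j) bin_width.
set k := c * (1 + d * cos (pi / 4)).
have -> : k = N%:R / (2 * pi) * (k * (b - a)) by rewrite ba mean_cst.
rewrite /local_mean -/a -/b ler_wpM2l//; first by rewrite divr_ge0 ?(ltW N0)// mulr_ge0 ?(ltW pi0).
rewrite -Rintegral_itv_cst//.
rewrite [leRHS](_ : _ = \int[mu]_(x in `[a, b]) cosine_density c d x); last first.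
  apply: eq_Rintegral => x /[!inE] /=; rewrite in_itv/= => /andP[ax xb].
  by apply: periodic_ext_id; apply/andP; split; lra.
apply: le_Rintegral => //.
- by apply: compact_itv_integrable => x; exact: cvg_cst.
- by apply: compact_itv_integrable; exact: continuous_cosine_density.
move=> x /=; rewrite in_itv/= => /andP[ax xb].
rewrite /k /cosine_density ler_wpM2l ?(ltW c0)// lerD2l ler_wpM2l//.
rewrite leNgt ltr_cos ?in_itv/= -?leNgt; last 2 first.
- by apply/andP; split; lra.
- by apply/andP; split; lra.
lra.
Qed.

End local_mean_cosine.

(** * Data processing and the two-point bound *)

Section layers.
Variable R : realType.

(** A layer-cake count of the integer levels 1, ..., n below y. It lies within 1 of y for 0 <= y <=
    n + 1 and turns a function into a sum of indicators of superlevel sets. *)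
Definition layers (n : nat) (y : R) : R := \sum_(k < n) (k.+1%:R <= y)%R%:R.

Let layers_le_size n y : layers n y <= n%:R.
Proof.
rewrite -[n in leRHS]card_ord -sumr_const; apply: ler_sum => k _.
by rewrite lern1 leq_b1.
Qed.

Lemma layers_le n y : 0 <= y -> layers n y <= y.
Proof.
move=> y0; elim: n => [|n IH]; first by rewrite /layers big_ord0.
rewrite /layers big_ord_recr /=; case: (leP n.+1%:R y) => h; last by rewrite addr0.
by apply: le_trans h; rewrite -natr1 lerD2r; exact: layers_le_size.
Qed.

Lemma le_layers n y : y <= n.+1%:R -> y <= layers n y + 1.
Proof.
elim: n => [|n IH] yn; first by rewrite /layers big_ord0 add0r.
have [h|h] := leP n.+1%:R y; last first.
  apply: (le_trans (IH (ltW h))); rewrite lerD2r /layers big_ord_recr /=.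
  by rewrite lerDl.
rewrite /layers (eq_bigr (fun=> 1)); first by rewrite sumr_const card_ord natr1.
by move=> k _; rewrite (le_trans _ h)// ler_nat.
Qed.

End layers.

Section data_processing.
Context (R : realType) d (T : measurableType d) (mu0 mu1 : probability T R) (t : R).
Hypothesis t0 : 0 <= t.
Hypothesis mu_le : forall A, measurable A -> fine (mu1 A) - fine (mu0 A) <= t.

(** A test function with values in [0, 1] separates no better than sets: (n + 1) h is a sum of n
    indicators up to an error of 1, so the bound holds up to 1 / (n + 1). *)
Lemma bm_int_diff_le (h : T -> R) : bounded_measurable h -> (forall x, 0 <= h x <= 1) ->
  \int[mu1]_x h x - \int[mu0]_x h x <= t.
Proof.
move=> bh h01.
have step (n : nat) : \int[mu1]_x h x - \int[mu0]_x h x <= t + n.+1%:R^-1.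
  pose g x := n.+1%:R * h x.
  have bg : bounded_measurable g by exact: bmZ.
  pose S (k : 'I_n) := [set x | k.+1%:R <= g x].
  have mS k : measurable (S k).
    rewrite -[X in measurable X]setTI; have [mg _] := bg.
    by have := mg measurableT _ (measurable_itv `[k.+1%:R, +oo[%R); congr measurable;
      apply/seteqP; split => y /=; rewrite in_itv/= andbT.
  have gE x : layers n (g x) = \sum_(k < n) \1_(S k) x.
    apply: eq_bigr => k _; rewrite indicE; congr (_%:R).
    by congr nat_of_bool; apply/idP/idP => [/mem_set|/set_mem].
  have g0 x : 0 <= g x by have /andP[h0 _] := h01 x; rewrite mulr_ge0.
  have gn x : g x <= n.+1%:R by have /andP[_ h1] := h01 x; rewrite -[leRHS]mulr1 ler_wpM2l.
  have bL : bounded_measurable (fun x => \sum_(k < n) \1_(S k) x : R).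
    by apply: bm_sum => k; exact: bm_indic.
  have bL1 : bounded_measurable (fun x => \sum_(k < n) \1_(S k) x + 1 : R).
    by apply: bmD => //; exact: bm_cst.
  have intL (mu : probability T R) :
      \int[mu]_x (\sum_(k < n) \1_(S k) x) = \sum_(k < n) fine (mu (S k)).
    rewrite bm_int_sum; last by move=> k; exact: bm_indic.
    by apply: eq_bigr => k _; rewrite bm_int_indic.
  have up : \int[mu1]_x g x <= \sum_(k < n) fine (mu1 (S k)) + 1.
    apply: (@le_trans _ _ (\int[mu1]_x (\sum_(k < n) \1_(S k) x + 1))).
      by apply: bm_int_le => // x; rewrite -gE; exact: le_layers.
    by rewrite bm_intD ?intL ?bm_int_cst//; exact: bm_cst.
  have lo : \sum_(k < n) fine (mu0 (S k)) <= \int[mu0]_x g x.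
    by rewrite -intL; apply: bm_int_le => // x; rewrite -gE; exact: layers_le.
  have df : \sum_(k < n) fine (mu1 (S k)) - \sum_(k < n) fine (mu0 (S k)) <= n%:R * t.
    rewrite -sumrB -[n in leRHS]card_ord mulr_natl -sumr_const.
    by apply: ler_sum => k _; exact: mu_le.
  rewrite !bm_intZ// in up lo.
  have n0 : 0 < n.+1%:R :> R by rewrite ltr0n.
  rewrite -(ler_pM2l n0) mulrBr mulrDr mulfV ?gt_eqF//.
  have : n%:R * t <= n.+1%:R * t by rewrite ler_wpM2r// ler_nat.
  lra.
apply/ler_addgt0Pr => e e0; have [n _ ne] := near_infty_natSinv_lt (PosNum e0).
by apply: (le_trans (step n)); rewrite lerD2l; exact: (ltW (ne n (leqnn n))).
Qed.

End data_processing.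

Lemma kimage_diff_le (R : realType) d d' (X : measurableType d) (Y : measurableType d')
    (L : R.-pker X ~> Y) (mu0 mu1 : probability X R) (t : R) : 0 <= t ->
  (forall A, measurable A -> `|fine (mu1 A) - fine (mu0 A)| <= t) ->
  forall B, measurable B -> `|fine (kimage L mu1 B) - fine (kimage L mu0 B)| <= t.
Proof.
move=> t0 H B mB.
have Lfin x : L x B \is a fin_num.
  by rewrite ge0_fin_numE// (@le_lt_trans _ _ 1%E) ?ltry//; exact: pker_le1.
have h01 x : 0 <= fine (L x B) <= 1.
  rewrite fine_ge0//= -lee_fin fineK; first exact: pker_le1.
  exact: Lfin.
have bh : bounded_measurable (fun x => fine (L x B)).
  split; last by exists 1 => x; have /andP[h0 h1] := h01 x; rewrite ger0_norm.
  apply: measurableT_comp => //; exact: measurable_kernel.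
have E (mu : probability X R) : fine (kimage L mu B) = \int[mu]_x fine (L x B).
  congr fine; apply: eq_integral => x _.
  by rewrite fineK.
rewrite ler_norml lerNl opprB !E; apply/andP; split.
  apply: bm_int_diff_le => // A /H; by rewrite distrC => /(le_trans (ler_norm _)).
by apply: bm_int_diff_le => // A /H /(le_trans (ler_norm _)).
Qed.

Section two_points.
Context (R : realType) (N : nat) (alpha : R) (I : Type) (G : set I).
Local Notation RN := (N.-tuple (measurableTypeR R)).
Variables (P Q : I -> probability RN R) (f0 f1 : I).
Hypothesis Gf0 : G f0.
Hypothesis Gf1 : G f1.

(** Testing both sides on the same event A, the probabilities in the target model differ by at least
    r and those of the simulation by at most t. The discrepancy r - t must be shared between f0 and
    f1, so one of them carries half of it. *)
Lemma ldp_deficiency_ge (K : 'I_N -> ldp_mechanism alpha) (A : set (mech_outN K)) (r t : R) :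
  measurable A ->
  r <= fine (kimage (mech_kerN K) (Q f1) A) - fine (kimage (mech_kerN K) (Q f0) A) ->
  0 <= t ->
  (forall (K' : 'I_N -> ldp_mechanism alpha) (B : set (mech_outN K')), measurable B ->
    `|fine (kimage (mech_kerN K') (P f1) B) - fine (kimage (mech_kerN K') (P f0) B)| <= t) ->
  (((r - t) / 2)%:E <= ldp_deficiency alpha G P Q)%E.
Proof.
move=> mA hr t0 ht.
apply: le_ereal_sup_tmp; eexists; first by exists K.
apply: le_ereal_inf_tmp => _ [K' [L ->]].
have hL := kimage_diff_le L t0 (ht K') mA.
set p := fun f => fine (kimage L (kimage (mech_kerN K') (P f)) A).
set q := fun f => fine (kimage (mech_kerN K) (Q f) A).
have tvE f : (`|p f - q f|%:E <=
    tv_dist (kimage L (kimage (mech_kerN K') (P f))) (kimage (mech_kerN K) (Q f)))%E.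
  apply: ereal_sup_ubound; exists A => //.
  by rewrite /p /q -abse_EFin EFinB !fineK// fin_num_measure.
have [h|h] := lerP ((r - t) / 2) `|p f0 - q f0|.
  apply: le_ereal_sup_tmp; exists (tv_dist (kimage L (kimage (mech_kerN K') (P f0)))
    (kimage (mech_kerN K) (Q f0))); first by exists f0.
  by apply: le_trans (tvE f0); rewrite lee_fin.
apply: le_ereal_sup_tmp; exists (tv_dist (kimage L (kimage (mech_kerN K') (P f1)))
  (kimage (mech_kerN K) (Q f1))); first by exists f1.
apply: le_trans (tvE f1); rewrite lee_fin.
have h0 := ler_norm (p f0 - q f0).
have h1 := ler_norm (- (p f1 - q f1)); rewrite normrN in h1.
have h2 : p f1 - p f0 <= t := le_trans (ler_norm _) hL.
have h3 : r <= q f1 - q f0 := hr.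
lra.
Qed.

End two_points.

Section time_tv.
Context (R : realType) (N : nat) (alpha c d : R).
Variables P0 P1 : probability (N.+1.-tuple (measurableTypeR R)) R.
Hypothesis c0 : 0 < c.
Hypothesis d01 : 0 <= d <= 1.
Hypothesis law0 : time_law (cosine_density c 0) P0.
Hypothesis law1 : time_law (cosine_density c d) P1.
Hypothesis alpha0 : 0 <= alpha.
Local Notation B := (expR alpha - 1).
Hypothesis B2 : B ^+ 2 <= 2^-1.
Variable t : R.
Hypothesis t0 : 0 < t.
Hypothesis tN : (1 + 2 * (B ^+ 2 * d ^+ 2) * B ^+ 2) ^+ N.+1 - 1 <= t ^+ 2.

(* [cosine_density c d] is the spectral density of the moving average
   sg (u e_i + v e_(i-1)) with u^2 + v^2 = 1 and 2 u v = d. *)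
Lemma time_cosine_bound (K : 'I_N.+1 -> ldp_mechanism alpha) (A : set (mech_outN K)) :
  measurable A ->
  `|fine (kimage (mech_kerN K) P1 A) - fine (kimage (mech_kerN K) P0 A)| <= t.
Proof.
have /andP[d0 d1] := d01; have pi0 := pi_gt0 R.
(* These are u + v and u - v, since u^2 + v^2 = 1 and 2 u v = d mean (u + v)^2 = 1 + d and (u - v)^2
   = 1 - d. *)
pose a : R := Num.sqrt (1 + d); pose b : R := Num.sqrt (1 - d).
have a0 : 0 < a by rewrite sqrtr_gt0; lra.
have b0 : 0 <= b by exact: sqrtr_ge0.
have a2 : a ^+ 2 = 1 + d by rewrite sqr_sqrtr//; lra.
have b2 : b ^+ 2 = 1 - d by rewrite sqr_sqrtr//; lra.
pose u := (a + b) / 2; pose v := (a - b) / 2.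
have u0 : 0 < u by rewrite divr_gt0// ltr_wpDr.
have uv1 : u ^+ 2 + v ^+ 2 = 1.
  have -> : u ^+ 2 + v ^+ 2 = (a ^+ 2 + b ^+ 2) / 2 by rewrite /u /v; field.
  by rewrite a2 b2; field.
have uv : u * v = d / 2.
  have -> : u * v = (a ^+ 2 - b ^+ 2) / 4 by rewrite /u /v; field.
  by rewrite a2 b2; field.
have u2 : 2^-1 <= u ^+ 2.
  have ab0 : 0 <= a * b by rewrite mulr_ge0// ltW.
  have -> : u ^+ 2 = (a ^+ 2 + b ^+ 2 + 2 * (a * b)) / 4 by rewrite /u; field.
  by rewrite a2 b2; lra.
(* Indeed v^2 / u^2 = d^2 / (4 u^4), and u^2 >= 1 / 2. *)
have vu : v ^+ 2 / u ^+ 2 <= d ^+ 2.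
  have u20 : 0 < u ^+ 2 by rewrite exprn_gt0.
  rewrite ler_pdivrMr//.
  have : u ^+ 2 * v ^+ 2 = d ^+ 2 / 4 by rewrite -exprMn uv; field.
  have := sqr_ge0 v; have := sqr_ge0 d; nra.
pose sg : R := Num.sqrt (2 * pi * c).
have sg2 : sg ^+ 2 = 2 * pi * c by rewrite sqr_sqrtr// mulr_ge0 ?ltW// mulr_gt0.
apply: (time_bound (sg := sg) u0 uv1 law0 law1) => //.
- by rewrite autocov_cosine_density0.
- case=> [//|[|n]] _; first by rewrite autocov_cosine_density1 mulr0.
  by rewrite autocov_cosine_density_ge2.
- by rewrite autocov_cosine_density0.
- rewrite autocov_cosine_density1 sg2 uv; move: (pi : R) => p; by field.
- by move=> n n1; rewrite autocov_cosine_density_ge2.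
apply: le_trans tN; rewrite lerD2r.
have B0 := sqr_ge0 B.
have nn w : 0 <= w -> 0 <= 1 + 2 * (B ^+ 2 * w) * B ^+ 2.
  by move=> w0; rewrite addr_ge0// mulr_ge0// mulr_ge0// mulr_ge0.
apply: lerXn2r; rewrite ?nnegrE ?nn ?sqr_ge0 ?divr_ge0 ?sqr_ge0//.
by rewrite lerD2l ler_wpM2r// ler_wpM2l// ler_wpM2l.
Qed.

End time_tv.

Section freq_tv.
Context (R : realType) (N : nat) (alpha c d : R).
Variables Q0 Q1 : probability (N.-tuple (measurableTypeR R)) R.
Hypothesis c0 : 0 < c.
Hypothesis d01 : 0 < d <= 1.
Hypothesis law0 : freq_law (cosine_density c 0) Q0.
Hypothesis law1 : freq_law (cosine_density c d) Q1.
Hypothesis alpha0 : 0 < alpha.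
Hypothesis N8 : (8 <= N)%N.
Local Notation p := (@normal_pdf R 0 1).

Lemma freq_cosine_bound : exists (K : 'I_N -> ldp_mechanism alpha) (A : set (mech_outN K)),
  measurable A /\
  1 - 32 / (N%:R * ((1 - expR (- alpha)) * (p 1 * (d * cos (pi / 4) / 8))) ^+ 2) <=
  fine (kimage (mech_kerN K) Q1 A) - fine (kimage (mech_kerN K) Q0 A).
Proof.
have /andP[d0 d1] := d01; have pi0 := pi_gt0 R.
have k0 : 0 < cos (pi / 4) :> R by apply: cos_gt0_pihalf; apply/andP; split; lra.
have k1 : cos (pi / 4) <= 1 :> R by exact: cos_le1.
pose J : {set 'I_N} := [set j : 'I_N | (8 * j.+1 <= N)%N]%SET.
(* J contains the first N %/ 8 bins, and N < 8 (N %/ 8 + 1) <= 16 (N %/ 8) because N >= 8. This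
   turns the 2 of [count_test] into 32. *)
have cJ : (N <= 16 * #|J|)%N.
  have le8 : (N %/ 8 <= N)%N by exact: leq_div.
  have inj : injective (widen_ord le8) by move=> x y /(congr1 val)/= /val_inj.
  have : (N %/ 8 <= #|J|)%N.
    rewrite -[leqLHS]card_ord -(card_imset _ inj).
    apply/subset_leq_card/fintype.subsetP => _ /imsetP[j _ ->].
    by rewrite inE /=; have := ltn_ord j; lia.
  lia.
have J0 : (0 < #|J|)%N by lia.
have e01 : 0 < d * cos (pi / 4) <= 1 by apply/andP; split; nra.
have [A [mA hA]] := freq_bound alpha0 law0 law1 c0 e01 J0
  (fun j _ => local_mean_cosine0 c j)
  (fun j jJ => @local_mean_cosine_ge R N c d j c0 (ltW d0) ltac:(by rewrite inE in jJ)).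
exists (@response R N alpha alpha0 c), A; split=> //; apply: le_trans hA.
rewrite lerD2l lerN2.
set e := _ ^+ 2.
have b0 : 0 < 1 - expR (- alpha) by rewrite subr_gt0 -expR0 ltr_expR oppr_lt0.
have e0 : 0 < e.
  rewrite exprn_gt0// mulr_gt0// mulr_gt0 ?divr_gt0// ?mulr_gt0//.
  by rewrite std_normal_pdfE mulr_gt0 ?normal_peak_gt0 ?expR_gt0.
have NJ : N%:R <= 16 * #|J|%:R :> R by rewrite -natrM ler_nat.
have n0 : 0 < N%:R :> R by rewrite ltr0n; lia.
have j0 : 0 < #|J|%:R :> R by rewrite ltr0n.
have H (n j x : R) : 0 < n -> 0 < j -> 0 < x -> n <= 16 * j -> 2 / (j * x) <= 32 / (n * x).
  move=> n' j' x' nj; rewrite ler_pdivrMr ?mulr_gt0// mulrAC ler_pdivlMr ?mulr_gt0//.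
  have : n * x <= 16 * j * x by rewrite ler_wpM2r// ltW.
  lra.
exact: H.
Qed.

End freq_tv.

Lemma limn_einf_ge (R : realType) (u : (\bar R)^nat) (l : \bar R) (n : nat) :
  (forall k, (n <= k)%N -> (l <= u k)%E) -> (l <= limn_einf u)%E.
Proof.
move=> lu; rewrite limn_einf_lim; apply: (@le_trans _ _ (einfs u n)).
  by apply: le_ereal_inf_tmp => _ [k /= nk <-]; exact: lu.
have -> : limn (einfs u) = ereal_sup (range (einfs u)).
  by apply/cvg_lim => //; exact: cvg_einfs_sup.
by apply: ereal_sup_ubound; exists n.
Qed.

(** * Elementary estimates, choice of the constants and conclusion *)

Section estimates.
Variable R : realType.

Lemma exprn_1D_le (x : R) (n : nat) : 0 <= x -> n%:R * x <= 2^-1 ->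
  (1 + x) ^+ n - 1 <= 2 * (n%:R * x).
Proof.
move=> x0; elim: n => [|n IH]; first by rewrite expr0 subrr mul0r mulr0.
rewrite -natr1 mulrDl mul1r exprSr => h.
have h' : n%:R * x <= 2^-1 by lra.
have {}IH := IH h'; have n0 : 0 <= n%:R * x by rewrite mulr_ge0.
have : (1 + x) ^+ n * (1 + x) <= (1 + 2 * (n%:R * x)) * (1 + x).
  by rewrite ler_wpM2r//; lra.
by move: h' n0; set y := n%:R * x => h' n0; nra.
Qed.

Lemma expR_sub1_le (a : R) : 0 <= a <= 2^-1 -> 0 <= expR a - 1 <= 2 * a.
Proof.
move=> /andP[a0 a1]; have e0 := expR_gt0 a.
have h := expR_ge1Dx a; have := expR_ge1Dx (- a).
have : expR a * expR (- a) = 1 by rewrite -expRD subrr expR0.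
move: (expR (- a)) (expR a) e0 h => u v v0 h vu h'.
have : v * (1 - a) <= 1 by rewrite -[leRHS]vu ler_wpM2l// ltW.
by move=> h2; apply/andP; split; nra.
Qed.

Lemma sub1_expRN_ge (a : R) : 0 <= a <= 1 -> a / 2 <= 1 - expR (- a).
Proof.
move=> /andP[a0 a1]; have e0 := expR_gt0 (- a).
have h := expR_ge1Dx a.
have : expR a * expR (- a) = 1 by rewrite -expRD subrr expR0.
move: (expR (- a)) (expR a) e0 h => u v u0 h vu.
have : (1 + a) * u <= 1 by rewrite -[leRHS]vu ler_wpM2r// ltW.
by nra.
Qed.

(** The fourth power of exp a - 1 is at most 16 a^4, and a^3 n d^2 <= 1, so n times the increment is
    at most 32 a. The condition a <= 1 / 64 makes this at most 1 / 2, where (1 + x)^n - 1 <= 2 n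
    x. *)
Lemma time_error_le (n : nat) (a m d : R) : 0 < a <= 64^-1 -> 0 <= m <= 1 ->
  d ^+ 2 = m ^+ 2 / (1 + a ^+ 3 * n%:R) ->
  (1 + 2 * ((expR a - 1) ^+ 2 * d ^+ 2) * (expR a - 1) ^+ 2) ^+ n - 1 <= 64 * a.
Proof.
move=> /andP[a0 a1] /andP[m0 m1] dE.
have /andP[b0 b1] : 0 <= expR a - 1 <= 2 * a by apply: expR_sub1_le; apply/andP; split; lra.
set b := expR a - 1 in b0 b1 *.
have a3 : 0 <= a ^+ 3 * n%:R by rewrite mulr_ge0// exprn_ge0// ltW.
have D0 : 0 < 1 + a ^+ 3 * n%:R by rewrite ltr_pwDl.
have b2 : b ^+ 2 <= 4 * a ^+ 2 by nra.
have b4 : b ^+ 2 * b ^+ 2 <= 16 * a ^+ 4.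
  have -> : 16 * a ^+ 4 = (4 * a ^+ 2) * (4 * a ^+ 2) by ring.
  by apply: ler_pM; rewrite ?sqr_ge0.
have d2 : 0 <= d ^+ 2 := sqr_ge0 d.
have nd : a ^+ 3 * n%:R * d ^+ 2 <= 1.
  rewrite dE mulrA ler_pdivrMr// mul1r.
  have : m ^+ 2 <= 1 by rewrite expr_le1.
  have := sqr_ge0 m; nra.
set x := 2 * (b ^+ 2 * d ^+ 2) * b ^+ 2.
have x0 : 0 <= x.
  apply: mulr_ge0; last exact: sqr_ge0.
  by apply: mulr_ge0 => //; apply: mulr_ge0; exact: sqr_ge0.
have nx : n%:R * x <= 32 * a.
  have -> : n%:R * x = 2 * (n%:R * d ^+ 2) * (b ^+ 2 * b ^+ 2) by rewrite /x; ring.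
  apply: (@le_trans _ _ (2 * (n%:R * d ^+ 2) * (16 * a ^+ 4))).
    by apply: ler_wpM2l => //; apply: mulr_ge0 => //; apply: mulr_ge0.
  have -> : 2 * (n%:R * d ^+ 2) * (16 * a ^+ 4) = 32 * a * (a ^+ 3 * n%:R * d ^+ 2) by ring.
  by rewrite -[leRHS]mulr1 ler_wpM2l//; lra.
apply: (le_trans (exprn_1D_le x0 _)); lra.
Qed.

(** Dividing 1 / d^2 = (1 + a^3 n) / m^2 by a^2 n gives ((a^2 n)^-1 + a) / m^2. The constant 128 is
    32 times the 4 coming from 1 - exp (-a) >= a / 2. *)
Lemma freq_error_le (n a m d k : R) : 0 < n -> 0 < a <= 1 -> 0 < m -> 0 < k ->
  d ^+ 2 = m ^+ 2 / (1 + a ^+ 3 * n) ->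
  32 / (n * ((1 - expR (- a)) * (k * d)) ^+ 2) <=
  128 / (k * m) ^+ 2 * ((a ^+ 2 * n)^-1 + a).
Proof.
move=> n0 /andP[a0 a1] m0 k0 dE.
have b0 : a / 2 <= 1 - expR (- a) by apply: sub1_expRN_ge; apply/andP; split => //; exact: ltW.
have D0 : 0 < 1 + a ^+ 3 * n by rewrite ltr_pwDl// mulr_ge0 ?exprn_ge0// ltW.
have d2 : 0 < d ^+ 2 by rewrite dE divr_gt0// exprn_gt0.
have -> : 128 / (k * m) ^+ 2 * ((a ^+ 2 * n)^-1 + a) = 32 / (n * ((a / 2) ^+ 2 * (k ^+ 2 * d ^+ 2))).
  by rewrite dE; field; rewrite !gt_eqF.
have a20 : 0 < a / 2 by lra.
have kd : 0 < k ^+ 2 * d ^+ 2 by rewrite mulr_gt0// exprn_gt0.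
have pos x : 0 < x -> 0 < n * (x ^+ 2 * (k ^+ 2 * d ^+ 2)).
  by move=> x0; rewrite mulr_gt0// mulr_gt0// exprn_gt0.
have b00 : 0 < 1 - expR (- a) by apply: lt_le_trans b0.
rewrite ler_wpM2l// [in leLHS]exprMn [in leLHS](exprMn _ k) lef_pV2 ?posrE ?pos//.
rewrite ler_wpM2l ?(ltW n0)// ler_wpM2r ?(ltW kd)//.
by apply: lerXn2r; rewrite ?nnegrE// ltW.
Qed.

(** A constant density c lies strictly inside the class when 1 / M < c and (2 pi c)^2 < M. Such a c
    exists precisely when 1 / M < sqrt M / (2 pi), which is the hypothesis on M. *)
Lemma cosine_density_params (M s : R) : (2 * pi) `^ (2 / 3) < M ->
  exists c m : R, [/\ 0 < c, 0 < m <= 1 &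
    forall d, 0 <= d <= m -> sobolev_class M s (cosine_density c d)].
Proof.
move=> hM; have pi0 := pi_gt0 R; have p0 : 0 < 2 * pi :> R by lra.
have M0 : 0 < M by apply: le_lt_trans hM; exact: powR_ge0.
have M3 : (2 * pi) ^+ 2 < M ^+ 3.
  have <- : ((2 * pi) `^ (2 / 3)) ^+ 3 = (2 * pi) ^+ 2 :> R.
    rewrite -powR_mulrn ?powR_ge0// -powRrM.
    by rewrite (_ : 2 / 3 * 3%:R = 2%:R) ?powR_mulrn ?(ltW p0)//; field.
  by apply: ltrXn2r; rewrite ?nnegrE ?powR_ge0// ltW.
pose q := Num.sqrt M; have q0 : 0 < q by rewrite sqrtr_gt0.
have q2 : q ^+ 2 = M by rewrite sqr_sqrtr// ltW.
have h : M^-1 < q / (2 * pi).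
  rewrite ltr_pdivlMr// -(ltr_pM2l M0) mulrA mulfV ?gt_eqF// mul1r.
  have Mq : 0 <= M * q by rewrite ltW// mulr_gt0.
  rewrite -(@ltr_pXn2r _ 2) ?nnegrE ?(ltW p0)//.
  by rewrite [in ltRHS]exprMn q2 -exprSr.
pose c := (M^-1 + q / (2 * pi)) / 2.
have Mi0 : 0 < M^-1 by rewrite invr_gt0.
have mid (x y : R) : x < y -> x < (x + y) / 2 < y by move=> xy; apply/andP; split; lra.
have /andP[c1 c2] : M^-1 < c < q / (2 * pi).
  exact: mid h.
have c0 : 0 < c by apply: lt_trans c1.
have C2 : (2 * pi * c) ^+ 2 < M.
  rewrite -q2; apply: ltrXn2r; rewrite ?nnegrE ?(ltW q0) ?(ltW (mulr_gt0 p0 c0))//.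
  by rewrite mulrC -ltr_pdivlMr.
have C0 : 0 < (2 * pi * c) ^+ 2 by rewrite exprn_gt0// mulr_gt0.
(* The room left for d: [m1] by the lower bound c (1 - d) >= 1 / M, and [m2] by the Sobolev bound,
   using d^2 / 2 <= d. *)
pose m1 := 1 - M^-1 / c; pose m2 := M / (2 * pi * c) ^+ 2 - 1.
have m10 : 0 < m1 by rewrite subr_gt0 ltr_pdivrMr// mul1r.
have m20 : 0 < m2 by rewrite subr_gt0 ltr_pdivlMr// mul1r.
have m11 : m1 <= 1 by rewrite gerBl divr_ge0// ltW.
exists c, (Num.min m1 m2); split=> //.
  by rewrite lt_min m10 m20 ge_min m11.
move=> d /andP[d0]; rewrite le_min => /andP[d1 d2].
apply: cosine_density_class => //; first by rewrite d0 (le_trans d1).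
  have -> : M^-1 = c * (1 - m1) by rewrite /m1; field; rewrite !gt_eqF.
  by rewrite ler_wpM2l ?(ltW c0)//; lra.
rewrite mulrC -ler_pdivlMr// (_ : M / _ = 1 + m2); last by rewrite /m2 addrC subrK.
rewrite lerD2l; have : d <= 1 by exact: le_trans d1 m11.
by nra.
Qed.

End estimates.

Lemma two_point_bound (R : realType) (N : nat) (M s alpha c m d t r : R)
    (P Q : (R -> R) -> probability (N.-tuple (measurableTypeR R)) R) :
  (8 <= N)%N -> 0 < c -> 0 < m <= 1 -> 0 < d <= m -> 0 < alpha <= 64^-1 ->
  d ^+ 2 = m ^+ 2 / (1 + alpha ^+ 3 * N%:R) ->
  sobolev_class M s (cosine_density c 0) ->
  sobolev_class M s (cosine_density c d) ->
  (forall f, sobolev_class M s f -> time_law f (P f)) ->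
  (forall f, sobolev_class M s f -> freq_law f (Q f)) ->
  0 < t -> 64 * alpha <= t ^+ 2 ->
  128 / (normal_pdf 0 1 1 * (cos (pi / 4) / 8) * m) ^+ 2 *
    ((alpha ^+ 2 * N%:R)^-1 + alpha) <= r ->
  (((1 - r - t) / 2)%:E <= ldp_deficiency alpha (sobolev_class M s) P Q)%E.
Proof.
case: N P Q => [//|N] P Q N8 c0 /andP[m0 m1] /andP[d0 dm] /andP[a0 a1] dE S0 S1 hP hQ t0 ta hr.
have d1 : d <= 1 by exact: le_trans dm m1.
have pi0 := pi_gt0 R.
have k0 : 0 < cos (pi / 4) :> R by apply: cos_gt0_pihalf; apply/andP; split; lra.
have k'0 : 0 < normal_pdf 0 1 1 * (cos (pi / 4) / 8) :> R.
  by rewrite mulr_gt0 ?divr_gt0// std_normal_pdfE mulr_gt0 ?normal_peak_gt0 ?expR_gt0.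
have dd1 : 0 < d <= 1 by rewrite d0.
have [K [A [mA hA]]] := freq_cosine_bound c0 dd1 (hQ _ S0) (hQ _ S1) a0 N8.
apply: (ldp_deficiency_ge S0 S1 mA _ (ltW t0)); last first.
  move=> K' B mB; apply: (@time_cosine_bound R N alpha c d) => //.
  - by rewrite (ltW d0).
  - exact: hP.
  - exact: hP.
  - exact: ltW.
  - have /andP[b0 b1] : 0 <= expR alpha - 1 <= 2 * alpha.
      by apply: expR_sub1_le; rewrite (ltW a0)/=; lra.
    by nra.
  - apply: le_trans ta; apply: (time_error_le (m := m)) => //; first by rewrite a0.
    by rewrite (ltW m0).
apply: le_trans hA; rewrite lerD2l lerN2; apply: le_trans hr.
have a01 : 0 < alpha <= 1 by rewrite a0/=; lra.
have := @freq_error_le R N.+1%:R alpha m d _ _ a01 m0 k'0 dE.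
rewrite ltr0n => /(_ isT); congr (_ <= _); congr (_ / (_ * _ ^+ 2)); congr (_ * _).
by move: (cos _) => k; field.
Qed.

Theorem proposition6 (R : realType) (M s : R)
  (P Q : forall N : nat, (R -> R) -> probability (N.-tuple (measurableTypeR R)) R)
  (alpha : nat -> R)
  (hM : (2 * pi) `^ (2 / 3) < M) (hs : 1 / 2 < s)
  (hP : forall N f, (0 < N)%N -> sobolev_class M s f -> time_law f (P N f))
  (hQ : forall N f, (0 < N)%N -> sobolev_class M s f -> freq_law f (Q N f))
  (alpha_gt0 : forall N, (0 < N)%N -> 0 < alpha N)
  (alpha_to0 : alpha N @[N --> \oo] --> 0)
  (alpha2N_toy : alpha N ^+ 2 * N%:R @[N --> \oo] --> +oo) :
  ((1 / 2)%:E <=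
   limn_einf (fun N => ldp_deficiency (alpha N) (sobolev_class M s) (P N) (Q N)))%E.
Proof.
have [c [m [c0 m01 Sc]]] := cosine_density_params s hM.
have /andP[m0 m1] := m01; have pi0 := pi_gt0 R.
have k0 : 0 < cos (pi / 4) :> R by apply: cos_gt0_pihalf; apply/andP; split; lra.
set k : R := normal_pdf 0 1 1 * (cos (pi / 4) / 8).
have kpos : 0 < k.
  by rewrite mulr_gt0 ?divr_gt0// std_normal_pdfE mulr_gt0 ?normal_peak_gt0 ?expR_gt0.
set C : R := 128 / (k * m) ^+ 2.
have C0 : 0 < C by rewrite divr_gt0// exprn_gt0// mulr_gt0.
apply/lee_addgt0Pr => e e0.
have C2 : 0 < 2 * C / e by rewrite divr_gt0// mulr_gt0.
(* The three thresholds give the smallness asked by the time bound, then 64 alpha <= e^2 so that t =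
   e is allowed, and C alpha <= e / 2. *)
pose b := Num.min (64^-1) (Num.min (e ^+ 2 / 64) ((2 * C / e)^-1)).
have b0 : 0 < b by rewrite !lt_min invr_gt0 ltr0n/= divr_gt0 ?exprn_gt0//= invr_gt0.
have ev1 : \forall N \near \oo, `|alpha N| < b.
  by move/cvgr0Pnorm_lt : alpha_to0; exact.
(* The 8 forces N >= 8, since alpha N <= 1; the other term makes C / (alpha^2 N) at most e / 2, so
   that r = e is allowed. *)
have ev2 : \forall N \near \oo, 8 + 2 * C / e <= alpha N ^+ 2 * N%:R.
  by move/cvgryPge : alpha2N_toy; exact.
have ev : \forall N \near \oo, [/\ (0 < N)%N, `|alpha N| < b &
    8 + 2 * C / e <= alpha N ^+ 2 * N%:R].
  near=> N; split.
  - by near: N; exact: nbhs_infty_gt.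
  - by near: N; exact: ev1.
  - by near: N; exact: ev2.
have [n _ hn] := ev; rewrite -leeBlDr//.
apply: (limn_einf_ge (n := n)) => N nN.
have [N0 ab aN] := hn N nN.
have a0 := alpha_gt0 N N0.
rewrite (gtr0_norm a0) !lt_min in ab; have /and3P[a64 ae aC] := ab.
set D := 1 + alpha N ^+ 3 * N%:R.
have D1 : 1 <= D by rewrite lerDl mulr_ge0// exprn_ge0// ltW.
have D0 : 0 < D by exact: lt_le_trans D1.
pose d := m / Num.sqrt D.
have sD0 : 0 < Num.sqrt D by rewrite sqrtr_gt0.
have d0 : 0 < d by rewrite divr_gt0.
have dm : d <= m.
  by rewrite ler_pdivrMr// ler_peMr ?(ltW m0)// -[leLHS]sqrtr1 ler_wsqrtr.
have a2N0 : 0 < alpha N ^+ 2 * N%:R by lra.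
have N8 : (8 <= N)%N.
  rewrite -(ler_nat R); apply: (@le_trans _ _ (alpha N ^+ 2 * N%:R)); first by lra.
  rewrite ler_piMl// expr_le1 ?(ltW a0)//; lra.
have -> : ((1 / 2)%:E - e%:E = ((1 - e - e) / 2)%:E)%E.
  by rewrite -EFinB; congr EFin; field.
apply: (@two_point_bound R N M s (alpha N) c m d e e (P N) (Q N)) => //.
- by rewrite d0.
- by rewrite a0 ltW.
- by rewrite expr_div_n sqr_sqrtr// ltW.
- by apply: Sc; rewrite lexx ltW.
- by apply: Sc; rewrite dm ltW.
- by move=> f; exact: hP.
- by move=> f; exact: hQ.
- by rewrite mulrC -ler_pdivlMr// ltW.
rewrite -/k -/C.
have i0 : (alpha N ^+ 2 * N%:R)^-1 <= (2 * C / e)^-1.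
  by rewrite lef_pV2 ?posrE//; lra.
have -> : e = C * ((2 * C / e)^-1 + (2 * C / e)^-1) by field; rewrite !gt_eqF.
by rewrite ler_wpM2l ?(ltW C0)// lerD// ltW.
Unshelve. all: by end_near.
Qed.
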